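(* For $m\ge1$, $u$ a parameter and $S\subseteq\{1,\dots,m\}$ let $r_S=\lfloor|S|/2\rfloor$ and $g_S(x)=\frac{q^{r_S^2}}{(ac)^{r_S}}\prod_{i\in S}x_i$ if $|S|$ is even, $g_S(x)=\frac{q^{r_S^2}}{(ac)^{r_S}}\prod_{i\in\bar S}x_i$ if $|S|$ is odd. Then $$Z^{\mathrm e}_m(u;x_1,\dots,x_m)+Z^{\mathrm o}_m(u;x_1,\dots,x_m)=\sum_{S\subseteq\{1,\dots,m\}}(-u)^{|S|}g_S(x)\prod_{i\in S}h(x_i)\prod_{i\in S,\,j\in\bar S}\frac{x_ix_j-1}{x_i-x_j}\prod_{i<j,\ i,j\in S}\frac{1-x_ix_j}{1-qx_ix_j},$$ and, denoting this common quantity by $Z_m(u;x_1,\dots,x_m)$, one has $Z_m(x_1,\dots,x_m)=Z_m(1;x_1,\dots,x_m)$.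
   Context: Fix complex $q,a,c$ and a choice of $q^{1/2}$. Edge states in $\{0,1\}$. Bulk weights $R_z(i,j;k,l)$: $1$ for $(0,0,0,0)$, $(1,1,1,1)$; $\frac{q(1-z)}{1-qz}$ for $(1,0,1,0)$; $\frac{1-q}{1-qz}$ for $(1,0,0,1)$; $\frac{1-z}{1-qz}$ for $(0,1,0,1)$; $\frac{z(1-q)}{1-qz}$ for $(0,1,1,0)$; $0$ otherwise ($i$ incoming bottom, $j$ incoming left, $k$ outgoing top, $l$ outgoing right). $h(x)=\frac{ac(1-x^2)}{(a-x)(c-x)}$, $K_x(0;0)=1-h(x)$, $K_x(0;1)=h(x)$, $K_x(1;0)=-h(x)/(ac)$, $K_x(1;1)=1+h(x)/(ac)$ (incoming; outgoing). $Z_m(x_1,\dots,x_m)$ is the partition function of the lattice with $m$ upward lines: line $i$ (parameter $x_i$) enters from the bottom in state $0$, crosses horizontal rows $1,\dots,i-1$, meets a boundary vertex of weight $K_{x_i}(s;s')$ ($s$ arriving from below, $s'$ leaving to the right), then continues as horizontal row $i$ moving right across vertical lines $i+1,\dots,m$ and exits on the right in state $0$. The crossing of vertical line $i$ with row $j$ ($j<i$) has weight $R_{x_ix_j}(b,\ell;t,r)$ ($b,t$ bottom/top, $\ell,r$ left/right states). Let $S(x,y)=\frac{x-y}{1-xy}$, $Q^{\mathrm e}(x_i,x_j)=S(x_i,x_j)+\frac{u^2q^{1/2}}{ac}x_ix_jh(x_i)h(x_j)S(q^{1/2}x_i,q^{1/2}x_j)$, $Q^{\mathrm o}(x_i,x_j)=x_ix_jS(x_i,x_j)+\frac{u^2}{q^{1/2}ac}h(x_i)h(x_j)S(q^{1/2}x_i,q^{1/2}x_j)$.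 For $n\ge1$: $Z^{\mathrm e}_{2n}(u;x_1,\dots,x_{2n})=\prod_{i<j}\frac{1-x_ix_j}{x_i-x_j}\mathrm{Pf}(Q^{\mathrm e}(x_i,x_j))_{1\le i,j\le 2n}$; $Z^{\mathrm o}_{2n-1}(u;x_1,\dots,x_{2n-1})=\prod_{i<j\le 2n-1}\frac{1-x_ix_j}{x_i-x_j}\mathrm{Pf}(M)$ where $M$ is the $2n\times2n$ skew-symmetric matrix with $M_{ij}=Q^{\mathrm o}(x_i,x_j)$ for $i,j\le 2n-1$, $M_{i,2n}=-uh(x_i)$, $M_{2n,j}=uh(x_j)$, $M_{2n,2n}=0$; $Z^{\mathrm e}_{2n-1}(u;x_1,\dots,x_{2n-1})=Z^{\mathrm e}_{2n}(u;x_1,\dots,x_{2n-1},1)$; $Z^{\mathrm o}_{2n}(u;x_1,\dots,x_{2n})=Z^{\mathrm o}_{2n+1}(u;x_1,\dots,x_{2n},1)$. $\bar S$ is the complement of $S$ in $\{1,\dots,m\}$. *)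

(* Defs.v *)
From mathcomp Require Import all_boot all_order all_algebra all_fingroup.

Set Implicit Arguments.
Unset Strict Implicit.
Unset Printing Implicit Defensive.

Import GRing.Theory.
Local Open Scope ring_scope.

Section Pfaffian.
Variables (F : fieldType) (n : nat).

Lemma pf_snd_proof (k : 'I_n./2) : (k.*2.+1 < n)%N.
Proof. by rewrite -gtn_half_double ltn_ord. Qed.

Lemma pf_fst_proof (k : 'I_n./2) : (k.*2 < n)%N.
Proof. exact: ltnW (pf_snd_proof k). Qed.

Definition pf_fst (k : 'I_n./2) : 'I_n := Ordinal (pf_fst_proof k).
Definition pf_snd (k : 'I_n./2) : 'I_n := Ordinal (pf_snd_proof k).

(* Only used on skew-symmetric matrices over a field of characteristic 0;
   the Pfaffian in odd dimension is 0 by convention. *)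
Definition pfaffian (A : 'M[F]_n) : F :=
  if odd n then 0
  else ((2 ^ n./2 * (n./2)`!)%:R)^-1 *
       \sum_(s : 'S_n) (-1) ^+ s * \prod_(k < n./2) A (s (pf_fst k)) (s (pf_snd k)).

End Pfaffian.

Section Model.
Variables (F : fieldType) (q a c : F).

(* States 0 and 1 are false and true.
   bulkR z bottom left top right; bdryK x incoming outgoing. *)
Definition bulkR (z : F) (i j k l : bool) : F :=
  match i, j, k, l with
  | false, false, false, false => 1
  | true, true, true, true => 1
  | true, false, true, false => q * (1 - z) / (1 - q * z)
  | true, false, false, true => (1 - q) / (1 - q * z)
  | false, true, false, true => (1 - z) / (1 - q * z)
  | false, true, true, false => z * (1 - q) / (1 - q * z)
  | _, _, _, _ => 0
  end.

Definition hfun (x : F) : F := a * c * (1 - x ^+ 2) / ((a - x) * (c - x)).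

Definition bdryK (x : F) (s s' : bool) : F :=
  match s, s' with
  | false, false => 1 - hfun x
  | false, true => hfun x
  | true, false => - hfun x / (a * c)
  | true, true => 1 + hfun x / (a * c)
  end.

(* With lines numbered from 0, line i meets m vertices in the order 0, ..., m-1:
   vertex k <> i is its crossing with line k (horizontal row k if k < i,
   vertical line k if k > i) and vertex i is its boundary vertex.  So line i has
   m+1 edges, and e i k is the state of the edge just before vertex k: vertical
   for k <= i, horizontal for k > i; e i 0 is the bottom edge and e i m the
   right-hand exit edge. *)
Definition before (m : nat) (k : 'I_m) : 'I_m.+1 := widen_ord (leqnSn m) k.
Definition after (m : nat) (k : 'I_m) : 'I_m.+1 := lift ord0 k.

Definition config_weight (m : nat) (x : 'rV[F]_m) (e : 'M[bool]_(m, m.+1)) : F :=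
  (\prod_(i < m) bdryK (x 0 i) (e i (before i)) (e i (after i))) *
  \prod_(i < m) \prod_(j < m | (j < i)%N)
     bulkR (x 0 i * x 0 j) (e i (before j)) (e j (before i))
                           (e i (after j)) (e j (after i)).

Definition partition_function (m : nat) (x : 'rV[F]_m) : F :=
  \sum_(e : 'M[bool]_(m, m.+1) |
          [forall i, (e i ord0 == false) && (e i ord_max == false)])
     config_weight x e.

Definition Sfun (x y : F) : F := (x - y) / (1 - x * y).

(* In what follows qh stands for the chosen square root of q. *)
Definition Qe (qh u x y : F) : F :=
  Sfun x y + u ^+ 2 * qh / (a * c) * x * y * hfun x * hfun y *
             Sfun (qh * x) (qh * y).

Definition Qo (qh u x y : F) : F :=
  x * y * Sfun x y + u ^+ 2 / (qh * a * c) * hfun x * hfun y *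
                     Sfun (qh * x) (qh * y).

Definition prefactor (m : nat) (x : 'rV[F]_m) : F :=
  \prod_(i < m) \prod_(j < m | (i < j)%N)
     ((1 - x 0 i * x 0 j) / (x 0 i - x 0 j)).

(* Z^e for an even number of variables and Z^o for an odd number. *)
Definition Ze_pf (qh u : F) (m : nat) (x : 'rV[F]_m) : F :=
  prefactor x * pfaffian (\matrix_(i < m, j < m) Qe qh u (x 0 i) (x 0 j)).

Definition Zo_pf (qh u : F) (m : nat) (x : 'rV[F]_m) : F :=
  prefactor x *
  pfaffian (block_mx (\matrix_(i < m, j < m) Qo qh u (x 0 i) (x 0 j))
                     (\col_(i < m) - (u * hfun (x 0 i)))
                     (\row_(j < m) (u * hfun (x 0 j)))
                     (0 : 'M_1)).

Definition append1 (m : nat) (x : 'rV[F]_m) : 'rV[F]_(m + 1) :=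
  row_mx x (const_mx 1).

Definition Ze (qh u : F) (m : nat) (x : 'rV[F]_m) : F :=
  if odd m then Ze_pf qh u (append1 x) else Ze_pf qh u x.

Definition Zo (qh u : F) (m : nat) (x : 'rV[F]_m) : F :=
  if odd m then Zo_pf qh u x else Zo_pf qh u (append1 x).

Definition gfun (m : nat) (x : 'rV[F]_m) (S : {set 'I_m}) : F :=
  let r := #|S|./2 in
  q ^+ (r ^ 2) / (a * c) ^+ r *
  \prod_(i in if odd #|S| then ~: S else S) x 0 i.

Definition Zsum (u : F) (m : nat) (x : 'rV[F]_m) : F :=
  \sum_(S : {set 'I_m})
     (- u) ^+ #|S| * gfun x S * (\prod_(i in S) hfun (x 0 i)) *
     (\prod_(i in S) \prod_(j in ~: S)
         ((x 0 i * x 0 j - 1) / (x 0 i - x 0 j))) *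
     \prod_(i in S) \prod_(j in S | (i < j)%N)
         ((1 - x 0 i * x 0 j) / (1 - q * x 0 i * x 0 j)).

End Model.

(* Main.v *)
(* Lattice side.  A line is a site carrying one bit, a vertex is a local operator on one
   or two sites, and the partition function is a vacuum matrix element of a product of such
   operators.  The Yang-Baxter and reflection equations make it symmetric in the lines.
   Setting x_i = 0 kills it, x_i = 1 or -1 removes line i (there K is the identity), and
   x_i x_j = 1 removes both lines i and j (the crossing exchanges the lines and K_x K_(1/x)
   is the identity).  At u = 1 the subset sum obeys the same rules, its apparent poles at
   x_i = x_j cancel, and so does its linear growth at infinity; these values exceed the
   degree in x_i, so both sides agree by interpolation, first for generic parameters and
   then, both sides being rational and regular along the line obtained by adding t to all
   parameters, for all admissible ones.

   Pfaffian side.  Multiplied by the product of (1 - x_i x_j) / (x_i - x_j), a Pfaffian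
   becomes a function of the set of indices alone, characterised by its average expansion
   along all pairs of indices.  In this form the Pfaffian of a sum is a sum over subsets,
   and Schur's Pfaffian evaluates both summands of Qe and Qo (for Qo the border is an
   additional variable equal to 1).  The result is the part of the subset sum of even,
   resp. odd, degree in u; appending x = 1 changes nothing since h(1) = 0. *)

Require Import Defs.
From mathcomp Require Import all_boot all_order all_algebra.
From mathcomp Require Import all_fingroup.
From mathcomp Require Import ring boolp.
From mathcomp Require Import reals complex.

Set Implicit Arguments.
Unset Strict Implicit.
Unset Printing Implicit Defensive.

Import GRing.Theory Num.Theory.
Local Open Scope ring_scope.

(** * Local operators, Yang-Baxter and reflection equations *)

(** The interpolation is tight. With [n] lines beside line [i], the numerator of the lattice in
    [x i] has degree [n + 2]; bringing in the apparent poles raises the degree of the difference to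
    [2n + 2], against the [2n + 3] roots 0, 1, -1, the [n] inverses and the [n] apparent poles
    themselves. The cancellation of the top coefficient is therefore indispensable, and it is what
    dictates the powers of [q] and [a * c] in [g]. Together with the zero at 0 it is where [u = 1]
    enters. For special parameters some of these roots collide. The common shift by [t] leaves
    [x i - x j], [x i - a] and [x i - c] alone and turns every other condition into a generic one.
    Expanding a Pfaffian along all ordered pairs, rather than along one row, makes the sum rule
    direct: a pair lies in [S] or in its complement, and the weights [#|S|] and [#|T :\: S|] add up
    to [#|T|]. The square roots that write the second summands of [Qe] and [Qo] as
    [lam i * lam j * sig i j] call for a closed field. *)

Section Ops.
Variables (F : fieldType) (I : finType).
Implicit Types (s : {ffun I -> bool}) (f g : {ffun I -> bool} -> F) (i j k : I).

Definition upd s i b : {ffun I -> bool} := [ffun k => if k == i then b else s k].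

(** Operators act on functions of the incoming states: [f] is the weight of all that follows, so the
    outermost operator is the first vertex met. *)
Definition op1 i (K : bool -> bool -> F) f s : F :=
  \sum_(b : bool) K (s i) b * f (upd s i b).

Definition op2 i j (W : bool -> bool -> bool -> bool -> F) f s : F :=
  \sum_(b : bool) \sum_(b' : bool) W (s i) (s j) b b' * f (upd (upd s i b) j b').

Lemma upd_same s i b : upd s i b i = b. Proof. by rewrite ffunE eqxx. Qed.
Lemma upd_neq s i k b : k != i -> upd s i b k = s k.
Proof. by rewrite ffunE => /negbTE ->. Qed.
Lemma upd_upd s i b b' : upd (upd s i b) i b' = upd s i b'.
Proof. by apply/ffunP => k; rewrite !ffunE; case: eqP. Qed.
Lemma upd_id s i : upd s i (s i) = s.
Proof. by apply/ffunP => k; rewrite !ffunE; case: eqP => // ->. Qed.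
Lemma upd_idP s i b : s i = b -> upd s i b = s.
Proof. by move=> <-; exact: upd_id. Qed.
Lemma updC s i j b b' : i != j -> upd (upd s i b) j b' = upd (upd s j b') i b.
Proof.
move=> ij; apply/ffunP => k; rewrite !ffunE; case: (eqVneq k j) => // ->.
by rewrite eq_sym (negbTE ij).
Qed.

Lemma op2_op2C i j k l V W f : k != i -> k != j -> l != i -> l != j ->
  op2 i j V (op2 k l W f) = op2 k l W (op2 i j V f).
Proof.
move=> ki kj li lj; apply: funext => s; rewrite /op2 !big_bool /= !(@upd_neq _ _ k) // !(@upd_neq _ _ l) //.
rewrite ?(@upd_neq _ k) ?(@upd_neq _ l) 1?eq_sym //.
have E a b d e : upd (upd (upd (upd s i a) j b) k d) l e =
                 upd (upd (upd (upd s k d) l e) i a) j b.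
  rewrite [upd (upd _ j b) k d]updC 1?eq_sym // [upd (upd _ i a) k d]updC 1?eq_sym //.
  by rewrite [upd (upd _ j b) l e]updC 1?eq_sym // [upd (upd _ i a) l e]updC // eq_sym.
rewrite !E !(@upd_neq _ _ i) 1?eq_sym // !(@upd_neq _ _ j) 1?eq_sym //.
ring.
Qed.

Lemma op1_op2C i k l K W f : k != i -> l != i ->
  op1 i K (op2 k l W f) = op2 k l W (op1 i K f).
Proof.
move=> ki li; apply: funext => s; rewrite /op2 /op1 !big_bool /=.
rewrite !(@upd_neq _ _ k) // !(@upd_neq _ _ l) // !(@upd_neq _ _ i) 1?eq_sym //.
have E a d e : upd (upd (upd s i a) k d) l e = upd (upd (upd s k d) l e) i a.
  by rewrite [upd (upd _ i a) k d]updC 1?eq_sym // [upd (upd _ i a) l e]updC // eq_sym.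
rewrite !E; ring.
Qed.

Section TwoSites.
Variables (i j : I) (ij : i != j) (s : {ffun I -> bool}).

(* Locked, so that nested updates are only normalised by the lemmas below. *)
Fact st2_key : unit. Proof. exact: tt. Qed.
Definition st2 := locked_with st2_key (fun a b => upd (upd s i a) j b).

Lemma st2_eta : s = st2 (s i) (s j).
Proof. by rewrite [st2]unlock !upd_id. Qed.

Lemma st2E a b : st2 a b = upd (upd s i a) j b.
Proof. by rewrite [st2]unlock. Qed.

Lemma st2_i a b : st2 a b i = a.
Proof. by rewrite st2E upd_neq // upd_same. Qed.

Lemma st2_j a b : st2 a b j = b.
Proof. by rewrite st2E upd_same. Qed.

Lemma op1_st2_i K f a b :
  op1 i K f (st2 a b) = K a true * f (st2 true b) + K a false * f (st2 false b).
Proof.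
rewrite /op1 big_bool /= [st2]unlock.
by rewrite upd_neq // upd_same ![upd (upd _ j _) i _]updC 1?eq_sym // !upd_upd.
Qed.

Lemma op1_st2_j K f a b :
  op1 j K f (st2 a b) = K b true * f (st2 a true) + K b false * f (st2 a false).
Proof. by rewrite /op1 big_bool /= [st2]unlock upd_same !upd_upd. Qed.

Lemma op2_st2 W f a b :
  op2 i j W f (st2 a b) =
    W a b true true * f (st2 true true) + W a b true false * f (st2 true false)
  + (W a b false true * f (st2 false true) + W a b false false * f (st2 false false)).
Proof.
rewrite /op2 !big_bool /= [st2]unlock upd_same upd_neq // upd_same.
by rewrite ![upd (upd _ j _) i _]updC 1?eq_sym // !upd_upd.
Qed.

Lemma op2_st2' W f a b :
  op2 j i W f (st2 a b) =
    W b a true true * f (st2 true true) + W b a true false * f (st2 false true)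
  + (W b a false true * f (st2 true false) + W b a false false * f (st2 false false)).
Proof.
rewrite /op2 !big_bool /= [st2]unlock upd_same upd_neq // upd_same !upd_upd.
by rewrite ![upd (upd _ j _) i _]updC 1?eq_sym // !upd_upd.
Qed.
End TwoSites.

Section ThreeSites.
Variables (i j k : I) (ij : i != j) (ik : i != k) (jk : j != k) (s : {ffun I -> bool}).

Fact st3_key : unit. Proof. exact: tt. Qed.
Definition st3 := locked_with st3_key (fun a b c => upd (upd (upd s i a) j b) k c).

Lemma st3_eta : s = st3 (s i) (s j) (s k).
Proof. by rewrite [st3]unlock !upd_id. Qed.

Lemma st3_i a b c : st3 a b c i = a.
Proof. by rewrite [st3]unlock upd_neq // upd_neq // upd_same. Qed.
Lemma st3_j a b c : st3 a b c j = b.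
Proof. by rewrite [st3]unlock upd_neq // upd_same. Qed.
Lemma st3_k a b c : st3 a b c k = c.
Proof. by rewrite [st3]unlock upd_same. Qed.
Lemma upd_st3_i a b c d : upd (st3 a b c) i d = st3 d b c.
Proof.
by rewrite [st3]unlock updC 1?eq_sym // [upd (upd _ j b) i d]updC 1?eq_sym // upd_upd.
Qed.
Lemma upd_st3_j a b c d : upd (st3 a b c) j d = st3 a d c.
Proof. by rewrite [st3]unlock updC 1?eq_sym // upd_upd. Qed.
Lemma upd_st3_k a b c d : upd (st3 a b c) k d = st3 a b d.
Proof. by rewrite [st3]unlock upd_upd. Qed.

Lemma op2_st3_ij W f a b c :
  op2 i j W f (st3 a b c) =
    W a b true true * f (st3 true true c) + W a b true false * f (st3 true false c)
  + (W a b false true * f (st3 false true c) + W a b false false * f (st3 false false c)).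
Proof. by rewrite /op2 !big_bool /= st3_i st3_j !upd_st3_i !upd_st3_j. Qed.

Lemma op2_st3_ik W f a b c :
  op2 i k W f (st3 a b c) =
    W a c true true * f (st3 true b true) + W a c true false * f (st3 true b false)
  + (W a c false true * f (st3 false b true) + W a c false false * f (st3 false b false)).
Proof. by rewrite /op2 !big_bool /= st3_i st3_k !upd_st3_i !upd_st3_k. Qed.

Lemma op2_st3_jk W f a b c :
  op2 j k W f (st3 a b c) =
    W b c true true * f (st3 a true true) + W b c true false * f (st3 a true false)
  + (W b c false true * f (st3 a false true) + W b c false false * f (st3 a false false)).
Proof. by rewrite /op2 !big_bool /= st3_j st3_k !upd_st3_j !upd_st3_k. Qed.

Lemma op2_st3_ki W f a b c :
  op2 k i W f (st3 a b c) =
    W c a true true * f (st3 true b true) + W c a true false * f (st3 false b true)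
  + (W c a false true * f (st3 true b false) + W c a false false * f (st3 false b false)).
Proof. by rewrite /op2 !big_bool /= st3_i st3_k !upd_st3_k !upd_st3_i. Qed.

Lemma op2_st3_kj W f a b c :
  op2 k j W f (st3 a b c) =
    W c b true true * f (st3 a true true) + W c b true false * f (st3 a false true)
  + (W c b false true * f (st3 a true false) + W c b false false * f (st3 a false false)).
Proof. by rewrite /op2 !big_bool /= st3_j st3_k !upd_st3_k !upd_st3_j. Qed.
End ThreeSites.

Section Model.
Variables (q a c : F).
(* The numerators of the bulk weights with spectral parameter x / y. *)
Definition braid (x y : F) (i j k l : bool) : F :=
  match i, j, k, l with
  | false, false, false, false => y - q * x
  | true, true, true, true => y - q * x
  | true, false, true, false => q * (y - x)
  | true, false, false, true => (1 - q) * y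
  | false, true, false, true => y - x
  | false, true, true, false => x * (1 - q)
  | _, _, _, _ => 0
  end.
(** [braid] exchanges two lines that both run upwards, [braidT] two lines that both run to the
    right. *)
Definition braidT x y (i j k l : bool) := braid x y j i l k.

(** An identity of rational functions on each of the eight states of the three sites. The exchange
    of [i] and [j] carries only numerators, so dividing by [y - q * x] is postponed to
    [zlat_swap]. *)
Lemma yang_baxter_vertical x y z i j k f : i != j -> i != k -> j != k ->
  1 - q * (x * z) != 0 -> 1 - q * (y * z) != 0 ->
  op2 i j (braid x y) (op2 i k (bulkR q (x * z)) (op2 j k (bulkR q (y * z)) f)) =
  op2 j k (bulkR q (y * z)) (op2 i k (bulkR q (x * z)) (op2 i j (braid x y) f)).
Proof.
move=> ij ik jk nx ny; apply: funext => s; rewrite (st3_eta i j k s).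
move: (s i) (s j) (s k) => b1 b2 b3.
rewrite op2_st3_ij // !op2_st3_ik // !op2_st3_jk // !op2_st3_ik // !op2_st3_ij //.
set G := fun a b c => f (st3 i j k s a b c).
rewrite -!/(G _ _ _); move: G => G.
case: b1 b2 b3 => [] [] [] /=; rewrite ?(mul0r, mul1r, addr0, add0r);
  by field; rewrite ?nx ?ny.
Qed.

Lemma yang_baxter_horizontal x y z i j k f : i != j -> i != k -> j != k ->
  1 - q * (z * x) != 0 -> 1 - q * (z * y) != 0 ->
  op2 i j (braidT x y) (op2 k i (bulkR q (z * x)) (op2 k j (bulkR q (z * y)) f)) =
  op2 k j (bulkR q (z * y)) (op2 k i (bulkR q (z * x)) (op2 i j (braidT x y) f)).
Proof.
move=> ij ik jk nx ny; apply: funext => s; rewrite (st3_eta i j k s).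
move: (s i) (s j) (s k) => b1 b2 b3.
rewrite op2_st3_ij // !op2_st3_ki // !op2_st3_kj // !op2_st3_ki // !op2_st3_ij //.
set G := fun a b c => f (st3 i j k s a b c).
rewrite -!/(G _ _ _) /braidT; move: G => G.
case: b1 b2 b3 => [] [] [] /=; rewrite ?(mul0r, mul1r, addr0, add0r);
  by field; rewrite ?nx ?ny.
Qed.

(** The boundary turns both lines from vertical to horizontal, hence [braid] becomes [braidT]. *)
Lemma reflection_equation x y i j f : i != j ->
  1 - q * (y * x) != 0 -> a != 0 -> c != 0 ->
  x != a -> x != c -> y != a -> y != c ->
  op2 i j (braid x y) (op1 i (bdryK a c x) (op2 j i (bulkR q (y * x)) (op1 j (bdryK a c y) f))) =
  op1 j (bdryK a c y) (op2 i j (bulkR q (x * y)) (op1 i (bdryK a c x) (op2 i j (braidT x y) f))).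
Proof.
move=> ij nx a0 c0 xa xc ya yc; apply: funext => s; rewrite (st2_eta i j s).
rewrite [x * y]mulrC.
have {}xa : a - x != 0 by rewrite subr_eq0 eq_sym.
have {}ya : a - y != 0 by rewrite subr_eq0 eq_sym.
have {}xc : c - x != 0 by rewrite subr_eq0 eq_sym.
have {}yc : c - y != 0 by rewrite subr_eq0 eq_sym.
move: (s i) (s j) => b1 b2.
rewrite op2_st2 // !op1_st2_i // !op2_st2' // !op1_st2_j // !op2_st2 // !op1_st2_i // !op2_st2 //.
set G := fun a b => f (st2 i j s a b).
rewrite -!/(G _ _) /braidT; move: G => G.
case: b1 b2 => [] [] /=; rewrite ?(mul0r, mul1r, addr0, add0r) /hfun; by field;  rewrite ?nx ?xa ?ya ?xc ?yc ?a0 ?c0.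
Qed.
End Model.
End Ops.

(** * The lattice as a product of local operators *)

Section Lattice.
Variables (F : fieldType) (I : finType) (q a c : F) (x : I -> F).
Implicit Types (s : {ffun I -> bool}) (f g : {ffun I -> bool} -> F).
Implicit Types (i j k : I) (p l : seq I).

Definition bulk i j := bulkR q (x i * x j).

Definition rowcross i p f := foldr (fun j => op2 i j (bulk i j)) f p.

Definition rowop i p f := rowcross i p (op1 i (bdryK a c (x i)) f).

(** [p] lists the lines that have already become rows; each line of [l] crosses them in turn, is
    reflected, and joins them at the end. *)
Fixpoint lattice p l f : {ffun I -> bool} -> F :=
  if l is i :: l' then rowop i p (lattice (rcons p i) l' f) else f.

Definition vacuum : {ffun I -> bool} := [ffun=> false].

Definition vacuum_ind s : F := (s == vacuum)%:R.

Definition zlat l := lattice [::] l vacuum_ind vacuum.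

Lemma rowcross_cat i p1 p2 f : rowcross i (p1 ++ p2) f = rowcross i p1 (rowcross i p2 f).
Proof. exact: foldr_cat. Qed.

Lemma lattice_cat p l1 l2 f :
  lattice p (l1 ++ l2) f = lattice p l1 (lattice (p ++ l1) l2 f).
Proof.
elim: l1 p => [|i l1 IH] p /=; first by rewrite cats0.
by rewrite IH cat_rcons.
Qed.

Lemma op2_rowcross i k j W p f : i \notin p -> k \notin p -> j != i -> j != k ->
  op2 i k W (rowcross j p f) = rowcross j p (op2 i k W f).
Proof.
move=> ip kp ji jk; elim: p ip kp => //= n p IH.
rewrite !inE !negb_or => /andP[ni ip] /andP[nk kp].
by rewrite op2_op2C ?IH // eq_sym.
Qed.

Lemma op2_rowop i k j W p f : i \notin p -> k \notin p -> j != i -> j != k ->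
  op2 i k W (rowop j p f) = rowop j p (op2 i k W f).
Proof.
by move=> ip kp ji jk; rewrite op2_rowcross // -op1_op2C // eq_sym.
Qed.

Lemma op2_lattice i k W p l f :
  i \notin p -> k \notin p -> i \notin l -> k \notin l ->
  op2 i k W (lattice p l f) = lattice p l (op2 i k W f).
Proof.
elim: l p f => //= j l IH p f ip kp; rewrite !inE !negb_or => /andP[ij il] /andP[kj kl].
by rewrite op2_rowop 1?eq_sym // IH // mem_rcons inE negb_or ?ij ?kj.
Qed.

Definition paircross i j p f :=
  foldr (fun k g => op2 i k (bulk i k) (op2 j k (bulk j k) g)) f p.

(** Vertices without a common line commute, so the two lines may meet each row of [p] together; this
    lets an exchange of them pass one row at a time. *)
Lemma rowcross_pair i j K p f : i != j -> i \notin p -> j \notin p -> uniq p ->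
  rowcross i p (op1 i K (rowcross j p f)) = paircross i j p (op1 i K f).
Proof.
move=> ij; elim: p => //= k p IH; rewrite !inE !negb_or => /andP[ik ip] /andP[jk jp] /andP[kp up].
by rewrite op1_op2C 1?eq_sym // -op2_rowcross // IH.
Qed.

Hypothesis pole : forall i j, i != j -> 1 - q * (x i * x j) != 0.
Hypotheses (a0 : a != 0) (c0 : c != 0).
Hypothesis xa : forall i, x i != a.
Hypothesis xc : forall i, x i != c.

Lemma braid_paircross i j p f : i != j -> i \notin p -> j \notin p ->
  op2 i j (braid q (x i) (x j)) (paircross i j p f) =
  paircross j i p (op2 i j (braid q (x i) (x j)) f).
Proof.
move=> ij; elim: p => //= k p IH; rewrite !inE !negb_or => /andP[ik ip] /andP[jk jp].
by rewrite yang_baxter_vertical ?pole // IH.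
Qed.

(** The exchange passes the rows [p] by the vertical Yang-Baxter equation and goes around the
    boundary by the reflection equation. *)
Lemma braid_rowops i j p f : i != j -> i \notin p -> j \notin p -> uniq p ->
  op2 i j (braid q (x i) (x j)) (rowop i p (rowop j (rcons p i) f)) =
  rowop j p (rowop i (rcons p j) (op2 i j (braidT q (x i) (x j)) f)).
Proof.
move=> ij ip jp up; rewrite /rowop -!cats1 !rowcross_cat /=.
rewrite !rowcross_pair // 1?eq_sym // braid_paircross //.
by rewrite /bulk reflection_equation // ?pole // eq_sym.
Qed.

(** Both lines are rows by now: the exchange moves on to the right past every line that enters
    later, by the horizontal Yang-Baxter equation. *)
Lemma braidT_lattice i j p1 p2 l f : uniq (p1 ++ i :: j :: p2 ++ l) ->
  op2 i j (braidT q (x i) (x j)) (lattice (p1 ++ i :: j :: p2) l f) =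
  lattice (p1 ++ j :: i :: p2) l (op2 i j (braidT q (x i) (x j)) f).
Proof.
elim: l p2 => //= k l IH p2 up.
have [ip1 jp1 ip2 jp2] : [/\ i \notin p1, j \notin p1, i \notin p2 & j \notin p2].
  move: up; rewrite cat_uniq /= !inE !mem_cat !negb_or.
  by case/and3P => _ /and3P[? ? _] /and3P[/and3P[_ ? _] /andP[? _] _].
have [ik jk ij] : [/\ k != i, k != j & i != j].
  move: up; rewrite cat_uniq /= !inE !mem_cat !inE !negb_or.
  by case/and3P => _ _ /and3P[/and4P[? _ ? _] /and3P[_ ? _] _]; split=> //; rewrite eq_sym.
rewrite /rowop !rowcross_cat /= op2_rowcross // /bulk.
rewrite yang_baxter_horizontal ?pole // 1?eq_sym // op2_rowcross //.
rewrite -op1_op2C 1?eq_sym //; congr (rowcross _ _ (op2 _ _ _ (op2 _ _ _ (rowcross _ _ _)))).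
congr op1; rewrite !rcons_cat /= IH //.
by rewrite cat_rcons.
Qed.

Lemma op2_vacuum i j W f : i != j ->
  (forall b b', W false false b b' = 0 \/ b = false /\ b' = false) ->
  op2 i j W f vacuum = W false false false false * f vacuum.
Proof.
move=> ij HW; rewrite /op2 !big_bool /= !ffunE.
have W0 b b' : b || b' -> W false false b b' = 0.
  by case: (HW b b') => // -[-> ->].
rewrite (W0 true true) // (W0 true false) // (W0 false true) // !mul0r !add0r; congr (_ * f _).
by apply/ffunP => k; rewrite !ffunE; do 2 case: eqP => // _.
Qed.

Lemma braidT_vacuum_ind i j : i != j ->
  op2 i j (braidT q (x i) (x j)) vacuum_ind = fun s => (x j - q * x i) * vacuum_ind s.
Proof.
move=> ij; apply: funext => s; rewrite (st2_eta i j s); move: (s i) (s j) => b b'.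
rewrite op2_st2 // /braidT /vacuum_ind.
have E d d' : d || d' -> (st2 i j s d d' == vacuum) = false.
  move=> dd; apply/negP => /eqP E.
  move: (st2_i ij s d d') (st2_j i j s d d').
  by rewrite E !ffunE => dE d'E; rewrite -dE -d'E in dd.
rewrite (E true true) // (E true false) // (E false true) //.
rewrite !mulr0n !mulr0 !add0r; case: b b' => [] []; rewrite /= ?(E true true) ?(E true false) ?(E false true) //= ?mul0r ?mulr0n ?mulr0 //.
Qed.

Lemma op2Z i j W f r : op2 i j W (fun s => r * f s) = fun s => r * op2 i j W f s.
Proof. by apply: funext => s; rewrite /op2 !big_bool /=; ring. Qed.

Lemma op1Z i K f r : op1 i K (fun s => r * f s) = fun s => r * op1 i K f s.
Proof. by apply: funext => s; rewrite /op1 !big_bool /=; ring. Qed.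

Lemma rowcrossZ i p f r : rowcross i p (fun s => r * f s) = fun s => r * rowcross i p f s.
Proof. by elim: p => //= j p ->; rewrite op2Z. Qed.

Lemma latticeZ p l f r : lattice p l (fun s => r * f s) = fun s => r * lattice p l f s.
Proof. by elim: l p => //= i l IH p; rewrite IH /rowop op1Z rowcrossZ. Qed.

(** An exchange inserted at the bottom acts on the vacuum as the scalar [x j - q * x i]. Carried
    through the whole lattice it reaches the right-hand exits, where it is the same scalar, which
    can then be divided out. *)
Lemma zlat_swap p i j l : uniq (p ++ i :: j :: l) -> x j != q * x i ->
  zlat (p ++ i :: j :: l) = zlat (p ++ j :: i :: l).
Proof.
move=> up ne; have ne0 : x j - q * x i != 0 by rewrite subr_eq0.
move: (up); rewrite cat_uniq /= !inE !negb_or => /and3P[u1 /and3P[ip jp _] /and3P[/andP[ij il] jl _]].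
apply: (mulfI ne0); rewrite /zlat !lattice_cat.
transitivity (op2 i j (braid q (x i) (x j)) (lattice [::] p (lattice p (i :: j :: l) vacuum_ind)) vacuum).
  by rewrite op2_vacuum // => -[] []; auto.
rewrite op2_lattice //= braid_rowops // -!cats1 -!catA /= braidT_lattice //.
by rewrite braidT_vacuum_ind // latticeZ /rowop !(op1Z, rowcrossZ) latticeZ.
Qed.

Lemma zlat_move p l1 j l2 : uniq (p ++ l1 ++ j :: l2) ->
  (forall i, i \in l1 -> x j != q * x i) ->
  zlat (p ++ l1 ++ j :: l2) = zlat (p ++ j :: l1 ++ l2).
Proof.
elim/last_ind: l1 l2 => // l1 i IH l2 up ne.
rewrite cat_rcons catA zlat_swap -?catA.
- rewrite IH //; first by rewrite cat_rcons.
  + rewrite (perm_uniq (_ : perm_eq _ (p ++ rcons l1 i ++ j :: l2))) //.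
    rewrite perm_cat2l cat_rcons perm_cat2l.
    exact: permEl (perm_catCA [:: j] [:: i] l2).
  + by move=> k kl; apply: ne; rewrite mem_rcons inE kl orbT.
- by rewrite -cat_rcons.
- by apply: ne; rewrite mem_rcons inE eqxx.
Qed.

(** A row of crossings changes only the sites [i :: p], so rewriting under it may assume the given
    states elsewhere. The inductions on vacuum rows depend on this, as they need the later lines to
    be in state 0. *)
Lemma rowcross_local i p f g s :
  (forall s', (forall j, j \notin i :: p -> s' j = s j) -> f s' = g s') ->
  rowcross i p f s = rowcross i p g s.
Proof.
elim: p s => [|k p IH] s fg /=; first exact: fg.
apply: eq_bigr => b _; apply: eq_bigr => b' _; congr (_ * _); apply: IH => s' ss'.
apply: fg => j; rewrite !inE !negb_or => /and3P[ji jk jp].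
by rewrite ss' ?inE ?negb_or ?ji // !upd_neq.
Qed.

Lemma rowop_local i p f g s :
  (forall s', (forall j, j \notin i :: p -> s' j = s j) -> f s' = g s') ->
  rowop i p f s = rowop i p g s.
Proof.
move=> fg; apply: rowcross_local => s' ss'; apply: eq_bigr => b _; congr (_ * _).
apply: fg => j jp; rewrite upd_neq ?ss' //.
by apply: contraNneq jp => ->; rewrite inE eqxx.
Qed.

(** Row [i] is the first one that each later line meets, and meets in state 0; two zeros cross with
    weight 1 and stay zeros. *)
Lemma lattice_vacuum_row i p l f s : uniq (i :: p ++ l) -> s i = false ->
  (forall k, k \in l -> s k = false) ->
  lattice (i :: p) l f s = lattice p l f s.
Proof.
elim: l p s => //= k l IH p s; rewrite mem_cat inE !negb_or cat_uniq /=.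
move=> /andP[/and3P[ip ik il] /and3P[up]]; rewrite negb_or => /andP[kp pl] /andP[kl ul] si sl.
transitivity (rowop k p (lattice (i :: rcons p k) l f) s).
  rewrite {1}/rowop /= /op2 !big_bool /= si sl ?mem_head //=.
  by rewrite !mul0r !add0r mul1r !upd_idP // sl ?mem_head.
apply: rowop_local => s' ss'; apply: IH.
- rewrite cat_rcons mem_cat inE !negb_or ip ik il cat_uniq up /= kl ul.
  by rewrite negb_or kp pl.
- by rewrite ss' // inE negb_or ik.
- move=> j jl; rewrite ss'; first by apply: sl; rewrite inE jl orbT.
  rewrite inE negb_or; apply/andP; split; first by apply: contraNneq kl => <-.
  by apply: contraNN pl => jp; apply/hasP; exists j.
Qed.

(** At spectral parameter 0 a row in state 1 meeting a vertical 0 keeps its 1 with weight 1, and the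
    weight of turning upwards is 0. The 1 thus reaches the exit, which the vacuum forbids. *)
Lemma lattice_zero_row i p l s : x i = 0 -> uniq (i :: p ++ l) -> s i = true ->
  (forall k, k \in l -> s k = false) ->
  lattice (i :: p) l vacuum_ind s = 0.
Proof.
move=> x0; elim: l p s => [|k l IH] p s /=.
  move=> _ si _; rewrite /vacuum_ind; case: eqP => // E.
  by move: si; rewrite E ffunE.
rewrite mem_cat inE !negb_or cat_uniq /=.
move=> /andP[/and3P[ip ik il] /and3P[up]]; rewrite negb_or => /andP[kp pl] /andP[kl ul] si sl.
transitivity (rowop k p (lattice (i :: rcons p k) l vacuum_ind) s).
  rewrite {1}/rowop /= /op2 !big_bool /= si sl ?mem_head //= /bulk x0 mulr0.
  rewrite /= !(mulr0, mul0r, subr0, invr1, mul1r, add0r, addr0).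
  by rewrite !upd_idP // sl ?mem_head.
transitivity (rowop k p (fun=> 0 * 0) s); last first.
  by rewrite /rowop (op1Z _ _ (fun=> 0)) rowcrossZ mul0r.
apply: rowop_local => s' ss'; rewrite mul0r; apply: IH.
- rewrite /= cat_rcons mem_cat inE !negb_or ip ik il cat_uniq up /= kl ul.
  by rewrite negb_or kp pl.
- by rewrite ss' // inE negb_or ik.
- move=> j jl; rewrite ss'; first by apply: sl; rewrite inE jl orbT.
  rewrite inE negb_or; apply/andP; split; first by apply: contraNneq kl => <-.
  by apply: contraNN pl => jp; apply/hasP; exists j.
Qed.

Lemma upd_vacuum i : upd vacuum i false = vacuum.
Proof. by apply/ffunP => k; rewrite !ffunE; case: eqP. Qed.

Lemma zlat_h0 i l : uniq (i :: l) -> hfun a c (x i) = 0 -> zlat (i :: l) = zlat l.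
Proof.
move=> ul h0; rewrite /zlat /= /rowop /= /op1 big_bool /= !ffunE /= h0.
rewrite subr0 mul0r mul1r add0r upd_vacuum.
by apply: lattice_vacuum_row => // [|k _]; rewrite ffunE.
Qed.

(** Since [h] is 1 at 0, the boundary forces the incoming 0 into a 1. *)
Lemma zlat_x0 i l : uniq (i :: l) -> x i = 0 -> zlat (i :: l) = 0.
Proof.
move=> ul x0; rewrite /zlat /= /rowop /= /op1 big_bool /= !ffunE /=.
have -> : hfun a c (x i) = 1.
  by rewrite /hfun x0 expr0n /= !subr0 mulr1 divff // mulf_neq0.
rewrite subrr mul0r mul1r addr0 lattice_zero_row ?upd_same //.
by move=> k kl; rewrite upd_neq ?ffunE //; apply: contraTneq kl => ->; case/andP: ul.
Qed.

Lemma zlat_inv i j l : uniq [:: i, j & l] -> q != 1 -> x i * x j = 1 ->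
  zlat [:: i, j & l] = zlat l.
Proof.
move=> ul q1 xx; rewrite /zlat /= /rowop /= /bulk [x j * x i]mulrC xx.
move: (ul) => /= /and3P[]; rewrite inE negb_or => /andP[ij il] jl ul'.
have q10 : 1 - q != 0 by rewrite subr_eq0 eq_sym.
rewrite [vacuum](st2_eta i j) !ffunE op1_st2_i // !op2_st2' // !op1_st2_j //=.
rewrite mulr1 subrr !(mulr0, mul0r, add0r, addr0, mul1r) divff // !mul1r.
have x0 : x i != 0 by apply/eqP => E; move: xx; rewrite E mul0r => /eqP; rewrite eq_sym oner_eq0.
have xjE : x j = (x i)^-1 by rewrite -[RHS]mulr1 -xx mulKf.
have na : a - x i != 0 by rewrite subr_eq0 eq_sym.
have nc : c - x i != 0 by rewrite subr_eq0 eq_sym.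
have nja : a - x j != 0 by rewrite subr_eq0 eq_sym.
have njc : c - x j != 0 by rewrite subr_eq0 eq_sym.
rewrite xjE in nja njc.
have nja' : a * x i - 1 != 0.
  by rewrite -(mulVf x0) -mulrBl mulf_neq0.
have njc' : c * x i - 1 != 0.
  by rewrite -(mulVf x0) -mulrBl mulf_neq0.
rewrite /hfun xjE; set G := lattice _ _ _.
have -> : st2 i j vacuum false false = vacuum by rewrite st2E !upd_vacuum.
have -> : G vacuum = lattice [::] l vacuum_ind vacuum.
  rewrite /G lattice_vacuum_row ?ffunE //; last by move=> k; rewrite ffunE.
  by rewrite lattice_vacuum_row ?ffunE // => [|k _]; rewrite ?ffunE //= jl.
move: (G _) (lattice _ _ _ vacuum) => g g'.
by field; rewrite x0 na nc a0 c0 nja' njc'.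
Qed.

End Lattice.

(** * Subset sums *)

Section SetSums.
Variables (R : pzRingType) (I : finType).

Lemma sum_subsetU1 (i : I) (T : {set I}) (f : {set I} -> R) : i \notin T ->
  \sum_(S : {set I} | S \subset i |: T) f S =
  \sum_(S : {set I} | S \subset T) (f S + f (i |: S)).
Proof.
move=> iT; rewrite big_split /= (bigID (fun S : {set I} => i \notin S)) /=; congr (_ + _).
  by apply: eq_bigl => S; rewrite -subsetD1 setU1K.
rewrite (reindex_onto (fun S => i |: S) (fun S => S :\ i)) /=; last first.
  by move=> S /andP[_]; rewrite negbK => iS; rewrite setD1K.
apply: eq_bigl => S; rewrite setU11 andbT; apply/andP/idP => [[ST /eqP SE]|ST].
  have iS : i \notin S by rewrite -SE !inE eqxx.
  by rewrite -(setU1K iT) subsetD1 iS andbT (subset_trans _ ST) ?subsetU1.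
split; first by rewrite setUS.
by rewrite setU1K //; apply: contraNN iT; apply: (subsetP ST).
Qed.

End SetSums.

(** * Products over unordered pairs *)

Section PairProd.
Variables (F : fieldType) (I : finType).

(** [enum_rank] merely selects one representative of each pair; the factors are meant to be
    symmetric. On ordinals this is the usual order. *)
Definition pairprod (S : {set I}) (p : I -> I -> F) : F :=
  \prod_(i in S) \prod_(j in S | (enum_rank i < enum_rank j)%N) p i j.

Implicit Types (S : {set I}) (p : I -> I -> F).

Lemma pairprod0 p : pairprod set0 p = 1.
Proof. by rewrite /pairprod big_set0. Qed.

Lemma pairprodU1 (i : I) S p : (forall j, p i j = p j i) -> i \notin S ->
  pairprod (i |: S) p = (\prod_(k in S) p i k) * pairprod S p.
Proof.
move=> psym iS; rewrite /pairprod big_setU1 //=.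
rewrite [X in _ * X](eq_bigr (fun k => (if (enum_rank k < enum_rank i)%N then p i k else 1)
  * \prod_(j in S | (enum_rank k < enum_rank j)%N) p k j)); last first.
  by move=> k kS; rewrite big_mkcondr big_setU1 //= -big_mkcondr psym.
rewrite big_mkcondr big_setU1 //= ltnn mul1r big_split /= mulrA; congr (_ * _).
rewrite -big_split; apply: eq_bigr => k kS /=.
have [ki|ik|/val_inj/enum_rank_inj E] := ltngtP (enum_rank k) (enum_rank i); rewrite ?mul1r ?mulr1 //.
by rewrite -E kS in iS.
Qed.

Lemma eq_pairprod S p p' : {in S &, p =2 p'} -> pairprod S p = pairprod S p'.
Proof.
move=> pp; apply: eq_bigr => i iS; apply: eq_bigr => j /andP[jS _]; exact: pp.
Qed.

End PairProd.

(** * The subset sum over a varying set of lines *)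

Section SubsetSum.
Variables (F : fieldType) (I : finType) (q a c u : F).
Implicit Types (x : I -> F) (S T : {set I}) (i j k : I).

Definition crossf x i j : F := (x i * x j - 1) / (x i - x j).
Definition pairf x i j : F := (1 - x i * x j) / (1 - q * x i * x j).

(** Complements are taken in [T], so that lines can be added and removed. The factor [g] is kept
    apart because it depends on the parity of [#|S|]. *)
Definition zcore x T S : F :=
  (- u) ^+ #|S| * (\prod_(i in S) hfun a c (x i)) *
  (\prod_(i in S) \prod_(j in T :\: S) crossf x i j) * pairprod S (pairf x).

Definition gcoef n : F := q ^+ (n./2 ^ 2) / (a * c) ^+ n./2.

Definition gset x T S : F :=
  gcoef #|S| * \prod_(i in if odd #|S| then T :\: S else S) x i.

Definition zsum x T : F := \sum_(S : {set I} | S \subset T) gset x T S * zcore x T S.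

Lemma pairfC x i j : pairf x i j = pairf x j i.
Proof. by rewrite /pairf -!mulrA [x j * x i]mulrC. Qed.

Lemma setU1D i T S : i \notin S -> (i |: T) :\: S = i |: (T :\: S).
Proof.
move=> iS; apply/setP => k; rewrite !inE; case: eqP => [->|_] //=.
by rewrite iS.
Qed.

Lemma setU1DU1 i T S : i \notin T -> (i |: T) :\: (i |: S) = T :\: S.
Proof.
move=> iT; apply/setP => k; rewrite !inE; case: eqP => [->|_] //=.
by rewrite (negbTE iT) andbF.
Qed.

Section Add.
Variables (x : I -> F) (i : I) (T S : {set I}).
Hypotheses (iT : i \notin T) (ST : S \subset T).

Let iS : i \notin S. Proof. by apply: contraNN iT; apply: (subsetP ST). Qed.

Lemma zcoreU : zcore x (i |: T) S = zcore x T S * \prod_(k in S) crossf x k i.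
Proof.
rewrite /zcore setU1D //.
under [X in _ * X * _]eq_bigr => k _ do rewrite big_setU1 ?inE ?(negbTE iT) ?andbF //=.
by rewrite [X in _ * X * _ = _]big_split /=; ring.
Qed.

Lemma zcoreUU : zcore x (i |: T) (i |: S) =
  zcore x T S * (- u * hfun a c (x i)) *
  ((\prod_(k in T :\: S) crossf x i k) * \prod_(k in S) pairf x i k).
Proof.
rewrite /zcore setU1DU1 // cardsU1 iS add1n exprS !big_setU1 //= pairprodU1 //; last first.
  by move=> j; rewrite pairfC.
by ring.
Qed.

Lemma gsetU : gset x (i |: T) S = gset x T S * (if odd #|S| then x i else 1).
Proof.
rewrite /gset; case: odd; rewrite ?mulr1 // setU1D // big_setU1 ?inE ?(negbTE iT) ?andbF //=.
by ring.
Qed.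

Lemma gsetUU : gset x (i |: T) (i |: S) =
  if odd #|S| then gcoef #|S|.+1 * (\prod_(k in S) x k) * x i
  else gcoef #|S| * \prod_(k in T :\: S) x k.
Proof.
rewrite /gset cardsU1 iS add1n /=; case: (boolP (odd #|S|)) => /= [oS|oS].
  by rewrite big_setU1 //=; ring.
by rewrite setU1DU1 // /gcoef /= uphalf_half (negbTE oS).
Qed.

End Add.

Lemma zsumU x i T : i \notin T -> zsum x (i |: T) =
  \sum_(S : {set I} | S \subset T)
    (gset x (i |: T) S * zcore x (i |: T) S
     + gset x (i |: T) (i |: S) * zcore x (i |: T) (i |: S)).
Proof. by move=> iT; rewrite /zsum sum_subsetU1. Qed.

Lemma zsum_set0 x : zsum x set0 = 1.
Proof.
rewrite /zsum (big_pred1 set0) => [|S]; last by rewrite subset0.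
rewrite /gset /zcore /gcoef cards0 /= pairprod0 !big_set0.
by rewrite !(expr0, mulr1, mul1r, invr1).
Qed.

(** Only subsets without [i] survive. Each cross factor with [i] equals [e], and [e ^+ #|S|] cancels
    the extra factor [x i = e] that [g] acquires when [#|S|] is odd. *)
Lemma zsum_h0 x i T (e : F) : i \notin T -> x i = e -> e ^+ 2 = 1 ->
  (forall k, k \in T -> x k != e) -> zsum x (i |: T) = zsum x T.
Proof.
move=> iT xe e2 xk; rewrite zsumU //; apply: eq_bigr => S ST.
have h0 : hfun a c (x i) = 0 by rewrite /hfun xe e2 subrr mulr0 mul0r.
rewrite zcoreUU // h0 !(mulr0, mul0r) addr0 zcoreU // gsetU // xe.
have -> : \prod_(k in S) crossf x k i = e ^+ #|S|.
  rewrite -prodr_const; apply: eq_bigr => k kS; rewrite /crossf xe.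
  have xk0 : x k - e != 0 by rewrite subr_eq0 xk ?(subsetP ST).
  apply: (mulIf xk0); rewrite divfK //; rewrite mulrBr -expr2 e2; ring.
have -> : e ^+ #|S| = if odd #|S| then e else 1.
  rewrite -[in LHS](odd_double_half #|S|) -muln2 mulnC exprD exprM e2 expr1n mulr1.
  by case: odd.
by case: odd; rewrite ?mulr1 // mulrACA -expr2 e2 mulr1.
Qed.

(** A subset with exactly one of [i], [j] is killed by its cross factor, one with both by its pair
    factor. For the remaining ones the cross factors with [i] and [j] multiply to 1, and [g] gains
    at most [x i * x j = 1]. *)
Lemma zsum_inv x i j T : i != j -> i \notin T -> j \notin T -> x i * x j = 1 ->
  (forall k, k \in T -> x k != x i) -> (forall k, k \in T -> x k != x j) ->
  zsum x (i |: (j |: T)) = zsum x T.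
Proof.
move=> ij iT jT xx xi xj.
have ijT : i \notin j |: T by rewrite !inE negb_or ij.
rewrite zsumU // sum_subsetU1 //; apply: eq_bigr => S ST.
have iS : i \notin S by apply: contraNN iT; apply: (subsetP ST).
have jS : j \notin S by apply: contraNN jT; apply: (subsetP ST).
have SjT : S \subset j |: T by rewrite subsetU // ST orbT.
have jSjT : j |: S \subset j |: T by rewrite setUS.
have cij : crossf x i j = 0 by rewrite /crossf xx subrr mul0r.
have cji : crossf x j i = 0 by rewrite /crossf mulrC [x j * _]mulrC xx subrr mulr0.
have pij : pairf x i j = 0 by rewrite /pairf xx subrr mul0r.
rewrite [zcore x (i |: _) (i |: S)]zcoreUU // setU1D // big_setU1 ?inE ?(negbTE jT) ?andbF //= cij.
rewrite [zcore x (i |: _) (j |: S)]zcoreU // big_setU1 //= cji.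
rewrite [zcore x (i |: _) (i |: (j |: S))]zcoreUU // [\prod_(k in j |: S) _]big_setU1 //= pij.
rewrite !(mul0r, mulr0, addr0) zcoreU // zcoreU // gsetU // gsetU //.
have PP : \prod_(k in S) crossf x k i * \prod_(k in S) crossf x k j = 1.
  rewrite -big_split big1 // => k kS /=; rewrite /crossf.
  have kT := subsetP ST k kS.
  have n1 : x k - x i != 0 by rewrite subr_eq0 xi.
  have n2 : x k - x j != 0 by rewrite subr_eq0 xj.
  rewrite mulf_div; apply: (mulIf (mulf_neq0 n1 n2)); rewrite divfK ?mulf_neq0 // mul1r.
  have -> : x k * x i - 1 = x i * (x k - x j) by rewrite mulrBr xx; ring.
  have -> : x k * x j - 1 = x j * (x k - x i) by rewrite mulrBr [x j * x i]mulrC xx; ring.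
  by rewrite -[RHS]mul1r -xx; ring.
move: PP; set P := \prod_(k in S) _; set P' := \prod_(k in S) _ => PP.
transitivity (gset x T S * zcore x T S * (if odd #|S| then x i * x j else 1) * (P * P')).
  by case: odd; ring.
by rewrite PP xx; case: odd; rewrite !mulr1.
Qed.

End SubsetSum.

(** * Subset sums as functions of one variable *)

Section Lead.
Variable (F : fieldType).
Implicit Types (p : {poly F}).

(** [d] is a formal degree: [r] may be 0, which is how a cancellation at the top is recorded. *)
Definition lead (d : nat) p (r : F) := ((size p <= d.+1)%N /\ p`_d = r).

Lemma leadM d1 d2 p1 p2 r1 r2 : lead d1 p1 r1 -> lead d2 p2 r2 ->
  lead (d1 + d2) (p1 * p2) (r1 * r2).
Proof.
move=> [s1 e1] [s2 e2]; split.
  apply: leq_trans (size_polyMleq _ _) _.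
  by have := leq_add s1 s2; case: (size p1 + size p2)%N => //= n; rewrite addSn addnS ltnS.
rewrite coefM (bigD1 (inord d1)) //= inordK ?ltnS ?leq_addr // addKn e1 e2 big1 ?addr0 //.
move=> i; rewrite -val_eqE /= inordK ?ltnS ?leq_addr // => id1.
case: (ltngtP i d1) id1 => // id1 _; last first.
  by rewrite nth_default ?mul0r // (leq_trans s1).
rewrite mulrC nth_default ?mul0r // (leq_trans s2) //.
by rewrite ltn_subRL ltn_add2r.
Qed.

Lemma leadC r : lead 0 r%:P r.
Proof. by split; rewrite ?coefC // size_polyC leq_b1. Qed.

Lemma leadZ d p r e : lead d p r -> lead d (e *: p) (e * r).
Proof. by move=> H; rewrite -mul_polyC; apply: (leadM (leadC e) H). Qed.

Lemma leadD d p1 p2 r1 r2 : lead d p1 r1 -> lead d p2 r2 -> lead d (p1 + p2) (r1 + r2).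
Proof.
move=> [s1 e1] [s2 e2]; split; last by rewrite coefD e1 e2.
by apply: leq_trans (size_polyD _ _) _; rewrite geq_max s1.
Qed.

Lemma lead_sum (J : finType) (P : pred J) d (p : J -> {poly F}) (r : J -> F) :
  (forall j, P j -> lead d (p j) (r j)) ->
  lead d (\sum_(j | P j) p j) (\sum_(j | P j) r j).
Proof.
move=> H; elim/big_ind2: _ => //; last by move=> *; apply: leadD.
by split; rewrite ?size_poly0 ?coef0.
Qed.

Lemma lead_prod (J : finType) (A : {set J}) d (p : J -> {poly F}) (r : J -> F) :
  (forall j, lead d (p j) (r j)) ->
  lead (d * #|A|) (\prod_(j in A) p j) (\prod_(j in A) r j).
Proof.
move=> H; rewrite -sum1_card big_distrr /=.
elim/big_rec3: _ => [|j e y p' _ IH]; first exact: leadC.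
by rewrite muln1; apply: leadM.
Qed.

Lemma lead_lin e r : lead 1 (e%:P + r *: 'X) r.
Proof.
split; last by rewrite coefD coefC coefZ coefX mulr1 add0r.
apply: leq_trans (size_polyD _ _) _; rewrite geq_max size_polyC (leq_trans (leq_b1 _)) //=.
by rewrite (leq_trans (size_scale_leq _ _)) ?size_polyX.
Qed.

Lemma lead_weak d p r : lead d p r -> lead d.+1 p 0.
Proof. by move=> [s _]; split; [apply: leqW | rewrite nth_default]. Qed.
End Lead.

(** * Numerator and denominator of the subset sum in the parameter of an added line *)

Section Numerator.
Variables (F : fieldType) (I : finType) (q a c : F) (x : I -> F).
Implicit Types (S T : {set I}) (i j k : I).

Let z T S := zcore q a c 1 x T S.
Let g T S := gset q a c x T S.

Definition xpow S : {poly F} := if odd #|S| then 'X else 1.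

(** The factor [g] of [S] enlarged by the added line, without the parameter of that line; that
    parameter again occurs to the power given by [xpow S]. *)
Definition gU T S : F :=
  if odd #|S| then gcoef q a c #|S|.+1 * \prod_(k in S) x k
  else gcoef q a c #|S| * \prod_(k in T :\: S) x k.

Definition bdry_den : {poly F} := (a%:P + (-1) *: 'X) * (c%:P + (-1) *: 'X).
Definition pole_den k : {poly F} := 1%:P + (- (q * x k)) *: 'X.
Definition one_minus k : {poly F} := 1%:P + (- x k) *: 'X.
Definition diff_den k : {poly F} := (- x k)%:P + 1 *: 'X.

Definition den T : {poly F} := bdry_den * \prod_(k in T) (pole_den k * diff_den k).

Definition num_out T S : {poly F} :=
  (g T S * z T S) *: (xpow S * (bdry_den *
    (\prod_(k in S) (one_minus k * pole_den k) *
     \prod_(k in T :\: S) (pole_den k * diff_den k)))).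

Definition num_in T S : {poly F} :=
  (- gU T S * z T S) *: (xpow S * (((a * c)%:P * ((1%:P + 1 *: 'X) * (1%:P + (-1) *: 'X))) *
    (\prod_(k in S) (one_minus k * diff_den k) *
     \prod_(k in T :\: S) ((-1)%:P * (one_minus k * pole_den k))))).

Definition num T := \sum_(S : {set I} | S \subset T) (num_out T S + num_in T S).

Lemma xpowE S t : (xpow S).[t] = if odd #|S| then t else 1.
Proof. by rewrite /xpow; case: odd; rewrite ?hornerX ?hornerC. Qed.
Lemma bdry_denE t : bdry_den.[t] = (a - t) * (c - t).
Proof. by rewrite /bdry_den !hornerE; ring. Qed.
Lemma pole_denE k t : (pole_den k).[t] = 1 - q * x k * t.
Proof. by rewrite /pole_den !hornerE; ring. Qed.
Lemma one_minusE k t : (one_minus k).[t] = 1 - x k * t.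
Proof. by rewrite /one_minus !hornerE; ring. Qed.
Lemma diff_denE k t : (diff_den k).[t] = t - x k.
Proof. by rewrite /diff_den !hornerE; ring. Qed.
Lemma bdry_numE t : (((1 : F)%:P + 1 *: 'X) * (1%:P + (-1) *: 'X)).[t] = 1 - t ^+ 2.
Proof. by rewrite !hornerE; ring. Qed.
Definition evalE := (xpowE, bdry_denE, pole_denE, one_minusE, diff_denE, bdry_numE,
  @hornerM F, @hornerZ F, @hornerC F, @horner_prod F).

Lemma card_setDl S T : S \subset T -> (#|S| + #|T :\: S| = #|T|)%N.
Proof. by move=> ST; rewrite -(cardsID S T) (setIidPr ST). Qed.

(** Even [S] stay one degree below the top. For [#|S| = 2r + 1] the terms with the added line
    outside and inside cancel there: outside, the top coefficient brings [q ^+ (2r + 1)]; inside,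
    [r] becomes [r + 1], where [(r + 1)^2 = r^2 + 2r + 1] and the new [a * c] in the denominator is
    absorbed by the one in [h]. *)
Lemma num_lead T : a != 0 -> c != 0 -> lead (2 * #|T|).+3 (num T) 0.
Proof.
move=> a0 c0.
suff : lead (2 * #|T|).+3 (num T) (\sum_(S : {set I} | S \subset T) 0) by rewrite big1_eq.
apply: lead_sum => S ST.
have lb : lead 2 bdry_den 1.
  rewrite (_ : 1 = (-1) * (-1) :> F); last by ring.
  by apply: (@leadM _ 1 1); apply: lead_lin.
have lo : lead 2 ((a * c)%:P * ((1%:P + 1 *: 'X) * (1%:P + (-1) *: 'X))) (- (a * c)).
  rewrite (_ : - (a * c) = a * c * (1 * (-1))); last by ring.
  apply: (@leadM _ 0 2); first exact: leadC.
  by apply: (@leadM _ 1 1); apply: lead_lin.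
have h1 := lead_prod S (fun k => leadM (lead_lin 1 (- x k)) (lead_lin 1 (- (q * x k)))).
have h2 := lead_prod (T :\: S) (fun k => leadM (lead_lin 1 (- (q * x k))) (lead_lin (- x k) 1)).
have h3 := lead_prod S (fun k => leadM (lead_lin 1 (- x k)) (lead_lin (- x k) 1)).
have h4 := lead_prod (T :\: S) (fun k => leadM (leadC (-1)) (leadM (lead_lin 1 (- x k)) (lead_lin 1 (- (q * x k))))).
have hA := leadM lb (leadM h1 h2).
have hB := leadM lo (leadM h3 h4).
rewrite -mulnDr card_setDl // in hA hB.
rewrite /num_out /num_in /xpow /gU; case: (boolP (odd #|S|)) => oS; last first.
  rewrite -[X in lead _ _ X]addr0 !mul1r.
  by apply: leadD; apply: (@lead_weak _ _ _ _); apply: leadZ; [exact: hA|exact: hB].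
have lX : lead 1 ('X : {poly F}) 1 by split; rewrite ?size_polyX ?coefX.
have {}hA := leadZ (g T S * z T S) (leadM lX hA).
have {}hB := leadZ (- (gcoef q a c #|S|.+1 * \prod_(k in S) x k) * z T S) (leadM lX hB).
have := leadD hA hB; congr lead.
rewrite /g /gset oS.
set A := \prod_(j in S) (- x j * - (q * x j)).
set B := \prod_(j in T :\: S) (- (q * x j) * 1).
set C := \prod_(j in S) (- x j * 1).
set D := \prod_(j in T :\: S) (-1 * (- x j * - (q * x j))).
have AE : A = q ^+ #|S| * (\prod_(k in S) x k) ^+ 2.
  by rewrite -prodr_const -prodrXl -big_split; apply: eq_bigr => k _ /=; ring.
have DE : D = B * \prod_(k in T :\: S) x k.
  by rewrite -big_split; apply: eq_bigr => k _ /=; ring.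
have CE : C = - \prod_(k in S) x k.
  rewrite /C (eq_bigr (fun k => -1 * x k)); last by move=> k _; ring.
  by rewrite big_split /= prodr_const -signr_odd oS expr1 mulN1r.
rewrite AE CE DE /gcoef /= uphalf_half oS add1n.
rewrite -[in q ^+ #|S|](odd_double_half #|S|) oS add1n -muln2.
have -> : ((#|S|./2).+1 ^ 2 = #|S|./2 ^ 2 + (#|S|./2 * 2).+1)%N by ring.
rewrite exprD [(a * c) ^+ _.+1]exprS; move: (_ ^+ (_ ^ 2)) => Q; move: (_ ^+ (_ * 2).+1) => Q'.
have : (a * c) ^+ (#|S|./2) != 0 by rewrite expf_neq0 ?mulf_neq0.
move: (_ ^+ _) => P P0; field; by rewrite P0 a0 c0.
Qed.

Lemma den_split S T : S \subset T -> den T = bdry_den *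
  (\prod_(k in S) (pole_den k * diff_den k) * \prod_(k in T :\: S) (pole_den k * diff_den k)).
Proof. by move=> ST; rewrite /den (big_setID S) /= (setIidPr ST). Qed.

Section Eval.
Variables (i : I) (T : {set I}) (iT : i \notin T) (t : F).
Let y k := if k == i then t else x k.
Let yi : y i = t. Proof. by rewrite /y eqxx. Qed.
Let yk k : k \in T -> y k = x k.
Proof. by move=> kT; rewrite /y; case: eqP => // E; move: iT; rewrite -E kT. Qed.

Lemma den_neq0 : (den T).[t] != 0 ->
  [/\ a - t != 0, c - t != 0 & forall k, k \in T -> (1 - q * x k * t != 0) /\ t - x k != 0].
Proof.
rewrite /den !evalE !mulf_eq0 !negb_or => /andP[/andP[-> ->]] /prodf_neq0 H.
by split=> // k kT; have := H k kT; rewrite !evalE mulf_eq0 negb_or => /andP[].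
Qed.

Lemma num_eval : (den T).[t] != 0 -> zsum q a c 1 y (i |: T) * (den T).[t] = (num T).[t].
Proof.
move=> /den_neq0[at0 ct0 dk].
rewrite zsumU // /num horner_sum big_distrl; apply: eq_bigr => S ST /=.
have yS k : k \in S -> y k = x k by move=> kS; rewrite yk // (subsetP ST).
have yTS k : k \in T :\: S -> y k = x k by rewrite inE => /andP[_ kT]; rewrite yk.
have zE : zcore q a c 1 y T S = z T S.
  rewrite /z /zcore; congr (_ * _ * _ * _).
  - by apply: eq_bigr => k kS; rewrite yS.
  - by apply: eq_bigr => k kS; apply: eq_bigr => k' kS'; rewrite /crossf yS // yTS.
  - by apply: eq_pairprod => k k' kS kS'; rewrite /pairf !yS.
have gE : gset q a c y T S = g T S.
  rewrite /g /gset; congr (_ * _); case: odd; apply: eq_bigr => k; [exact: yTS | exact: yS].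
rewrite zcoreU // gsetU // zcoreUU // gsetUU // zE gE yi.
have -> : (if odd #|S| then gcoef q a c #|S|.+1 * \prod_(k in S) y k * t
   else gcoef q a c #|S| * \prod_(k in T :\: S) y k) = gU T S * (if odd #|S| then t else 1).
  rewrite /gU; case: odd; rewrite ?mulr1; last by congr (_ * _); apply: eq_bigr => k; exact: yTS.
  by congr (_ * _ * _); apply: eq_bigr => k; exact: yS.
rewrite hornerD mulrDl; congr (_ + _).
  rewrite /num_out (den_split ST) !evalE.
  set PD := \prod_(_ in S) (_ * _).[t]; set PC := \prod_(k in S) crossf y k i.
  set PM := \prod_(_ in S) (one_minus _ * _).[t].
  have E1 : PC * PD = PM.
    rewrite -big_split; apply: eq_bigr => k kS /=.
    have [_ d] := dk k (subsetP ST k kS).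
    by rewrite /crossf yi yS // !evalE; field; rewrite -opprB oppr_eq0.
  rewrite -E1; move: (\prod_(_ in _) _) PC PD E1 (g T S) (z T S) => P1 P2 P3 _ G Z.
  by case: odd; ring.
rewrite /num_in (den_split ST) !evalE.
set PD := \prod_(_ in S) (pole_den _ * _).[t]; set PC := \prod_(k in S) pairf q y i k.
set PD' := \prod_(_ in _ :\: _) (pole_den _ * _).[t].
set PC' := \prod_(_ in _ :\: _) crossf _ _ _.
set PM := \prod_(_ in S) (one_minus _ * _).[t].
set PM' := \prod_(_ in _ :\: _) (_%:P * _).[t].
have E1 : PC * PD = PM.
  rewrite -big_split; apply: eq_bigr => k kS /=.
  have [d _] := dk k (subsetP ST k kS).
  by rewrite /pairf yi yS // !evalE; field; rewrite mulrAC.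
have E2 : PC' * PD' = PM'.
  rewrite -big_split; apply: eq_bigr => k kS /=.
  have [_ d] : _ /\ _ := dk k (subsetP (subsetDl T S) k kS).
  by rewrite /crossf yi yTS // !evalE; field.
rewrite -E1 -E2; move: (gU T S) (z T S) PD PC PD' PC' {E1 E2} => G Z PD PC PD' PC'.
by rewrite /hfun; case: odd; field; rewrite ?at0 ?ct0.
Qed.
End Eval.

(** Subsets containing both or neither of line [j] and the added line have no pole here and are
    killed by the factor [diff_den j]. The others cancel in pairs: exchanging the two lines reverses
    the sign. *)
Lemma num_pole j T : j \notin T -> a - x j != 0 -> c - x j != 0 ->
  (forall k, k \in T -> x j - x k != 0) -> (forall k, k \in T -> 1 - q * x j * x k != 0) ->
  (num (j |: T)).[x j] = 0.
Proof.
move=> jT aj cj xk qk; rewrite /num sum_subsetU1 // horner_sum big1 // => S ST.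
have jS : j \notin S by apply: contraNN jT; apply: (subsetP ST).
have jTS : j \notin T :\: S by rewrite inE (negbTE jT) andbF.
have d0 : (diff_den j).[x j] = 0 by rewrite diff_denE subrr.
have oE : (num_out (j |: T) S).[x j] = 0.
  by rewrite /num_out setU1D // (big_setU1 _ jTS) /= !evalE subrr !(mulr0, mul0r).
have iE : (num_in (j |: T) (j |: S)).[x j] = 0.
  by rewrite /num_in big_setU1 //= !evalE subrr !(mulr0, mul0r).
rewrite !hornerD oE iE add0r addr0.
rewrite /num_in /num_out setU1DU1 // setU1D // /z /g zcoreU // zcoreUU // gsetUU //.
rewrite (big_setU1 _ jS) (big_setU1 _ jTS) /=.
rewrite !evalE.
rewrite cardsU1 jS add1n /= if_neg.
have -> : gU (j |: T) S = if odd #|S| then gcoef q a c #|S|.+1 * \prod_(k in S) x k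
   else gcoef q a c #|S| * (x j * \prod_(k in T :\: S) x k).
  by rewrite /gU setU1D // big_setU1.
set P1 := \prod_(k in T :\: S) crossf x j k.
set P2 := \prod_(k in S) pairf q x j k.
set P3 := \prod_(k in S) (one_minus k * pole_den k).[x j].
set P4 := \prod_(k in T :\: S) (pole_den k * diff_den k).[x j].
set P5 := \prod_(k in S) crossf x k j.
set P6 := \prod_(k in S) (one_minus k * diff_den k).[x j].
set P7 := \prod_(k in T :\: S) ((-1)%:P * (one_minus k * pole_den k)).[x j].
have E1 : P1 * P4 = P7.
  rewrite -big_split; apply: eq_bigr => k; rewrite inE => /andP[_ kT] /=.
  by rewrite /crossf !evalE; field; exact: xk.
have E2 : P2 * P3 = P5 * P6.
  rewrite -!big_split; apply: eq_bigr => k kS /=.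
  have kT := subsetP ST k kS.
  rewrite /crossf /pairf !evalE; field.
  by rewrite qk // -opprB oppr_eq0 xk.
rewrite /hfun -E1.
apply: etrans (_ : (if odd #|S| then gcoef q a c #|S|.+1 * (\prod_(k in S) x k) * x j
    else gcoef q a c #|S| * (x j * \prod_(k in T :\: S) x k)) *
   (- zcore q a c 1 x T S * (a * c) * (1 - x j ^+ 2) * P1 * P4 *
     ((one_minus j).[x j] * (pole_den j).[x j]) * (P2 * P3 - P5 * P6)) = 0); last first.
  by rewrite E2 subrr !mulr0.
rewrite !evalE; move: P1 P2 P3 P4 P5 P6 {E1 E2} => P1 P2 P3 P4 P5 P6.
by case: odd; field; rewrite aj cj.
Qed.

(** For odd [#|S|] both terms carry the factor [x i]. For even [#|S|] the terms without and with [i]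
    cancel at [u = 1]: [h] is 1, and the cross factors with 0 are, up to an even number of signs,
    the inverses of the variables in [g]. *)
Lemma zsum_x0 i T : i \notin T -> a != 0 -> c != 0 -> x i = 0 ->
  (forall k, k \in T -> x k != 0) -> zsum q a c 1 x (i |: T) = 0.
Proof.
move=> iT a0 c0 xi xk; rewrite zsumU // big1 // => S ST.
rewrite gsetU // gsetUU // zcoreU // zcoreUU // xi.
case: (boolP (odd #|S|)) => oS; first by rewrite !mulr0 !mul0r addr0.
have -> : hfun a c 0 = 1.
  by rewrite /hfun expr0n /= !subr0 mulr1 divff // mulf_neq0.
have -> : \prod_(k in S) pairf q x i k = 1.
  by rewrite big1 // => k _; rewrite /pairf xi mulr0 !mul0r subr0 invr1 mulr1.
rewrite /gset (negbTE oS).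
have E1 : (\prod_(k in S) x k) * (\prod_(k in S) crossf x k i) = 1.
  rewrite -big_split (eq_bigr (fun=> -1)); last first.
    move=> k kS /=; rewrite /crossf xi; field; apply: xk; exact: (subsetP ST) kS.
  by rewrite /= prodr_const -signr_odd (negbTE oS).
have E2 : (\prod_(k in T :\: S) x k) * (\prod_(k in T :\: S) crossf x i k) = 1.
  rewrite -big_split big1 // => k /=; rewrite inE => /andP[_ kT].
  by rewrite /crossf xi sub0r; field; rewrite ?oppr_eq0 xk.
rewrite !mulr1; move: E1 E2 (zcore _ _ _ _ _ _ _) (gcoef _ _ _ _).
set A := \prod_(k in S) x k; set B := \prod_(k in S) crossf x k i.
set C := \prod_(k in _ :\: _) x k; set D := \prod_(k in _ :\: _) crossf x i k.
move=> E1 E2 Z G; transitivity (G * Z * (A * B - C * D)); first by ring.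
by rewrite E1 E2 subrr mulr0.
Qed.

End Numerator.

(** * Interpolation in one variable *)

Section RatDeg.
Variable F : fieldType.
Implicit Types (E N : {poly F}) (f g : F -> F).

(** The equation is required only off the zeros of [E], so that the value of a division by zero
    never matters. *)
Definition ratdeg d E f := exists2 N : {poly F}, (size N <= d.+1)%N &
  forall t, E.[t] != 0 -> f t * E.[t] = N.[t].

Lemma ratdeg_ext d E f g : f =1 g -> ratdeg d E f -> ratdeg d E g.
Proof. by move=> fg [N sN fN]; exists N => // t Et; rewrite -fg fN. Qed.

Lemma ratdeg_const r : ratdeg 0 1 (fun=> r).
Proof. by exists r%:P => [|t _]; rewrite ?size_polyC ?leq_b1 // !hornerC mulr1. Qed.

Lemma ratdegD d E f g : ratdeg d E f -> ratdeg d E g -> ratdeg d E (fun t => f t + g t).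
Proof.
move=> [N sN fN] [M sM gM]; exists (N + M) => [|t Et].
  by apply: leq_trans (size_polyD _ _) _; rewrite geq_max sN.
by rewrite mulrDl fN // gM // hornerD.
Qed.

Lemma ratdegM d d' E E' f g : ratdeg d E f -> ratdeg d' E' g ->
  ratdeg (d + d') (E * E') (fun t => f t * g t).
Proof.
move=> [N sN fN] [M sM gM]; exists (N * M) => [|t].
  apply: leq_trans (size_polyMleq _ _) _.
  by have := leq_add sN sM; case: (size N + size M)%N => //= n; rewrite addSn addnS ltnS.
by rewrite hornerM mulf_eq0 negb_or => /andP[? ?]; rewrite !hornerM -fN // -gM // mulrACA.
Qed.

Lemma ratdeg_sum (J : finType) d E (f : J -> F -> F) :
  (forall j, ratdeg d E (f j)) -> ratdeg d E (fun t => \sum_j f j t).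
Proof.
move=> fE; have : ratdeg d E (fun t => \sum_(j <- index_enum J) f j t).
  elim: (index_enum J) => [|j r IH].
    by exists 0 => [|t _]; rewrite ?size_poly0 // big_nil mul0r horner0.
  by apply: (ratdeg_ext _ (ratdegD (fE j) IH)) => t; rewrite big_cons.
by [].
Qed.

Lemma ratdegZ d E r f : ratdeg d E f -> ratdeg d E (fun t => r * f t).
Proof. by move=> H; have := ratdegM (ratdeg_const r) H; rewrite mul1r. Qed.

End RatDeg.

(** * Degree of the lattice in one parameter, and equality at generic points *)

Section Interpolation.
Variables (F : numFieldType) (I : finType) (q a c : F).
Implicit Types (x : I -> F) (i j k : I) (l p : seq I) (T : {set I}).

Lemma lattice_eq x x' p l f : {in p ++ l, x =1 x'} ->
  lattice q a c x p l f = lattice q a c x' p l f.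
Proof.
elim: l p => //= i l IH p xx.
rewrite (IH (rcons p i)) ?cat_rcons // /rowop xx ?mem_cat ?mem_head ?orbT //.
have : {in p, x =1 x'} by move=> k kp; apply: xx; rewrite mem_cat kp.
have xi : x i = x' i by rewrite xx // mem_cat mem_head orbT.
move: (op1 _ _ _) => g; elim: p {IH xx} => //= k p IHp xxp; rewrite IHp; last first.
  by move=> k' k'p; apply: xxp; rewrite inE k'p orbT.
by rewrite /bulk xi xxp ?mem_head.
Qed.

Section Degree.
Variables (x : I -> F) (i : I).
Let y t k := if k == i then t else x k.

Lemma bulk_ratdeg j b1 b2 b3 b4 : j != i ->
  ratdeg 1 (pole_den q x j) (fun t => bulk q (y t) j i b1 b2 b3 b4).
Proof.
move=> ji; rewrite /bulk /y (negbTE ji) eqxx.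
have H (e : F) : ratdeg 1 (pole_den q x j) (fun t => e).
  exists (e *: pole_den q x j) => [|t _]; last by rewrite hornerZ.
  by apply: leq_trans (size_scale_leq _ _) _; case: (lead_lin 1 (- (q * x j))).
have H' (e e' : F) : ratdeg 1 (pole_den q x j) (fun t => (e + e' * t) / (1 - q * (x j * t))).
  exists (e%:P + e' *: 'X) => [|t]; first by case: (lead_lin e e').
  rewrite pole_denE mulrA => d; rewrite divfK //.
  by rewrite hornerD hornerC hornerZ hornerX.
have H1 := H' q (- (q * x j)); have H2 := H' (1 - q) 0.
have H3 := H' 1 (- x j); have H4 := H' 0 (x j * (1 - q)).
rewrite /bulkR; case: b1 b2 b3 b4 => [] [] [] [] //=.
- by apply: (ratdeg_ext _ H1) => t; congr (_ / _); ring.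
- by apply: (ratdeg_ext _ H2) => t; congr (_ / _); ring.
- by apply: (ratdeg_ext _ H4) => t; congr (_ / _); ring.
- by apply: (ratdeg_ext _ H3) => t; congr (_ / _); ring.
Qed.

Lemma bdryK_ratdeg b b' : ratdeg 2 (bdry_den a c) (fun t => bdryK a c (y t i) b b').
Proof.
rewrite /y eqxx.
have l1 : ratdeg 2 (bdry_den a c) (fun t => 1).
  exists (bdry_den a c) => [|t _]; last by rewrite mul1r.
  by case: (@leadM _ 1 1 _ _ _ _ (lead_lin a (-1)) (lead_lin c (-1))).
have lh : ratdeg 2 (bdry_den a c) (hfun a c).
  exists ((a * c)%:P * ((1%:P + 1 *: 'X) * (1%:P + (-1) *: 'X))) => [|t].
    by case: (@leadM _ 0 2 _ _ _ _ (leadC (a * c)) (@leadM _ 1 1 _ _ _ _ (lead_lin 1 1) (lead_lin 1 (-1)))).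
  by rewrite bdry_denE /hfun => d; rewrite divfK // hornerM hornerC bdry_numE.
case: b b' => [] [] /=.
- by apply: (ratdeg_ext _ (ratdegD l1 (ratdegZ (a * c)^-1 lh))) => t; rewrite [_ / _]mulrC.
- by apply: (ratdeg_ext _ (ratdegZ (- (a * c)^-1) lh)) => t; rewrite mulrC mulrN mulNr.
- by [].
- by apply: (ratdeg_ext _ (ratdegD l1 (ratdegZ (-1) lh))) => t; rewrite mulN1r.
Qed.

Lemma op2_ratdeg d d' E E' j k (W : F -> bool -> bool -> bool -> bool -> F) f s :
  (forall b1 b2 b3 b4, ratdeg d' E' (fun t => W t b1 b2 b3 b4)) ->
  (forall s, ratdeg d E (fun t => f t s)) ->
  ratdeg (d' + d) (E' * E) (fun t => op2 j k (W t) (f t) s).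
Proof.
move=> HW Hf; apply: ratdeg_sum => b; apply: ratdeg_sum => b'.
exact: (ratdegM (HW _ _ _ _)).
Qed.

Lemma op1_ratdeg d d' E E' j (K : F -> bool -> bool -> F) f s :
  (forall b1 b2, ratdeg d' E' (fun t => K t b1 b2)) ->
  (forall s, ratdeg d E (fun t => f t s)) ->
  ratdeg (d' + d) (E' * E) (fun t => op1 j (K t) (f t) s).
Proof. by move=> HK Hf; apply: ratdeg_sum => b; exact: (ratdegM (HK _ _)). Qed.

Lemma rowcross_ratdeg d E j p f : j != i -> i \notin p ->
  (forall s, ratdeg d E (fun t => f t s)) ->
  forall s, ratdeg d E (fun t => rowcross q (y t) j p (f t) s).
Proof.
move=> ji; elim: p => //= k p IH; rewrite inE negb_or => /andP[ik ip] Hf s.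
rewrite -[d]add0n -[E]mul1r; apply: op2_ratdeg; last exact: IH.
move=> b1 b2 b3 b4; rewrite /bulk /y (negbTE ji) eq_sym (negbTE ik).
exact: ratdeg_const.
Qed.

Lemma rowop_ratdeg d E j p f : j != i -> i \in p -> uniq p ->
  (forall s, ratdeg d E (fun t => f t s)) ->
  forall s, ratdeg d.+1 (pole_den q x j * E) (fun t => rowop q a c (y t) j p (f t) s).
Proof.
move=> ji /splitPr[p1 p2]; rewrite cat_uniq /= => /and3P[_]; rewrite !negb_or => /andP[ip1 _] /andP[ip2 _] Hf s.
rewrite (_ : (fun t => _) = (fun t => rowcross q (y t) j p1 (op2 j i (bulk q (y t) j i)
  (rowcross q (y t) j p2 (op1 j (bdryK a c (y t j)) (f t)))) s)); last first.
  by apply: funext => t; rewrite /rowop rowcross_cat.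
apply: rowcross_ratdeg => // {}s; rewrite -add1n.
apply: op2_ratdeg => [|{}s]; first by move=> *; apply: bulk_ratdeg.
apply: rowcross_ratdeg => // {}s; rewrite -[d]add0n -[E]mul1r; apply: op1_ratdeg => // b b'.
by rewrite /y (negbTE ji); apply: ratdeg_const.
Qed.

Lemma lattice_ratdeg p l f : uniq (p ++ l) -> i \in p ->
  forall s, ratdeg (size l) (\prod_(j <- l) pole_den q x j)
    (fun t => lattice q a c (y t) p l f s).
Proof.
elim: l p => [|j l IH] p upl ip s /=.
  by rewrite big_nil; apply: ratdeg_const.
rewrite big_cons; apply: rowop_ratdeg => //.
- by apply: contraTneq upl => ->; rewrite cat_uniq /= ip /= andbF.
- by move: upl; rewrite cat_uniq => /andP[].
- by move=> s'; apply: IH; rewrite ?cat_rcons // mem_rcons inE ip orbT.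
Qed.

(** Line [i] comes first, so [t] enters its boundary vertex, of degree 2, and one crossing with each
    later line, of degree 1. *)
Lemma zlat_ratdeg l : uniq (i :: l) ->
  ratdeg (2 + size l) (bdry_den a c * \prod_(j <- l) pole_den q x j)
    (fun t => zlat q a c (y t) (i :: l)).
Proof.
move=> ul; rewrite /zlat /= /rowop /=; apply: op1_ratdeg; first exact: bdryK_ratdeg.
by apply: lattice_ratdeg; rewrite ?mem_head.
Qed.

End Degree.

(** What keeps the interpolation points distinct and away from the poles, and makes the exchange
    scalars [x j - q * x i] nonzero. *)
Definition generic_point x : Prop :=
  [/\ [/\ q != 1, a != 0, a != 1 & a != -1],
      [/\ c != 0, c != 1 & c != -1],
      forall i, [/\ [/\ x i != 0, x i != 1 & x i != -1], [/\ x i != a, x i != c, a * x i != 1 & c * x i != 1]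
       & q * x i != 1 /\ q * x i != -1] &
      forall i j, i != j -> [/\ x i != x j, x i * x j != 1, q * x i != x j & 1 - q * (x i * x j) != 0]].

Lemma set_cons i l : [set k in i :: l] = i |: [set k in l].
Proof. by apply/setP => k; rewrite !inE. Qed.

(** Both sides are put over the denominator [den T] in [t = x i], and [M] is the difference of the
    numerators. Fewer lines remain at 1, -1 and the inverses, where induction applies. At [t = x j]
    the lattice part vanishes through [D], which was brought in for the apparent poles, and the rest
    by [num_pole]. *)
Lemma zlat_generic x l : uniq l -> generic_point x ->
  zlat q a c x l = zsum q a c 1 x [set k in l].
Proof.
move=> ul [[q1 a0 a1 am1] [c0 c1 cm1] G1 G2].
have [n sl] : exists n, (size l <= n)%N by exists (size l).
elim: n l sl ul => [|n IHn] [|i l] //= sl ul.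
- by rewrite [[set k in [::]]](_ : _ = set0) ?zsum_set0 /zlat /= /vacuum_ind ?eqxx //; apply/setP => k; rewrite !inE.
- by rewrite [[set k in [::]]](_ : _ = set0) ?zsum_set0 /zlat /= /vacuum_ind ?eqxx //; apply/setP => k; rewrite !inE.
rewrite set_cons; set T := [set k in l].
case/andP: (ul) => il ul'.
have iT : i \notin T by rewrite inE.
have lT k : (k \in T) = (k \in l) by rewrite inE.
have cT : #|T| = size l by rewrite cardsE; apply/card_uniqP.
pose y t k := if k == i then t else x k.
have yi t : y t i = t by rewrite /y eqxx.
have yk t k : k != i -> y t k = x k by rewrite /y => /negbTE ->.
have li k : k \in l -> k != i by move=> kl; apply: contraNneq il => <-.
have bigT (f : I -> {poly F}) : \prod_(k in T) f k = \prod_(k <- l) f k.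
  by rewrite big_uniq //; apply: eq_bigl => k; rewrite inE.
have [N sN NE] := zlat_ratdeg x ul; rewrite -/y in NE.
pose E := bdry_den a c * \prod_(k <- l) pole_den q x k.
pose D := \prod_(k <- l) diff_den x k.
have denE : den q a c x T = E * D by rewrite /den bigT big_split /= mulrA.
pose M := N * D - num q a c x T.
have IHl : zlat q a c x l = zsum q a c 1 x T by apply: IHn.
have Mt t : (E * D).[t] != 0 -> zlat q a c (y t) (i :: l) = zsum q a c 1 (y t) (i |: T) ->
    M.[t] = 0.
  move=> dt ZE; rewrite /M hornerD hornerN -(num_eval iT) denE // hornerM.
  move: (dt); rewrite hornerM mulf_eq0 negb_or => /andP[Et _].
  by rewrite -NE // -/(y t) ZE mulrA subrr.
have E0 t : t != a -> t != c -> (forall k, k \in l -> 1 - q * x k * t != 0) ->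
   (forall k, k \in l -> t != x k) -> (E * D).[t] != 0.
  move=> ta tc tp tx; rewrite hornerM mulf_neq0 //; last first.
    rewrite /D horner_prod prodf_seq_neq0; apply/allP => k kl /=.
    by rewrite diff_denE subr_eq0 tx.
  rewrite /E hornerM bdry_denE horner_prod !mulf_neq0 //.
  - by rewrite subr_eq0 eq_sym.
  - by rewrite subr_eq0 eq_sym.
  - by rewrite prodf_seq_neq0; apply/allP => k kl /=; rewrite pole_denE tp.
have zy t : zlat q a c (y t) l = zlat q a c x l.
  by rewrite /zlat; congr (_ _); apply: lattice_eq => k kl; rewrite yk ?li.
have sy t (A : {set I}) : i \notin A -> zsum q a c 1 (y t) A = zsum q a c 1 x A.
  move=> iA; rewrite /zsum; apply: eq_bigr => S SA.
  have E1 k : k \in A -> y t k = x k.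
    by move=> kA; rewrite yk //; apply: contraTneq kA => ->.
  have ES k : k \in S -> y t k = x k by move=> kS; rewrite E1 // (subsetP SA).
  have ED k : k \in A :\: S -> y t k = x k by rewrite inE => /andP[_ kA]; rewrite E1.
  rewrite /gset /zcore; congr (_ * _ * (_ * _ * _ * _)).
  - by case: odd; apply: eq_bigr => k; [exact: ED | exact: ES].
  - by apply: eq_bigr => k kS; rewrite ES.
  - by apply: eq_bigr => k kS; apply: eq_bigr => k' kS'; rewrite /crossf ES // ED.
  - by apply: eq_pairprod => k k' kS kS'; rewrite /pairf !ES.
have M_0 : M.[0] = 0.
  apply: Mt; first apply: E0; rewrite 1?eq_sym //.
  - by move=> k _; rewrite mulr0 subr0 oner_eq0.
  - by move=> k _; rewrite eq_sym; have [[]] := G1 k.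
  rewrite zlat_x0 ?yi // zsum_x0 ?yi // => k; rewrite lT => kl.
  by rewrite yk ?li //; have [[]] := G1 k.
have M_e e : e ^+ 2 = 1 -> e != a -> e != c -> (forall k, x k != e) ->
    (forall k, q * x k * e != 1) -> M.[e] = 0.
  move=> e2 ea ec ex eqx; apply: Mt; first apply: E0 => //.
  - by move=> k _; rewrite subr_eq0 eq_sym.
  - by move=> k _; rewrite eq_sym.
  rewrite zlat_h0 ?yi //; last by rewrite /hfun e2 subrr mulr0 mul0r.
  rewrite (@zsum_h0 _ _ _ _ _ _ _ _ _ e) ?yi // ?zy ?sy // => k; rewrite lT => kl.
  by rewrite yk ?li.
have M_1 : M.[1] = 0.
  apply: M_e; rewrite ?expr1n 1?eq_sym // => k; first by have [[]] := G1 k.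
  by rewrite mulr1; have [_ _ []] := G1 k.
have M_m1 : M.[-1] = 0.
  apply: M_e; rewrite ?sqrrN ?expr1n 1?eq_sym // => k; first by have [[]] := G1 k.
  by rewrite mulrN1 eqr_oppLR; have [_ _ []] := G1 k.
have M_inv j : j \in l -> M.[(x j)^-1] = 0.
  move=> jl; have [[xj0 xj1 xjm1] [xja xjc axj cxj] [qxj qxj']] := G1 j.
  have xinv r : (r == (x j)^-1) = (r * x j == 1).
    by rewrite -(inj_eq (mulIf xj0)) mulVf.
  have P k : k != j -> 1 - q * x k * (x j)^-1 != 0.
    by move=> kj; rewrite subr_eq0 eq_sym -(inj_eq (mulIf xj0)) mulfVK // mul1r; have [] := G2 _ _ kj.
  have Pj : 1 - q != 0 by rewrite subr_eq0 eq_sym.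
  have P' k : 1 - q * x k * (x j)^-1 != 0.
    by case: (eqVneq k j) => [->|/P//]; rewrite mulfK.
  apply: Mt; first apply: E0.
  - by rewrite eq_sym xinv.
  - by rewrite eq_sym xinv.
  - by move=> k _; apply: P'.
  - move=> k _; rewrite eq_sym xinv; case: (eqVneq k j) => [->|/G2[]//].
    by rewrite -expr2 sqrf_eq1 negb_or xj1.
  have ji := li j jl.
  set t := (x j)^-1; have yy : y t i * y t j = 1 by rewrite yi yk // mulVf.
  have pole k k' : k != k' -> 1 - q * (y t k * y t k') != 0.
    case: (eqVneq k i) => [->|ki]; case: (eqVneq k' i) => [->|k'i]; rewrite ?eqxx //.
    + by rewrite yi yk // [t * _]mulrC mulrA P'.
    + by rewrite yi yk // mulrA P'.
    + by rewrite !yk // => /G2[].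
  have ya k : y t k != a.
    case: (eqVneq k i) => [->|ki]; first by rewrite yi eq_sym xinv.
    by rewrite yk //; have [_ []] := G1 k.
  have yc k : y t k != c.
    case: (eqVneq k i) => [->|ki]; first by rewrite yi eq_sym xinv.
    by rewrite yk //; have [_ []] := G1 k.
  have [l1 [l2 lE]] : exists l1 l2, l = l1 ++ j :: l2.
    by case/splitPr: jl => l1 l2; exists l1, l2.
  have pl : perm_eq l (j :: l1 ++ l2) by rewrite lE (permEl (perm_catCA l1 [:: j] l2)).
  have uj : uniq (j :: l1 ++ l2) by rewrite -(perm_uniq pl).
  have il' : i \notin j :: l1 ++ l2 by rewrite -(perm_mem pl).
  (* Symmetry brings line [j] next to line [i], where [zlat_inv] removes both. *)
  rewrite lE (zlat_move pole a0 c0 ya yc (p := [:: i])) -?lE //=; last first.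
    move=> k kl; have kj : k != j.
      by apply: contraTneq kl => ->; case/andP: uj; rewrite mem_cat negb_or => /andP[].
    rewrite !yk //; first by rewrite eq_sym; have [] := G2 _ _ kj.
    by apply: li; rewrite lE mem_cat kl.
  rewrite zlat_inv //; last by rewrite /= il'.
  have -> : T = j |: [set k in l1 ++ l2].
    by apply/setP => k; rewrite inE (perm_mem pl) !inE.
  move: il'; rewrite inE negb_or => /andP[ij il'].
  case/andP: uj => jl' ul1.
  have kx k : k \in l1 ++ l2 -> k != j /\ k != i.
    by move=> kl; split; [apply: contraNneq jl' => <- | apply: contraNneq il' => <-].
  rewrite zsum_inv ?inE //; last first.
  + by move=> k; rewrite inE => /kx[kj ki]; rewrite !yk //; have [] := G2 _ _ kj.
  + move=> k; rewrite inE => /kx[kj ki]; rewrite yi yk // xinv; by have [] := G2 _ _ kj.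
  rewrite sy ?inE // -IHn //; last first.
    by move: sl; rewrite (perm_size pl); apply: ltnW.
  by rewrite /zlat; congr (_ _); apply: lattice_eq => k /kx[_ ki]; rewrite yk.
have M_x j : j \in l -> M.[x j] = 0.
  move=> jl; have jT : j \in T by rewrite lT.
  have D0 : D.[x j] = 0.
    by apply/eqP; rewrite /D horner_prod prodf_seq_eq0; apply/hasP; exists j; rewrite //= diff_denE subrr.
  rewrite /M hornerD hornerN hornerM D0 mulr0 sub0r -(setD1K jT) num_pole ?oppr0 ?setD11 //.
  - by rewrite subr_eq0 eq_sym; have [_ []] := G1 j.
  - by rewrite subr_eq0 eq_sym; have [_ []] := G1 j.
  - by move=> k; rewrite !inE => /andP[kj _]; rewrite subr_eq0 eq_sym; have [] := G2 _ _ kj.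
  - by move=> k; rewrite !inE => /andP[kj _]; rewrite -mulrA [x j * _]mulrC; have [] := G2 _ _ kj.
have M0 : M = 0.
  pose rs := [:: 0, 1, -1 & [seq (x k)^-1 | k <- l] ++ [seq x k | k <- l]].
  apply: (@roots_geq_poly_eq0 _ _ rs).
  - rewrite /= !rootE M_0 M_1 M_m1 eqxx /= all_cat !all_map.
    by apply/andP; split; apply/allP => k kl /=; rewrite rootE ?M_inv ?M_x.
  - have x0 k : x k != 0 by have [[]] := G1 k.
    have x1 k : x k != 1 by have [[]] := G1 k.
    have xm1 k : x k != -1 by have [[]] := G1 k.
    have xinv k r : (r == (x k)^-1) = (r * x k == 1).
      by rewrite -(inj_eq (mulIf (x0 k))) mulVf.
    have xinj : injective x.
      by move=> k k' E'; apply: contra_eq E' => /G2[].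
    have n11 : (1 == -1 :> F) = false by rewrite -subr_eq0 opprK (pnatr_eq0 F 2).
    rewrite /= !inE !mem_cat !negb_or cat_uniq !map_inj_uniq // ?ul' ?andbT; last exact: inj_comp invr_inj xinj.
    rewrite [0 == 1]eq_sym oner_eq0 [0 == -1]eq_sym oppr_eq0 oner_eq0 n11 /=.
    do 6?[apply/andP; split]; apply/negP.
    + by case/mapP => k _ /eqP; rewrite xinv mul0r eq_sym oner_eq0.
    + by case/mapP => k _ /eqP; rewrite eq_sym (negbTE (x0 k)).
    + by case/mapP => k _ /eqP; rewrite xinv mul1r (negbTE (x1 k)).
    + by case/mapP => k _ /eqP; rewrite eq_sym (negbTE (x1 k)).
    + by case/mapP => k _ /eqP; rewrite xinv mulN1r eqr_oppLR (negbTE (xm1 k)).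
    + by case/mapP => k _ /eqP; rewrite eq_sym (negbTE (xm1 k)).
    + case/hasP => _ /mapP[k kl ->] /mapP[k' k'l] /eqP; rewrite xinv.
      case: (eqVneq k k') => [->|/G2[_ /negbTE-> //]].
      by rewrite -expr2 sqrf_eq1 (negbTE (x1 k')) (negbTE (xm1 k')).
  - rewrite /= size_cat !size_map.
    have sD : lead (size l) D 1.
      rewrite /D; elim: (l) => [|k l' IHl']; first by rewrite big_nil; apply: leadC.
      by have := @leadM _ 1 (size l') _ _ _ _ (lead_lin (- x k) 1) IHl'; rewrite mulr1 big_cons.
    have [_ sN' ] : (2 + size l).+1 = (2 + size l).+1 /\ (size (N * D)%R <= (2 * size l).+3)%N.
      split=> //; apply: leq_trans (size_polyMleq _ _) _; case: sD => sD _.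
      have := leq_add sN sD; case: (size N + size D)%N => //= n'.
      by rewrite !addSn addnS ltnS addnn -mul2n.
    (* The formal bound on the size is [2n + 4]; the vanishing top coefficient lowers it to
       [2n + 3], exactly the number of roots. *)
    have := num_lead q x T a0 c0; rewrite cT => -[sM cM].
    apply: leq_trans (size_polyD _ _) _; rewrite size_polyN geq_max.
    rewrite addnn -mul2n sN' /=.
    apply/leq_sizeP => k; rewrite leq_eqVlt => /orP[/eqP<- //|].
    by move: k; apply/leq_sizeP.
have yx : y (x i) = x by apply: funext => k; rewrite /y; case: eqP => // ->.
have di : (E * D).[x i] != 0.
  apply: E0; try by have [_ []] := G1 i.
    by move=> k /li ki; rewrite -mulrA; have [] := G2 _ _ ki.
  by move=> k /li ki; rewrite eq_sym; have [] := G2 _ _ ki.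
apply: (mulIf di); move: (NE (x i)); rewrite -/(y _) yx => NEi.
have := @num_eval F I q a c x i T iT (x i); rewrite denE -/(y _) yx => -> //.
rewrite hornerM.
move: (di); rewrite hornerM mulf_eq0 negb_or => /andP[Ei _].
rewrite mulrA NEi //; apply/eqP; rewrite -subr_eq0 -hornerM -hornerN -hornerD.
by rewrite -/M M0 horner0.
Qed.
End Interpolation.

(** * Extension from generic to admissible parameters *)

Section Regular.
Variable F : numFieldType.
Implicit Types (P Q : {poly F}) (f g : F -> F) (A B : F -> Prop).

Definition generically A := exists2 P : {poly F}, P != 0 & forall t, P.[t] != 0 -> A t.

Lemma generic_and A B : generically A -> generically B -> generically (fun t => A t /\ B t).
Proof.
move=> [P P0 PA] [Q Q0 QB]; exists (P * Q); first by rewrite mulf_neq0.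
by move=> t; rewrite hornerM mulf_eq0 negb_or => /andP[/PA ? /QB].
Qed.

Lemma generic_imp A B : (forall t, A t -> B t) -> generically A -> generically B.
Proof. by move=> AB [P P0 PA]; exists P => // t /PA/AB. Qed.

Lemma generic_true A : (forall t, A t) -> generically A.
Proof. by move=> HA; exists 1; rewrite ?oner_eq0. Qed.

Lemma generic_all (J : finType) (A : J -> F -> Prop) :
  (forall j, generically (A j)) -> generically (fun t => forall j, A j t).
Proof.
move=> HA; suff [P P0 PA] : generically (fun t => forall j, j \in enum J -> A j t).
  by exists P => // t /PA H j; apply: H; rewrite mem_enum.
elim: (enum J) => [|j r [P P0 PA]]; first exact: generic_true.
have [Q Q0 QA] := HA j; exists (P * Q); first by rewrite mulf_neq0.
move=> t; rewrite hornerM mulf_eq0 negb_or => /andP[/PA PAt /QA Ajt] k.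
by rewrite inE => /predU1P[->|/PAt].
Qed.

Lemma generic_lead d P r : r != 0 -> lead d P r -> generically (fun t => P.[t] != 0).
Proof. by move=> r0 [_ Pd]; exists P => //; apply: contraNneq r0 => P0; rewrite -Pd P0 coef0. Qed.

Lemma poly_fun_eq0 P : (forall t, P.[t] = 0) -> P = 0.
Proof.
move=> P0; apply: (@roots_geq_poly_eq0 _ _ [seq k%:R | k <- iota 0 (size P)]).
- by apply/allP => _ /mapP[k _ ->]; rewrite rootE P0.
- by rewrite map_inj_uniq ?iota_uniq //; apply: mulrIn; rewrite oner_eq0.
- by rewrite size_map size_iota.
Qed.

(** A rational function whose denominator does not vanish at 0: its value at 0 is then determined by
    its values at generic [t]. *)
Definition regular f := exists P, exists2 Q : {poly F}, Q.[0] != 0 &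
  forall t, Q.[t] != 0 -> f t * Q.[t] = P.[t].

Lemma regular_eq0 f : regular f -> generically (fun t => f t = 0) -> f 0 = 0.
Proof.
move=> [P [Q Q0 fP]] [G G0 Gf]; suff P0 : P = 0.
  by apply: (mulIf Q0); rewrite fP // P0 horner0 mul0r.
have Qn0 : Q != 0 by apply: contraNneq Q0 => ->; rewrite horner0.
have : P * (Q * G) = 0.
  apply: poly_fun_eq0 => t; rewrite !hornerM.
  have [->|Qt] := eqVneq Q.[t] 0; first by rewrite mul0r mulr0.
  have [->|Gt] := eqVneq G.[t] 0; first by rewrite !mulr0.
  by rewrite -fP // Gf // !mul0r.
by move=> /eqP; rewrite !mulf_eq0 (negbTE Qn0) (negbTE G0) !orbF => /eqP.
Qed.

Lemma regular_eq f g : f =1 g -> regular f -> regular g.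
Proof. by move=> fg [P [Q Q0 fP]]; exists P, Q => // t Qt; rewrite -fg fP. Qed.

Lemma regular_const r : regular (fun=> r).
Proof. by exists r%:P, 1 => [|t _]; rewrite !hornerC ?oner_eq0 // mulr1. Qed.

Lemma regular_shift r : regular (fun t => r + t).
Proof.
by exists (r%:P + 'X), 1 => [|t _]; rewrite !hornerE ?oner_eq0.
Qed.

Lemma regularD f g : regular f -> regular g -> regular (fun t => f t + g t).
Proof.
move=> [P [Q Q0 fP]] [P' [Q' Q0' gP]]; exists (P * Q' + P' * Q), (Q * Q').
  by rewrite hornerM mulf_neq0.
move=> t; rewrite hornerM mulf_eq0 negb_or => /andP[Qt Qt'].
by rewrite hornerD !hornerM -fP // -gP //; ring.
Qed.

Lemma regularM f g : regular f -> regular g -> regular (fun t => f t * g t).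
Proof.
move=> [P [Q Q0 fP]] [P' [Q' Q0' gP]]; exists (P * P'), (Q * Q').
  by rewrite hornerM mulf_neq0.
move=> t; rewrite hornerM mulf_eq0 negb_or => /andP[Qt Qt'].
by rewrite !hornerM -fP // -gP //; ring.
Qed.

Lemma regularN f : regular f -> regular (fun t => - f t).
Proof.
by move=> H; apply: (regular_eq _ (regularM (regular_const (-1)) H)) => t; rewrite mulN1r.
Qed.

Lemma regularB f g : regular f -> regular g -> regular (fun t => f t - g t).
Proof. by move=> Hf Hg; apply: regularD => //; apply: regularN. Qed.

Lemma regularV f : f 0 != 0 -> regular f -> regular (fun t => (f t)^-1).
Proof.
move=> f0 [P [Q Q0 fP]]; exists (Q * Q), (P * Q).
  by rewrite hornerM -fP // !mulf_neq0.
move=> t; rewrite !hornerM mulf_eq0 negb_or => /andP[Pt Qt].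
have ft : f t != 0 by apply: contraNneq Pt => ft0; rewrite -fP // ft0 mul0r.
by rewrite -fP //; field.
Qed.

Lemma regular_div f g : g 0 != 0 -> regular f -> regular g -> regular (fun t => f t / g t).
Proof. by move=> g0 Hf Hg; apply: regularM => //; apply: regularV. Qed.

Lemma regularX f n : regular f -> regular (fun t => f t ^+ n).
Proof.
move=> Hf; elim: n => [|n IH]; first exact: regular_const.
by apply: (regular_eq _ (regularM Hf IH)) => t; rewrite exprS.
Qed.

Lemma regular_sum (J : Type) (r : seq J) (p : pred J) (f : J -> F -> F) :
  (forall j, p j -> regular (f j)) -> regular (fun t => \sum_(j <- r | p j) f j t).
Proof.
move=> H; elim: r => [|j r IH].
  by apply: (regular_eq _ (regular_const 0)) => t; rewrite big_nil.
case pj: (p j); last by apply: (regular_eq _ IH) => t; rewrite big_cons pj.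
by apply: (regular_eq _ (regularD (H j pj) IH)) => t; rewrite big_cons pj.
Qed.

Lemma regular_prod (J : Type) (r : seq J) (p : pred J) (f : J -> F -> F) :
  (forall j, p j -> regular (f j)) -> regular (fun t => \prod_(j <- r | p j) f j t).
Proof.
move=> H; elim: r => [|j r IH].
  by apply: (regular_eq _ (regular_const 1)) => t; rewrite big_nil.
case pj: (p j); last by apply: (regular_eq _ IH) => t; rewrite big_cons pj.
by apply: (regular_eq _ (regularM (H j pj) IH)) => t; rewrite big_cons pj.
Qed.

End Regular.

(** * The line of shifted parameters *)

Section Extension.
Variables (F : numFieldType) (I : finType) (q a c : F) (x : I -> F).
Implicit Types (i j k : I) (l p : seq I).

Hypothesis pole : forall i j, i != j -> 1 - q * (x i * x j) != 0.
Hypotheses (a0 : a != 0) (c0 : c != 0).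
Hypothesis xa : forall i, x i != a.
Hypothesis xc : forall i, x i != c.
Hypothesis xx : forall i j, i != j -> x i != x j.

Let qt t := q + t.
Let at_ t := a + t.
Let ct t := c + t.
Let y t i := x i + t.

Let reg_y i : regular (fun t => y t i). Proof. exact: regular_shift. Qed.
Let reg_q : regular qt. Proof. exact: regular_shift. Qed.
Let reg_a : regular at_. Proof. exact: regular_shift. Qed.
Let reg_c : regular ct. Proof. exact: regular_shift. Qed.

Let reg_h i : regular (fun t => hfun (at_ t) (ct t) (y t i)).
Proof.
apply: regular_div.
- by rewrite /at_ /ct /y !addr0 mulf_neq0 // subr_eq0 eq_sym.
- apply: regularM; first exact: regularM.
  by apply: regularB; [exact: regular_const | exact: regularX].
- by apply: regularM; apply: regularB.
Qed.

Let reg_K i b b' : regular (fun t => bdryK (at_ t) (ct t) (y t i) b b').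
Proof.
have r1 : regular (fun=> 1 : F) by apply: regular_const.
have rd : regular (fun t => hfun (at_ t) (ct t) (y t i) / (at_ t * ct t)).
  by apply: regular_div => //; [rewrite /at_ /ct !addr0 mulf_neq0 | apply: regularM].
case: b b' => [] [] /=; first exact: regularD.
- apply: (regular_eq _ (regularN rd)) => t; by rewrite mulNr.
- exact: reg_h.
- exact: regularB.
Qed.

Let reg_den i j : i != j -> regular (fun t => 1 - qt t * (y t i * y t j)).
Proof.
move=> ij; apply: regularB; first exact: regular_const.
by apply: regularM => //; apply: regularM.
Qed.

Let reg_bulk i j b1 b2 b3 b4 : i != j -> regular (fun t => bulk (qt t) (y t) i j b1 b2 b3 b4).
Proof.
move=> ij; rewrite /bulk /bulkR.
have r1 : regular (fun=> 1 : F) by apply: regular_const.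
have rz : regular (fun t => y t i * y t j) by apply: regularM.
have d0 : 1 - qt 0 * (y 0 i * y 0 j) != 0 by rewrite /qt /y !addr0 pole.
have rd := reg_den ij.
case: b1 b2 b3 b4 => [] [] [] []; try exact: regular_const;
 by (apply: regular_div => //; try apply: regularM => //; try apply: regularB => //).
Qed.

Let reg_op2 i j (W : F -> bool -> bool -> bool -> bool -> F) f :
  (forall b1 b2 b3 b4, regular (fun t => W t b1 b2 b3 b4)) ->
  (forall s, regular (fun t => f t s)) -> forall s, regular (fun t => op2 i j (W t) (f t) s).
Proof. by move=> HW Hf s; apply: regular_sum => b _; apply: regular_sum => b' _; apply: regularM. Qed.

Let reg_op1 i (K : F -> bool -> bool -> F) f :
  (forall b1 b2, regular (fun t => K t b1 b2)) ->
  (forall s, regular (fun t => f t s)) -> forall s, regular (fun t => op1 i (K t) (f t) s).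
Proof. by move=> HK Hf s; apply: regular_sum => b _; apply: regularM. Qed.

Let reg_rowcross i p f : i \notin p -> (forall s, regular (fun t => f t s)) ->
  forall s, regular (fun t => rowcross (qt t) (y t) i p (f t) s).
Proof.
elim: p => //= j p IH; rewrite inE negb_or => /andP[ij ip] Hf.
by apply: reg_op2; [move=> *; apply: reg_bulk | apply: IH].
Qed.

Lemma regular_lattice p l f : uniq (p ++ l) ->
  forall s, regular (fun t => lattice (qt t) (at_ t) (ct t) (y t) p l f s).
Proof.
elim: l p => [|i l IH] p up /=; first by move=> s; apply: regular_const.
have ip : i \notin p.
  by move: up; rewrite cat_uniq /= negb_or => /and3P[_ /andP[]].
rewrite /rowop; apply: reg_rowcross => //; apply: reg_op1; first exact: reg_K.
by apply: IH; rewrite cat_rcons.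
Qed.

Lemma regular_zsum (T : {set I}) : regular (fun t => zsum (qt t) (at_ t) (ct t) 1 (y t) T).
Proof.
apply: regular_sum => S ST; apply: regularM.
  apply: regularM; last by apply: regular_prod.
  apply: regular_div; last by apply: regularX; apply: regularM.
    by rewrite expf_neq0 // /at_ /ct !addr0 mulf_neq0.
  exact: regularX.
apply: regularM; last first.
  apply: regular_prod => i iS; apply: regular_prod => j /andP[jS ij].
  have {}ij : i != j by apply: contraTneq ij => ->; rewrite ltnn.
  apply: regular_div.
  - by rewrite /qt /y !addr0 -mulrA pole.
  - by apply: regularB; [exact: regular_const | apply: regularM].
  - by apply: (regular_eq _ (reg_den ij)) => t; rewrite mulrA.
apply: regularM; first apply: regularM.
- exact: regular_const.
- exact: regular_prod.
apply: regular_prod => i iS; apply: regular_prod => j; rewrite inE => /andP[jS _].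
have ij : i != j by apply: contraNneq jS => <-.
apply: regular_div.
- by rewrite /y !addr0 subr_eq0 xx.
- by apply: regularB; [apply: regularM | exact: regular_const].
- exact: regularB.
Qed.

(** Conditions on the differences [x i - x j], [x i - a], [x i - c] do not depend on [t]. Each of
    the others says, up to sign, that a monic polynomial of positive degree in [t] is nonzero. *)
Lemma generic_shift : generically (fun t => generic_point (qt t) (at_ t) (ct t) (y t)).
Proof.
have L r : lead 1 (r%:P + 1 *: 'X : {poly F}) 1 by apply: lead_lin.
have LE r t : (r%:P + 1 *: 'X : {poly F}).[t] = r + t by rewrite !hornerE.
have N1 (r e : F) : generically (fun t : F => r + t != e).
  apply: generic_imp (generic_lead (oner_neq0 F) (L (r - e))) => t.
  by rewrite LE addrAC subr_eq0.
have N2 (r s e : F) : generically (fun t : F => (r + t) * (s + t) != e).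
  have H := leadD (@leadM _ 1 1 _ _ _ _ (L r) (L s)) (lead_weak (lead_weak (leadC (- e)))).
  rewrite mulr1 addr0 in H; apply: generic_imp (generic_lead (oner_neq0 F) H) => t.
  by rewrite hornerD hornerM !LE hornerC subr_eq0.
have N3 (r s e : F) : generically (fun t : F => (r + t) * (s + t) != e + t).
  have H := leadD (@leadM _ 1 1 _ _ _ _ (L r) (L s)) (lead_weak (lead_lin (- e) (-1))).
  rewrite mulr1 addr0 in H; apply: generic_imp (generic_lead (oner_neq0 F) H) => t.
  rewrite hornerD hornerM !LE hornerD hornerC hornerZ hornerX mulN1r -opprD subr_eq0.
  by [].
have N4 i j : generically (fun t : F => i != j -> 1 - (q + t) * ((x i + t) * (x j + t)) != 0).
  have H := leadD (@leadM _ 1 2 _ _ _ _ (L q) (@leadM _ 1 1 _ _ _ _ (L (x i)) (L (x j))))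
     (lead_weak (lead_weak (lead_weak (leadC (-1))))).
  rewrite !mulr1 addr0 in H; apply: generic_imp (generic_lead (oner_neq0 F) H) => t.
  by rewrite hornerD !hornerM !LE hornerC -opprB oppr_eq0.
have N5 i (r : F) : x i != r -> generically (fun t : F => x i + t != r + t).
  by move=> xr; apply: generic_true => t; rewrite (inj_eq (addIr t)).
have N6 i j : generically (fun t : F => i != j -> x i + t != x j + t).
  by apply: generic_true => t ij; rewrite (inj_eq (addIr t)) xx.
have H1 := generic_and (generic_and (N1 q 1) (N1 a 0)) (generic_and (N1 a 1) (N1 a (-1))).
have H2 := generic_and (N1 c 0) (generic_and (N1 c 1) (N1 c (-1))).
have H3 := generic_all (fun i => generic_and (generic_and (generic_and (N1 (x i) 0)
  (generic_and (N1 (x i) 1) (N1 (x i) (-1)))) (generic_and (generic_and (N5 i a (xa i)) (N5 i c (xc i)))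
  (generic_and (N2 a (x i) 1) (N2 c (x i) 1)))) (generic_and (N2 q (x i) 1) (N2 q (x i) (-1)))).
have H4 := generic_all (fun i => generic_all (fun j => generic_and (generic_and (N6 i j) (N4 i j))
  (generic_and (N2 (x i) (x j) 1) (N3 q (x i) (x j))))).
apply: generic_imp (generic_and (generic_and H1 H2) (generic_and H3 H4)) => t.
move=> [[[[? ?] [? ?]] [? [? ?]]] [G3 G4]]; split => //.
  by move=> i; have [[[? [? ?]] [[? ?] [? ?]]] [? ?]] := G3 i.
by move=> i j ij; have [[D1 D2] [? ?]] := G4 i j; split; auto.
Qed.

Theorem zlat_zsum l : uniq l -> zlat q a c x l = zsum q a c 1 x [set k in l].
Proof.
move=> ul; apply/eqP; rewrite -subr_eq0; apply/eqP.
have y0 : y 0 = x by apply: funext => i; rewrite /y addr0.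
rewrite -[q]addr0 -[a]addr0 -[c]addr0 -y0.
apply: (@regular_eq0 _ (fun t => zlat (qt t) (at_ t) (ct t) (y t) l
   - zsum (qt t) (at_ t) (ct t) 1 (y t) [set k in l])).
  by apply: regularB; [exact: regular_lattice | exact: regular_zsum].
by apply: generic_imp generic_shift => t G; rewrite zlat_generic // subrr.
Qed.

End Extension.

(** * From edge configurations to local operators *)

Section Configurations.
Variables (F : fieldType) (m : nat).
Implicit Types (e : 'M[bool]_(m, m.+1)) (r : 'I_m) (p : 'I_m.+1) (pos : 'I_m -> nat).

Definition sete e r p b : 'M[bool]_(m, m.+1) :=
  \matrix_(r', p') if (r' == r) && (p' == p) then b else e r' p'.

(** [pos r] counts the vertices that line [r] has passed. Its edges 1 to [pos r] are free and all
    its other edges are 0, so a sum over supported configurations describes a partly built lattice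
    entered in state 0. *)
Definition supported pos e := [forall r, forall p : 'I_m.+1, e r p ==> (0 < p <= pos r)%N].

Lemma supportedP pos e :
  reflect (forall r p, e r p -> (0 < p <= pos r)%N) (supported pos e).
Proof.
apply: (iffP forallP) => [H r p|H r]; first by move/forallP: (H r) => /(_ p)/implyP.
by apply/forallP => p; apply/implyP/H.
Qed.

Definition advance pos r := fun r' => if r' == r then (pos r').+1 else pos r'.

Lemma sum_advance pos r p (G : 'M[bool]_(m, m.+1) -> F) : val p = (pos r).+1 ->
  \sum_(e | supported (advance pos r) e) G e =
  \sum_(e | supported pos e) \sum_(b : bool) G (sete e r p b).
Proof.
move=> pE; rewrite (partition_big (fun e => e r p) xpredT) //= exchange_big /=.
apply: eq_bigr => b _.
rewrite (reindex_onto (fun e => sete e r p b) (fun e => sete e r p false)) /=; last first.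
  move=> e /andP[_ /eqP eb]; apply/matrixP => r' p'; rewrite !mxE.
  by case E: (_ && _) => //; case/andP: E => /eqP-> /eqP->.
apply: eq_bigl => e; apply/idP/idP.
  case/andP=> /andP[/supportedP H _] /eqP E.
  have Er r' p' : e r' p' = if (r' == r) && (p' == p) then false else e r' p'.
    by rewrite -{1}E !mxE; case: (_ && _).
  apply/supportedP => r' p' ep; move: ep (H r' p'); rewrite Er mxE /advance.
  case: (eqVneq r' r) => [->|] /=; last by move=> _ ep; apply.
  case: (eqVneq p' p) => // /eqP pp ep /(_ ep) /andP[-> /=].
  by rewrite leq_eqVlt => /orP[/eqP E'|//]; case: pp; apply: val_inj; rewrite pE.
move/supportedP => H.
have erp : e r p = false.
  by apply/negP => /H; rewrite pE ltnn andbF.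
rewrite mxE !eqxx /= andbT; apply/andP; split.
  apply/supportedP => r' p'; rewrite mxE /advance.
  case: (eqVneq r' r) => [->|] /=; last by move=> _; apply: H.
  case: (eqVneq p' p) => [-> _|_ /H/andP[-> /leqW//]].
  by rewrite pE leqnn.
apply/eqP/matrixP => r' p'; rewrite !mxE; case E: (_ && _) => //.
by case/andP: E => /eqP-> /eqP->; rewrite erp.
Qed.

Definition front pos e : {ffun 'I_m -> bool} := [ffun r => e r (inord (pos r))].

Definition agree pos e e' := forall r p, (p <= pos r)%N -> e r p = e' r p.

Lemma agree_sete pos e r p b : (pos r < p)%N -> agree pos e (sete e r p b).
Proof.
move=> rp r' p' pp'; rewrite mxE; case: eqP => //= rr; case: eqP => // E.
by move: pp'; rewrite rr E leqNgt rp.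
Qed.

Lemma front_sete pos e r p b : val p = (pos r).+1 -> (forall r', pos r' <= m)%N ->
  front (advance pos r) (sete e r p b) = upd (front pos e) r b.
Proof.
move=> pE Hm; apply/ffunP => r'; rewrite !ffunE mxE /advance.
case: (eqVneq r' r) => [->|] //=; rewrite (_ : inord _ = p) ?eqxx //.
by rewrite -pE inord_val.
Qed.

(** One more vertex is one more local operator: [W], the weight of the vertices already passed, sees
    only edges up to the front, and only the new edge [p] is summed. [sum_op2] does the same for a
    crossing. *)
Lemma sum_op1 pos r p (K : bool -> bool -> F) (W : 'M[bool]_(m, m.+1) -> F) f :
  (forall r', pos r' <= m)%N ->
  val p = (pos r).+1 -> (forall e e', agree pos e e' -> W e = W e') ->
  \sum_(e | supported (advance pos r) e)
    W e * K (e r (inord (pos r))) (e r p) * f (front (advance pos r) e) =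
  \sum_(e | supported pos e) W e * op1 r K f (front pos e).
Proof.
move=> Hm pE HW; rewrite (sum_advance _ pE); apply: eq_bigr => e _.
rewrite /op1 big_distrr; apply: eq_bigr => b _ /=.
rewrite front_sete // -(HW e); last by apply: agree_sete; rewrite pE.
rewrite !mxE !eqxx /= ffunE mulrA.
rewrite (_ : inord (pos r) == p = false) //; apply/negbTE.
by rewrite -val_eqE /= inordK ?ltnS ?Hm // pE neq_ltn ltnSn.
Qed.

Lemma sum_op2 pos r r' p p' (R : bool -> bool -> bool -> bool -> F)
   (W : 'M[bool]_(m, m.+1) -> F) f : r != r' ->
  (forall r', pos r' <= m)%N ->
  val p = (pos r).+1 -> val p' = (pos r').+1 -> (forall e e', agree pos e e' -> W e = W e') ->
  \sum_(e | supported (advance (advance pos r) r') e)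
    W e * R (e r (inord (pos r))) (e r' (inord (pos r'))) (e r p) (e r' p')
    * f (front (advance (advance pos r) r') e) =
  \sum_(e | supported pos e) W e * op2 r r' R f (front pos e).
Proof.
move=> rr' Hm pE pE' HW.
have Hm' r0 : (advance pos r r0 <= m)%N.
  by rewrite /advance; case: eqP => [->|//]; rewrite -pE -ltnS ltn_ord.
have E' : val p' = (advance pos r r').+1 by rewrite /advance eq_sym (negbTE rr').
rewrite (sum_advance _ E') (sum_advance _ pE); apply: eq_bigr => e _.
rewrite /op2 big_distrr; apply: eq_bigr => b _ /=; rewrite big_distrr.
apply: eq_bigr => b' _ /=.
rewrite !front_sete // -(HW e); last first.
  move=> r0 p0 H0; rewrite -(@agree_sete pos _ r' p' b') ?pE' //.
  by rewrite -(@agree_sete pos _ r p b) ?pE.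
rewrite !mxE !eqxx /= !ffunE mulrA [r' == r]eq_sym (negbTE rr') /=.
have n1 : (inord (pos r) == p) = false.
  by apply/negbTE; rewrite -val_eqE /= inordK ?ltnS ?Hm // pE neq_ltn ltnSn.
have n2 : (inord (pos r') == p') = false.
  by apply/negbTE; rewrite -val_eqE /= inordK ?ltnS ?Hm // pE' neq_ltn ltnSn.
by rewrite n1 n2.
Qed.

Variables (q a c : F) (x : 'rV[F]_m).

Let xf i := x 0 i.

(** The front once the lines before [k] are complete among themselves and line [k] has crossed the
    rows before [l]: an earlier line has passed [k] vertices, and one more if it is already crossed
    by line [k]. *)
Definition posn (k l : nat) r : nat :=
  if (r < k)%N then (if (r < l)%N then k.+1 else k) else if r == k :> nat then l else 0.

Definition bulk_weight e (i j : 'I_m) := bulkR q (x 0 i * x 0 j)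
  (e i (before j)) (e j (before i)) (e i (after j)) (e j (after i)).

Definition line_weight e (i : 'I_m) :=
  (\prod_(j < m | (j < i)%N) bulk_weight e i j) *
  bdryK a c (x 0 i) (e i (before i)) (e i (after i)).

Definition lines_weight k e := \prod_(i < m | (i < k)%N) line_weight e i.

Definition partial_weight l e (k : 'I_m) := \prod_(j < m | (j < l)%N) bulk_weight e k j.

Lemma posn_leq (k l : nat) r : (k <= m)%N -> (l <= k)%N -> (k = m -> l = 0%N) ->
  (posn k l r <= m)%N.
Proof.
move=> km lk H; rewrite /posn; case: ifP => rk.
  case: ifP => // rl; move: km; rewrite leq_eqVlt => /orP[/eqP E|//].
  by rewrite H // in rl.
by case: ifP => // _; apply: leq_trans lk km.
Qed.

Lemma bulk_weight_agree pos e e' (i j : 'I_m) : agree pos e e' -> (j < pos i)%N -> (i < pos j)%N ->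
  bulk_weight e i j = bulk_weight e' i j.
Proof.
move=> ee ji ij; rewrite /bulk_weight !ee //=; exact: ltnW.
Qed.

Lemma lines_weight_agree k l e e' : agree (posn k l) e e' -> lines_weight k e = lines_weight k e'.
Proof.
move=> ee; apply: eq_bigr => i ik; rewrite /line_weight.
have P (j : 'I_m) : (j < k)%N -> (k <= posn k l j)%N.
  by move=> jk; rewrite /posn jk; case: ifP.
have ip := P i ik.
congr (_ * _).
  apply: eq_bigr => j ji; apply: (bulk_weight_agree ee).
    exact: leq_trans (ltn_trans ji ik) ip.
  exact: leq_trans ik (P j (ltn_trans ji ik)).
by rewrite !ee //= ?(leq_trans ik) // (leq_trans (ltnW ik)).
Qed.

Lemma partial_weight_agree (k : 'I_m) l e e' : (l <= k)%N -> agree (posn k l) e e' ->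
  partial_weight l e k = partial_weight l e' k.
Proof.
move=> lk ee; apply: eq_bigr => j jl; apply: (bulk_weight_agree ee).
  by rewrite /posn ltnn eqxx.
by rewrite /posn (leq_trans jl lk) jl.
Qed.

Lemma supported_ext pos pos' : pos =1 pos' -> supported pos =1 supported pos'.
Proof.
move=> pp e; apply: eq_forallb => r; apply: eq_forallb => p; by rewrite pp.
Qed.

Lemma front_ext pos pos' e : pos =1 pos' -> front pos e = front pos' e.
Proof. by move=> pp; apply/ffunP => r; rewrite !ffunE pp. Qed.

Lemma advance_bulk (k l : 'I_m) : (l < k)%N ->
  advance (advance (posn k l) k) l =1 posn k l.+1.
Proof.
move=> lk r; rewrite /advance /posn -!val_eqE /=.
case: (ltngtP r l) => [rl|rl|->].
- by rewrite !(ltn_trans rl lk) ltn_eqF ?(ltn_trans rl lk) // ltnS (ltnW rl).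
- case: (ltngtP r k) => rk //; first by rewrite ltnS leqNgt rl.
by rewrite lk ltn_eqF // ltnSn.
Qed.

Lemma advance_bdry (k : 'I_m) : advance (posn k k) k =1 posn k.+1 0.
Proof.
move=> r; rewrite /advance /posn -!val_eqE /= ltnS.
by case: (ltngtP r k) => rk //=; rewrite if_same.
Qed.

Lemma take_enum_rcons (k : 'I_m) : take k.+1 (enum 'I_m) = rcons (take k (enum 'I_m)) k.
Proof.
by rewrite (take_nth k) ?size_enum_ord // nth_ord_enum.
Qed.

Lemma lattice_rcons l i f :
  lattice q a c xf [::] (rcons l i) f = lattice q a c xf [::] l (rowop q a c xf i l f).
Proof. by rewrite -cats1 lattice_cat. Qed.

Lemma partial_sum_bulk (k : 'I_m) l f : (l <= k)%N ->
  (forall f, \sum_(e | supported (posn k 0) e) lines_weight k e * f (front (posn k 0) e) =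
     lattice q a c xf [::] (take k (enum 'I_m)) f (@vacuum _)) ->
  \sum_(e | supported (posn k l) e)
     lines_weight k e * partial_weight l e k * f (front (posn k l) e) =
  lattice q a c xf [::] (take k (enum 'I_m)) (rowcross q xf k (take l (enum 'I_m)) f) (@vacuum _).
Proof.
move=> lk H; elim: l lk f => [|l IH] lk f.
  rewrite take0 /= -H; apply: eq_bigr => e _.
  by rewrite /partial_weight big_pred0 ?mulr1.
have lm : (l < m)%N by apply: ltn_trans lk (ltn_ord k).
pose l' := Ordinal lm.
rewrite (take_enum_rcons l') -cats1 rowcross_cat /= -IH; last exact: ltnW.
have P r : (posn k l r <= m)%N.
  by apply: posn_leq; [apply: ltnW | apply: ltnW | move=> E; move: (ltn_ord k); rewrite E ltnn].
have pk : posn k l k = l by rewrite /posn ltnn eqxx.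
have pl : posn k l l' = k by rewrite /posn lk ltnn.
have kl : k != l' by rewrite -val_eqE /= gtn_eqF.
have := @sum_op2 (posn k l) k l' (after l') (after k) (bulk q xf k l')
  (fun e => lines_weight k e * partial_weight l e k) f kl P.
rewrite pk pl /= => <- //; last first.
  move=> e e' ee; rewrite (lines_weight_agree ee) (partial_weight_agree _ ee) //; exact: ltnW.
rewrite (eq_bigl _ _ (supported_ext (advance_bulk (k := k) (l := l') lk))).
apply: eq_bigr => e _; rewrite (front_ext _ (advance_bulk (k := k) (l := l') lk)).
congr (_ * _); rewrite -mulrA; congr (_ * _).
rewrite /partial_weight (bigD1 l') ?ltnSn //= mulrC; congr (_ * _).
  by apply: eq_bigl => j; rewrite -val_eqE /= ltnS ltn_neqAle andbC.
rewrite /bulk_weight /bulk; congr bulkR; congr (e _ _); apply: val_inj => /=; rewrite inordK //.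
  by rewrite ltnS ltnW.
by rewrite ltnS ltnW.
Qed.

Lemma partial_sum k f : (k <= m)%N ->
  \sum_(e | supported (posn k 0) e) lines_weight k e * f (front (posn k 0) e) =
  lattice q a c xf [::] (take k (enum 'I_m)) f (@vacuum _).
Proof.
elim: k f => [|k IH] f km.
  rewrite take0 /= (big_pred1 0) => [|e].
    rewrite /lines_weight big_pred0 // mul1r; congr f.
    by apply/ffunP => r; rewrite !ffunE mxE.
  apply/supportedP/eqP => [H|->]; last by move=> r p; rewrite mxE.
  apply/matrixP => r p; rewrite mxE; case E: (e r p) => //.
  by have := H r p E; rewrite /posn ltn0 if_same leqn0; case: (nat_of_ord p).
pose k' := Ordinal km.
rewrite (take_enum_rcons k') lattice_rcons /rowop.
rewrite -(@partial_sum_bulk k') //; last by move=> g; apply: IH; apply: ltnW.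
have P r : (posn k' k' r <= m)%N.
  by apply: posn_leq => //=; [apply: ltnW | move=> /eqP E; move: (ltn_ord k'); rewrite ltn_neqAle E].
have pk : posn k k k' = k by rewrite /posn ltnn eqxx.
have := @sum_op1 (posn k k) k' (after k') (bdryK a c (xf k'))
  (fun e => lines_weight k e * partial_weight k e k') f P.
rewrite pk /= => <- //; last first.
  by move=> e e' ee; rewrite (lines_weight_agree ee) (@partial_weight_agree k' _ _ _ _ ee).
rewrite (eq_bigl _ _ (supported_ext (advance_bdry k'))).
apply: eq_bigr => e _; rewrite (front_ext _ (advance_bdry k')); congr (_ * _).
rewrite /lines_weight (bigD1 k') ?ltnSn //= mulrC -mulrA; congr (_ * _).
  by apply: eq_bigl => j; rewrite -val_eqE /= ltnS ltn_neqAle andbC.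
rewrite /line_weight; congr (_ * bdryK _ _ _ (e _ _) _); apply: val_inj => /=.
by rewrite inordK // ltnS ltnW.
Qed.

Lemma partition_function_zlat :
  partition_function q a c x = zlat q a c xf (enum 'I_m).
Proof.
have := partial_sum (@vacuum_ind F _) (leqnn m).
rewrite -[X in take X](size_enum_ord m) take_size -/(zlat _ _ _ _ _) => <-.
have pm r : posn m 0 r = m by rewrite /posn ltn_ord.
(* All lines being complete, support only says that the bottom edges are 0; the exits are tested by
   [vacuum_ind]. *)
rewrite /partition_function (bigID (fun e => supported (posn m 0) e)) /=.
rewrite [X in _ + X]big1 ?addr0 => [|e /andP[/forallP H /supportedP[]]]; last first.
  move=> r p erp; rewrite pm leq_ord andbT lt0n; apply: contraTneq erp => p0.
  by rewrite (_ : p = ord0) ?(eqP (proj1 (andP (H r)))) //; apply: val_inj.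
rewrite big_mkcond [RHS]big_mkcond; apply: eq_bigr => e _ /=.
case: (boolP (supported _ e)) => [/supportedP S|_]; rewrite ?andbF //= andbT.
have E0 r : e r ord0 = false by apply/negP => /S.
have W : config_weight q a c x e = lines_weight m e.
  rewrite /config_weight /lines_weight -big_split; apply: eq_big => i; first by rewrite ltn_ord.
  by move=> _ /=; rewrite mulrC.
rewrite W /vacuum_ind; case: forallP => H.
  rewrite (_ : front _ e = vacuum _) ?eqxx ?mulr1 //; apply/ffunP => r; rewrite !ffunE pm.
  by case/andP: (H r) => _ /eqP <-; congr (e _ _); apply: val_inj; rewrite /= inordK.
rewrite (_ : _ == _ = false) ?mulr0 //; apply/eqP => E; case: H => r.
rewrite E0 eqxx /=; move/ffunP: E => /(_ r); rewrite !ffunE pm => <-.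
by apply/eqP; congr (e _ _); apply: val_inj; rewrite /= inordK.
Qed.

End Configurations.

(** * Pfaffians as functions of sets *)

Section PfaffianRecursion.
Variable F : fieldType.

Definition pfsum n (B : 'I_n -> 'I_n -> F) : F :=
  \sum_(s : 'S_n) (-1) ^+ s * \prod_(k < n./2) B (s (pf_fst k)) (s (pf_snd k)).

Lemma sum_lift_perm n (f : 'S_n.+1 -> F) :
  \sum_s f s = \sum_(i : 'I_n.+1) \sum_(s : 'S_n) f (lift_perm ord0 i s).
Proof.
pose g (u : 'I_n.+1 * 'S_n) := lift_perm ord0 u.1 u.2.
have gI : injective g.
  move=> [i s] [j t] /= E; have ij : i = j.
    by rewrite -(lift_perm_id ord0 i s) -(lift_perm_id ord0 j t) -/(g (i, s)) E.
  rewrite -ij in E *; congr (_, _); apply/permP => k; apply: (@lift_inj _ i).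
  by rewrite -!(lift_perm_lift ord0) -/(g (i, s)) E.
have gB : bijective g by apply: inj_card_bij => //; rewrite card_prod card_ord !card_Sn factS.
by rewrite (reindex g) /=; [rewrite -(pair_bigA _ (fun i s => f (g (i, s)))) | apply: onW_bij].
Qed.

(** Permutations are sorted by the images of the first two positions. This yields all ordered pairs
    at once, which is why [normal_pfaffian] averages over pairs. *)
Lemma pfsum_rec n (B : 'I_n.+2 -> 'I_n.+2 -> F) :
  pfsum B = \sum_(i < n.+2) \sum_(j < n.+1) (-1) ^+ (i + j) * B i (lift i j) *
    pfsum (fun k l => B (lift i (lift j k)) (lift i (lift j l))).
Proof.
rewrite /pfsum sum_lift_perm; apply: eq_bigr => i _.
rewrite sum_lift_perm; apply: eq_bigr => j _; rewrite big_distrr.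
apply: eq_bigr => s _ /=.
rewrite big_ord_recl.
have E0 : pf_fst (n := n.+2) ord0 = ord0 by apply: val_inj.
have E1 : pf_snd (n := n.+2) ord0 = lift ord0 ord0 by apply: val_inj.
rewrite E0 E1 lift_perm_id lift_perm_lift lift_perm_id.
have -> : (-1) ^+ lift_perm ord0 i (lift_perm ord0 j s) = (-1) ^+ (i + j) * (-1) ^+ s :> F.
  rewrite !odd_lift_perm /= exprD -(signr_odd _ i) -(signr_odd _ j) -!signr_addb.
  by congr (_ ^+ nat_of_bool _); case: (odd i) (odd j) (odd_perm s) => [] [] [].
rewrite -!mulrA; congr (_ * _); rewrite mulrCA; congr (_ * (_ * _)).
apply: eq_bigr => k _.
have F1 : pf_fst (n := n.+2) (lift ord0 k) = lift ord0 (lift ord0 (pf_fst k)).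
  by apply: val_inj; rewrite /= /bump /= !add1n.
have F2 : pf_snd (n := n.+2) (lift ord0 k) = lift ord0 (lift ord0 (pf_snd k)).
  by apply: val_inj; rewrite /= /bump /= !add1n.
by rewrite F1 F2 !lift_perm_lift.
Qed.

Definition upper_prod n (w : 'I_n -> 'I_n -> F) :=
  \prod_(i < n) \prod_(j < n | (i < j)%N) w i j.

Lemma prod_sign_ltn n (i : 'I_n.+1) : \prod_(k < n) (if (lift i k < i)%N then -1 else 1) = (-1) ^+ i :> F.
Proof.
have iN : (i <= n)%N by rewrite -ltnS.
rewrite -big_mkcond /= (eq_bigl (fun k : 'I_n => (k < i)%N)); last first.
  by move=> k; rewrite /= /bump; case: (leqP i k) => ik; rewrite ?add0n // add1n ltnNge (leqW ik).
by rewrite -(big_ord_widen _ (fun=> -1) iN) prodr_const card_ord.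
Qed.

(** Index [i] has exactly [i] predecessors, and each of them contributes a sign when its factor is
    written as [w i _]. These signs will cancel those of [pfsum_rec]. *)
Lemma upper_prod_lift n (w : 'I_n.+1 -> 'I_n.+1 -> F) (i : 'I_n.+1) :
  (forall j k, j != k -> w j k = - w k j) ->
  upper_prod w = (-1) ^+ i * (\prod_(k < n) w i (lift i k)) *
    upper_prod (fun j k => w (lift i j) (lift i k)).
Proof.
move=> wA; rewrite /upper_prod (bigD1_ord i) //= big_mkcond (bigD1_ord i) //= ltnn mul1r.
rewrite [X in _ * X](eq_bigr (fun j => (if (lift i j < i)%N then w (lift i j) i else 1) *
   \prod_(k < n | (j < k)%N) w (lift i j) (lift i k))); last first.
  move=> j _; rewrite big_mkcond (bigD1_ord i) //= [in RHS]big_mkcond; congr (_ * _).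
  apply: eq_bigr => k _; congr (if _ then _ else _).
  by rewrite -!/(bump _ _) !ltnNge leq_bump2.
rewrite big_split /= mulrA; congr (_ * _).
rewrite -prod_sign_ltn -!big_split; apply: eq_bigr => k _ /=.
case: (ltngtP i (bump i k)) => [||E]; rewrite ?mulr1 ?mul1r //.
  by move=> _; rewrite mulN1r wA // eq_sym neq_lift.
by have := neq_bump i k; rewrite -E eqxx.
Qed.

End PfaffianRecursion.

(** * Order-free normalisation of the Pfaffian *)

Section NormalizedPfaffian.
Variables (F : numFieldType) (I : finType).
Implicit Types (w A B : I -> I -> F) (T S U : {set I}).

Definition cofactor_weight w (a b : I) U : F := \prod_(k in U) (w a k * w b k).

(* [E T] is the Pfaffian of [A] on [T] multiplied by the product of the [w i j] over the
   pairs of [T]; unlike the Pfaffian it does not depend on the order of [T]. *)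
Definition normal_pfaffian w A (E : {set I} -> F) :=
  E set0 = 1 /\ forall T, ~~ odd #|T| ->
    \sum_(a in T) \sum_(b in T :\ a)
      A a b * w a b * cofactor_weight w a b (T :\ a :\ b) * E (T :\ a :\ b) = #|T|%:R * E T.

Lemma imset_lift n (f : 'I_n.+1 -> I) i : injective f ->
  (f @: setT) :\ f i = (fun j => f (lift i j)) @: setT.
Proof.
move=> fI; apply/setP => k; rewrite !inE; apply/andP/imsetP.
  case=> ki /imsetP[j _ kE]; case: (unliftP i j) => [j'|] jE; last by rewrite kE jE eqxx in ki.
  by exists j' => //; rewrite kE jE.
case=> j _ ->; rewrite (inj_eq fI) eq_sym neq_lift; split=> //; exact: imset_f.
Qed.

Lemma big_imset_setT n (f : 'I_n -> I) (R : Type) (idx : R) (op : Monoid.com_law idx) (g : I -> R) :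
  injective f -> \big[op/idx]_(k in f @: setT) g k = \big[op/idx]_(j < n) g (f j).
Proof.
move=> fI; rewrite big_imset /=; last by move=> ? ? _ _; apply: fI.
by apply: eq_bigl => j; rewrite inE.
Qed.

(** Removing [i], then [j], yields [(-1) ^+ (i + j)] both from the permutations and from the ordered
    product, so no sign is left. The normalising factor grows by [2 * (h + 1)], which is the [#|T|]
    of the recursion. *)
Lemma normal_pfaffianE w A E n (f : 'I_n -> I) :
  (forall a b, a != b -> w a b = - w b a) -> normal_pfaffian w A E -> ~~ odd n -> injective f ->
  upper_prod (fun i j => w (f i) (f j)) * pfaffian (\matrix_(i, j) A (f i) (f j)) = E (f @: setT).
Proof.
move=> wA [E0 Erec] nE fI.
suff H : upper_prod (fun i j => w (f i) (f j)) * pfsum (fun i j => A (f i) (f j)) =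
   (2 ^ n./2 * (n./2)`!)%:R * E (f @: setT).
  have -> : pfaffian (\matrix_(i, j) A (f i) (f j)) =
      ((2 ^ n./2 * (n./2)`!)%:R)^-1 * pfsum (fun i j => A (f i) (f j)).
    rewrite /pfaffian (negbTE nE); congr (_ * _); apply: eq_bigr => s _; congr (_ * _).
    by apply: eq_bigr => k _; rewrite mxE.
  rewrite mulrCA H mulKf // pnatr_eq0 muln_eq0 negb_or expn_eq0 /=.
  by rewrite -lt0n fact_gt0.
have [h hE] : exists h, n = h.*2 by exists n./2; rewrite -[LHS]odd_double_half (negbTE nE).
move: n hE f fI nE => _ -> f fI _; rewrite doubleK.
elim: h f fI => [|h IH] f fI.
  rewrite /upper_prod big_ord0 mul1r /pfsum.
  have -> : f @: setT = set0.
    by apply/setP => k; rewrite inE; apply/imsetP => -[[]].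
  rewrite E0 (big_pred1 1%g) ?big_ord0 ?odd_perm1 ?mulr1 // => s /=.
  by symmetry; apply/eqP/permP => -[].
set T := f @: setT.
have cT : #|T| = h.*2.+2 by rewrite /T card_imset // cardsT card_ord.
rewrite pfsum_rec big_distrr /=.
transitivity ((2 ^ h * h`!)%:R * (\sum_(a in T) \sum_(b in T :\ a)
      A a b * w a b * cofactor_weight w a b (T :\ a :\ b) * E (T :\ a :\ b))).
  rewrite big_imset_setT // big_distrr; apply: eq_bigr => i _ /=.
  have fiI : injective (fun j => f (lift i j)) by move=> j k /fI/lift_inj.
  rewrite imset_lift // big_imset_setT // !big_distrr; apply: eq_bigr => j _ /=.
  have fijI : injective (fun k => f (lift i (lift j k))) by move=> k l /fiI/lift_inj.
  rewrite (imset_lift j fiI) -mulrCA.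
  rewrite (upper_prod_lift i); last by move=> k l kl; apply: wA; rewrite (inj_eq fI).
  rewrite (upper_prod_lift j); last by move=> k l kl; apply: wA; rewrite (inj_eq fiI).
  rewrite (bigD1_ord j) //= /cofactor_weight big_imset_setT // big_split /=.
  have := IH _ fijI; rewrite -/(upper_prod _) => IHij.
  have s1 : (-1) ^+ i * (-1) ^+ i = 1 :> F by rewrite -expr2 sqrr_sign.
  have s2 : (-1) ^+ j * (-1) ^+ j = 1 :> F by rewrite -expr2 sqrr_sign.
  rewrite exprD; set X := upper_prod _ in IHij *; set Y := pfsum _ in IHij *.
  set P := \prod_(_ < _) _; set Q := \prod_(_ < _) _.
  set Z := E _ in IHij *.
  transitivity (((-1) ^+ i * (-1) ^+ i) * ((-1) ^+ j * (-1) ^+ j) * A (f i) (f (lift i j)) *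
     w (f i) (f (lift i j)) * (P * Q) * (X * Y)); first by ring.
  by rewrite s1 s2 IHij; ring.
rewrite Erec ?cT /= ?odd_double // mulrA -natrM; congr (_%:R * _).
by rewrite -doubleS -muln2 factS expnS; ring.
Qed.

End NormalizedPfaffian.

(** * Sum rule and Schur Pfaffians *)

Section Exchange.
Variables (F : fieldType) (I : finType).
Implicit Types (T S U : {set I}) (a b : I) (G : I -> I -> {set I} -> F).

(** Serves the pairs lying outside [S] in the sum rule; [exchange_inner] serves those inside, with
    [S] enlarged by the pair. *)
Lemma exchange_outer T G :
  \sum_(a in T) \sum_(b in T :\ a) \sum_(S : {set I} | (S \subset T :\ a :\ b) && ~~ odd #|S|) G a b S =
  \sum_(S : {set I} | (S \subset T) && ~~ odd #|S|)
    \sum_(a in T :\: S) \sum_(b in (T :\: S) :\ a) G a b S.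
Proof.
rewrite pair_big_dep /= (exchange_big_dep (fun S => (S \subset T) && ~~ odd #|S|)) /=; last first.
  by move=> [a b] S _ /andP[]; rewrite !subsetD1 -andbA => /and3P[-> _ _] ->.
apply: eq_bigr => S /andP[ST oS]; rewrite pair_big_dep /=; apply: eq_bigl => -[a b] /=.
rewrite !subsetD1 ST oS /= !inE andbT.
by case: (a \in S) (b \in S) (a \in T) (b \in T) (b == a) => [] [] [] [] [].
Qed.

Lemma exchange_inner T G :
  \sum_(a in T) \sum_(b in T :\ a) \sum_(S : {set I} | (S \subset T :\ a :\ b) && ~~ odd #|S|) G a b S =
  \sum_(S : {set I} | (S \subset T) && ~~ odd #|S|)
    \sum_(a in S) \sum_(b in S :\ a) G a b (S :\ a :\ b).
Proof.
transitivity (\sum_(a in T) \sum_(b in T :\ a)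
  \sum_(S : {set I} | [&& S \subset T, ~~ odd #|S|, a \in S & b \in S]) G a b (S :\ a :\ b)).
  apply: eq_bigr => a aT; apply: eq_bigr => b; rewrite !inE => /andP[ba bT].
  rewrite (reindex_onto (fun S => S :\ a :\ b) (fun S => a |: (b |: S))) /=; last first.
    move=> S /andP[/subsetP H _].
    have aS : a \notin S by apply/negP => /H; rewrite !inE eqxx andbF.
    have bS : b \notin S by apply/negP => /H; rewrite !inE eqxx.
    by rewrite setU1K ?setU1K // !inE negb_or aS eq_sym ba.
  apply: eq_bigl => S.
  apply/idP/idP => [/andP[/andP[ST oS] /eqP SE]|/and4P[ST oS aS bS]].
    have aS : a \in S by rewrite -SE !inE eqxx.
    have bS : b \in S by rewrite -SE !inE eqxx orbT.
    rewrite aS bS !andbT; apply/andP; split.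
      apply/subsetP => k kS; case: (eqVneq k a) => [->//|ka]; case: (eqVneq k b) => [->//|kb].
      by have := subsetP ST k; rewrite !inE ka kb kS => /(_ isT).
    by rewrite [#|S|](cardsD1 a) aS (cardsD1 b (S :\ a)) !inE ba bS /= negbK.
  have SE : a |: (b |: S :\ a :\ b) = S by rewrite setD1K ?setD1K // !inE ba bS.
  rewrite SE eqxx andbT; apply/andP; split; first by do 2 apply: setSD.
  by move: oS; rewrite [#|S|](cardsD1 a) aS (cardsD1 b (S :\ a)) !inE ba bS /= negbK.
rewrite pair_big_dep /= (exchange_big_dep (fun S => (S \subset T) && ~~ odd #|S|)) /=; last first.
  by move=> [a b] S _ /and4P[-> ->].
apply: eq_bigr => S /andP[ST oS]; rewrite pair_big_dep /=; apply: eq_bigl => -[a b] /=.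
rewrite ST oS /= !inE; case: (boolP (a \in S)) => aS; rewrite ?andbF //=.
case: (boolP (b \in S)) => bS; rewrite ?andbF //=.
by rewrite (subsetP ST a aS) (subsetP ST b bS) !andbT.
Qed.

End Exchange.

(** * The Pfaffian of a sum, and Schur's Pfaffian in order-free form *)

Section SumRule.
Variables (F : numFieldType) (I : finType) (w : I -> I -> F).
Hypothesis wA : forall a b, a != b -> w a b = - w b a.
Implicit Types (T S U : {set I}) (a b : I).

Definition crossprod S U : F := \prod_(i in S) \prod_(j in U) w i j.

Lemma crossprodD1l a S U : a \in S -> crossprod S U = (\prod_(k in U) w a k) * crossprod (S :\ a) U.
Proof. by move=> aS; rewrite /crossprod (big_setD1 a). Qed.

Lemma crossprodD1r a S U : a \in U -> crossprod S U = (\prod_(k in S) w k a) * crossprod S (U :\ a).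
Proof.
move=> aU; rewrite /crossprod -big_split; apply: eq_bigr => k kS /=.
by rewrite (big_setD1 a).
Qed.

Lemma cofactor_weight_split a b T S : S \subset T ->
  cofactor_weight w a b T = cofactor_weight w a b S * cofactor_weight w a b (T :\: S).
Proof. by move=> ST; rewrite /cofactor_weight (big_setID S) /= (setIidPr ST). Qed.

Definition sum_pfaffian (phi psi : {set I} -> F) T : F :=
  \sum_(S : {set I} | (S \subset T) && ~~ odd #|S|) crossprod S (T :\: S) * phi S * psi (T :\: S).

(** A pair taken from [A] belongs to [S], a pair taken from [B] to the complement. For fixed [S] the
    two recursions then give the factors [#|S|] and [#|T :\: S|], whose sum is [#|T|]. *)
Lemma normal_pfaffianD A B phi psi :
  normal_pfaffian w A phi -> normal_pfaffian w B psi ->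
  normal_pfaffian w (fun a b => A a b + B a b) (sum_pfaffian phi psi).
Proof.
move=> [phi0 phiE] [psi0 psiE]; split.
  rewrite /sum_pfaffian (big_pred1 set0) => [|S].
    by rewrite setD0 phi0 psi0 /crossprod big_set0 !mul1r.
  by rewrite subset0 /=; case: eqP => // ->; rewrite cards0.
move=> T oT.
transitivity (\sum_(a in T) \sum_(b in T :\ a) \sum_(S : {set I} | (S \subset T :\ a :\ b) && ~~ odd #|S|)
   A a b * w a b * cofactor_weight w a b (T :\ a :\ b) *
     (crossprod S (T :\ a :\ b :\: S) * phi S * psi (T :\ a :\ b :\: S))
  + \sum_(a in T) \sum_(b in T :\ a) \sum_(S : {set I} | (S \subset T :\ a :\ b) && ~~ odd #|S|)
   B a b * w a b * cofactor_weight w a b (T :\ a :\ b) *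
     (crossprod S (T :\ a :\ b :\: S) * phi S * psi (T :\ a :\ b :\: S))).
  rewrite -big_split; apply: eq_bigr => a _ /=; rewrite -big_split; apply: eq_bigr => b _ /=.
  by rewrite -!big_distrr /= -/(sum_pfaffian phi psi _) !mulrDl.
rewrite exchange_inner exchange_outer -big_split /sum_pfaffian big_distrr.
apply: eq_bigr => S /andP[ST oS] /=.
have oTS : ~~ odd #|T :\: S|.
  by move: oT; rewrite -(cardsID S T) (setIidPr ST) oddD (negbTE oS).
have cT : #|T| = (#|S| + #|T :\: S|)%N by rewrite -(cardsID S T) (setIidPr ST).
rewrite cT natrD.
transitivity (crossprod S (T :\: S) * psi (T :\: S) * (#|S|%:R * phi S) +
   crossprod S (T :\: S) * phi S * (#|T :\: S|%:R * psi (T :\: S))); last by ring.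
rewrite -phiE // -psiE //; congr (_ + _).
  rewrite big_distrr; apply: eq_bigr => a aS /=; rewrite big_distrr; apply: eq_bigr => b /=.
  rewrite !inE => /andP[ba bS].
  have bSa : b \in S :\ a by rewrite !inE ba.
  have aT := subsetP ST a aS; have bT := subsetP ST b bS.
  have -> : T :\ a :\ b :\: (S :\ a :\ b) = T :\: S.
    apply/setP => k; rewrite !inE; case: (eqVneq k a) => [->|_]; rewrite ?aS ?andbF //=.
    by case: (eqVneq k b) => [->|_]; rewrite ?bS ?andbF.
  rewrite (@cofactor_weight_split _ _ _ (S :\ a :\ b)); last by do 2 apply: setSD.
  have -> : T :\ a :\ b :\: (S :\ a :\ b) = T :\: S.
    apply/setP => k; rewrite !inE; case: (eqVneq k a) => [->|_]; rewrite ?aS ?andbF //=.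
    by case: (eqVneq k b) => [->|_]; rewrite ?bS ?andbF.
  rewrite (crossprodD1l _ aS) (crossprodD1l _ bSa).
  rewrite {2}/cofactor_weight big_split /=; ring.
rewrite big_distrr; apply: eq_bigr => a aTS /=; rewrite big_distrr; apply: eq_bigr => b /= bTS.
have E : T :\ a :\ b :\: S = (T :\: S) :\ a :\ b.
  by apply/setP => k; rewrite !inE; case: (k == a) (k == b) (k \in S) => [] [] [].
move: (aTS); rewrite !inE => /andP[aS aT].
move: (bTS); rewrite !inE => /and3P[ba bS bT].
have SS : S \subset T :\ a :\ b by rewrite !subsetD1 ST aS bS.
rewrite (cofactor_weight_split _ _ SS) !E.
rewrite (crossprodD1r _ aTS) (crossprodD1r _ bTS).
(* Here [a] and [b] lie outside [S], so [crossprod] has them as second arguments; the two signs of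
   each [k] cancel. *)
have -> : cofactor_weight w a b S = (\prod_(k in S) w k a) * \prod_(k in S) w k b.
  rewrite -big_split; apply: eq_bigr => k kS /=.
  by rewrite !(wA (a := _) (b := k)) ?mulrNN //; [apply: contraNneq bS => -> | apply: contraNneq aS => ->].
by ring.
Qed.

(* [lam] will vanish at an appended variable 1, where [sig] may degenerate. *)
Lemma normal_pfaffian_schur (lam : I -> F) (sig : I -> I -> F) :
  (forall a b, a != b -> sig a b = - sig b a) ->
  (forall a b, a != b -> lam a != 0 -> lam b != 0 -> sig a b != 0) ->
  (forall T a, ~~ odd #|T| -> a \in T -> (forall k, k \in T -> lam k != 0) ->
     \sum_(b in T :\ a) \prod_(k in T :\ a :\ b) (sig a k * sig b k)^-1 = 1) ->
  normal_pfaffian w (fun a b => lam a * lam b * sig a b)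
    (fun T => (\prod_(i in T) lam i) * pairprod T (fun i j => sig i j * w i j)).
Proof.
move=> sigA sig0 sigS; split; first by rewrite big_set0 pairprod0 mulr1.
move=> T oT; case: (boolP [forall k in T, lam k != 0]) => [/forall_inP l0|].
  (* For each fixed [a] the sum over [b] is already the claimed value; [#|T|] counts the choices of
     [a]. *)
  rewrite -sum1_card natr_sum big_distrl; apply: eq_bigr => a aT /=.
  rewrite mul1r -[RHS]mulr1 -[X in _ = _ * X](sigS T a) // big_distrr; apply: eq_bigr => b bTa /=.
  move: (bTa); rewrite !inE => /andP[ba bT].
  have psym i j : i != j -> sig i j * w i j = sig j i * w j i.
    by move=> ij; rewrite sigA // wA // mulrNN.
  have PE (i : I) S : i \in S -> pairprod S (fun i j => sig i j * w i j) =
      (\prod_(k in S :\ i) (sig i k * w i k)) * pairprod (S :\ i) (fun i j => sig i j * w i j).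
    move=> iS; pose p' k l := if k == l then 0 else sig k l * w k l.
    have pp' S' : pairprod S' (fun i j => sig i j * w i j) = pairprod S' p'.
      apply: eq_bigr => k kS; apply: eq_bigr => l /andP[lS kl].
      by rewrite /p'; case: eqP kl => // ->; rewrite ltnn.
    rewrite !pp' -{1}(setD1K iS) pairprodU1 ?setD11 //; last first.
      by move=> j; rewrite /p' [j == i]eq_sym; case: eqVneq => // ij; apply: psym.
    by congr (_ * _); apply: eq_bigr => k; rewrite !inE /p' eq_sym => /andP[/negbTE-> _].
  rewrite (PE a T) // (PE b (T :\ a)) // (big_setD1 a aT) /=.
  rewrite (big_setD1 b bTa) /= (big_setD1 b bTa) /=.
  set V := T :\ a :\ b.
  have sa : \prod_(k in V) (sig a k * w a k) = (\prod_(k in V) sig a k) * \prod_(k in V) w a k.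
    by rewrite big_split.
  have sb : \prod_(k in V) (sig b k * w b k) = (\prod_(k in V) sig b k) * \prod_(k in V) w b k.
    by rewrite big_split.
  have sc : cofactor_weight w a b V = (\prod_(k in V) w a k) * \prod_(k in V) w b k.
    by rewrite /cofactor_weight big_split.
  have si : \prod_(k in V) (sig a k * sig b k)^-1 = ((\prod_(k in V) sig a k) * \prod_(k in V) sig b k)^-1.
    by rewrite prodfV big_split.
  rewrite sa sb sc si.
  have na : \prod_(k in V) sig a k != 0.
    apply/prodf_neq0 => k; rewrite !inE => /and3P[kb ka kT]; apply: sig0; rewrite ?l0 //.
    by rewrite eq_sym.
  have nb : \prod_(k in V) sig b k != 0.
    apply/prodf_neq0 => k; rewrite !inE => /and3P[kb ka kT]; apply: sig0; rewrite ?l0 //.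
    by rewrite eq_sym.
  move: na nb; move: (\prod_(k in V) sig a k) (\prod_(k in V) sig b k) => P Q na nb.
  by field; rewrite na nb.
(* If [lam] vanishes at [k0], both sides are 0: [k0] is [a], or [b], or remains in the cofactor. *)
rewrite negb_forall_in => /exists_inP[k0 k0T]; rewrite negbK => /eqP lk0.
rewrite [\prod_(i in T) lam i](big_setD1 k0) //= lk0 !mul0r mulr0.
apply: big1 => a aT; apply: big1 => b; rewrite !inE => /andP[ba bT].
case: (eqVneq k0 a) => [E|k0a]; first by rewrite -E lk0 !mul0r.
case: (eqVneq k0 b) => [E|k0b]; first by rewrite -E lk0 mulr0 !mul0r.
by rewrite [\prod_(i in _) lam i](big_setD1 k0) ?inE ?k0a ?k0b //= lk0 !mul0r mulr0.
Qed.

End SumRule.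

(** * Schur identities *)

Section SchurIdentity.
Variables (F : numFieldType) (I : finType).
Implicit Types (z : I -> F) (U : {set I}).

Definition schur_coef z U j : F := \prod_(k in U :\ j) ((1 - z j * z k) / (z j - z k)).

Definition schur_sum1 z U := \sum_(j in U) schur_coef z U j = (odd #|U|)%:R.

(** At [y = z a], divided by the product of the [y - z k], this is the expansion of Schur's Pfaffian
    along the row of [a]. The correction for even [#|U|] is what the border compensates. *)
Definition schur_sum2 z U := forall y,
  \sum_(j in U) schur_coef z U j * ((y - z j) * \prod_(k in U :\ j) (1 - z k * y)) =
  \prod_(k in U) (y - z k) - (~~ odd #|U|)%:R * \prod_(k in U) (1 - z k * y).

(** [M] has degree at most [#|U|] and vanishes at the inverses of the nodes, as in Lagrange
    interpolation; the coefficient [s - 1] is chosen to make it vanish at 1 as well. Hence [M] is 0,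
    and its value at -1 then determines [s]. *)
Lemma schur_sums_generic z U : {in U &, injective z} ->
  (forall k, k \in U -> [/\ z k != 0, z k != 1 & z k != -1]) -> schur_sum1 z U /\ schur_sum2 z U.
Proof.
move=> zI zn; pose s := \sum_(j in U) schur_coef z U j.
pose L := \sum_(j in U) schur_coef z U j *: (diff_den z j * \prod_(k in U :\ j) one_minus z k).
pose M := L - \prod_(k in U) diff_den z k - (s - 1) *: \prod_(k in U) one_minus z k.
have LE y : L.[y] = \sum_(j in U) schur_coef z U j * ((y - z j) * \prod_(k in U :\ j) (1 - z k * y)).
  rewrite /L horner_sum; apply: eq_bigr => j _.
  rewrite hornerZ hornerM diff_denE horner_prod; congr (_ * (_ * _)).
  by apply: eq_bigr => k _; rewrite one_minusE.
have ME y : M.[y] = L.[y] - \prod_(k in U) (y - z k) - (s - 1) * \prod_(k in U) (1 - z k * y).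
  rewrite /M hornerD hornerD !hornerN hornerZ !horner_prod.
  by congr (_ - _ - _ * _); apply: eq_bigr => k _; rewrite ?diff_denE ?one_minusE.
have Ls e : e ^+ 2 = 1 -> L.[e] = e * s * \prod_(k in U) (1 - z k * e).
  move=> e2; rewrite LE /s big_distrr big_distrl; apply: eq_bigr => j jU /=.
  rewrite [X in _ = _ * X](big_setD1 j) //=.
  have -> : e - z j = e * (1 - z j * e) by rewrite mulrBr mulr1 mulrCA -expr2 e2 mulr1.
  by ring.
have M1 : M.[1] = 0.
  rewrite ME Ls ?expr1n //.
  have -> : \prod_(k in U) (1 - z k) = \prod_(k in U) (1 - z k * 1).
    by apply: eq_bigr => k _; rewrite mulr1.
  by ring.
have MV k : k \in U -> M.[(z k)^-1] = 0.
  move=> kU; have [zk0 _ _] := zn k kU.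
  rewrite ME LE (big_setD1 k kU) /= [\sum_(i in U :\ k) _]big1 ?addr0; last first.
    move=> j; rewrite !inE => /andP[jk jU].
    rewrite (big_setD1 k) ?inE ?kU ?andbT 1?eq_sym //=.
    by rewrite divff // subrr mul0r !mulr0.
  rewrite [\prod_(k0 in U) (1 - _)](big_setD1 k kU) /= divff // subrr mul0r mulr0 subr0.
  rewrite [\prod_(k0 in U) _](big_setD1 k kU) /= mulrCA -mulrBr /schur_coef -big_split /=.
  rewrite (eq_bigr (fun l => (z k)^-1 - z l)) ?subrr ?mulr0 // => l.
  rewrite !inE => /andP[lk lU]; field.
  by rewrite zk0 subr_eq0; apply: contraNneq lk => E; apply/eqP/zI.
have M0 : M = 0.
  apply: (@roots_geq_poly_eq0 _ _ (1 :: [seq (z k)^-1 | k <- enum U])).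
  - rewrite /= rootE M1 eqxx all_map; apply/allP => k; rewrite mem_enum => kU /=.
    by rewrite rootE MV.
  - rewrite /= map_inj_in_uniq ?enum_uniq ?andbT.
      apply/mapP => -[k]; rewrite mem_enum => kU E; have [_ /eqP zk1 _] := zn k kU.
      by apply: zk1; rewrite -[LHS]invrK -E invr1.
    by move=> k l; rewrite !mem_enum => kU lU /invr_inj; apply: zI.
  rewrite /= size_map -cardE.
  have l1 := lead_prod U (fun k => lead_lin (- z k) 1).
  have l2 := lead_prod U (fun k => lead_lin 1 (- z k)).
  have l3 j : j \in U -> lead (1 * #|U|) (schur_coef z U j *: (diff_den z j * \prod_(k in U :\ j) one_minus z k))
     (schur_coef z U j * (1 * \prod_(k in U :\ j) (- z k))).
    move=> jU; apply: leadZ; rewrite mul1n (cardsD1 j) jU -[#|_|]mul1n.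
    by apply: leadM; [exact: lead_lin | apply: lead_prod => k; exact: lead_lin].
  have [sM _] := leadD (leadD (lead_sum l3) (leadZ (-1) l1)) (leadZ (- (s - 1)) l2).
  by move: sM; rewrite mul1n scaleN1r scaleNr.
have sE : s = (odd #|U|)%:R.
  have P0 : \prod_(k in U) (1 - z k * -1) != 0.
    apply/prodf_neq0 => k kU; have [_ _ zk] := zn k kU.
    by rewrite mulrN1 opprK addrC addr_eq0.
  have := ME (-1); rewrite M0 horner0 Ls ?sqrrN ?expr1n //.
  have -> : \prod_(k in U) (-1 - z k) = (-1) ^+ odd #|U| * \prod_(k in U) (1 - z k * -1).
    rewrite signr_odd -prodr_const -big_split; apply: eq_bigr => k _ /=; ring.
  move: P0; set P := \prod_(_ in _) _ => P0 E.
  have {}E : (2 * s - (1 - (-1) ^+ odd #|U|)) * P = 0.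
    by rewrite -[RHS]oppr0 E; ring.
  have {}E : 2 * s - (1 - (-1) ^+ odd #|U|) = 0 by apply: (mulIf P0); rewrite E mul0r.
  have n2 : (2 : F) != 0 by rewrite (pnatr_eq0 F 2).
  apply: (mulfI n2); move/eqP: E; rewrite subr_eq0 => /eqP ->.
  by case: odd; rewrite ?expr0 ?expr1 /=; ring.
split=> // y; rewrite -LE; apply/eqP; rewrite -subr_eq0; apply/eqP.
rewrite -[RHS](horner0 y) -M0 ME sE.
by case: odd => /=; ring.
Qed.

Lemma generic_nodes z U : generically (fun t => forall k, k \in U ->
  [/\ z k + t != 0, z k + t != 1 & z k + t != -1]).
Proof.
have N1 (r e : F) : generically (fun t : F => r + t != e).
  apply: generic_imp (generic_lead (oner_neq0 F) (lead_lin (r - e) 1)) => t.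
  by rewrite !hornerE addrAC subr_eq0.
apply: generic_imp (generic_all (fun k => generic_and (N1 (z k) 0) (generic_and (N1 (z k) 1) (N1 (z k) (-1))))).
by move=> t H k _; have [? [? ?]] := H k.
Qed.

Lemma regular_schur_coef z U j : {in U &, injective z} -> j \in U ->
  regular (fun t => schur_coef (fun k => z k + t) U j).
Proof.
move=> zI jU; apply: regular_prod => k; rewrite !inE => /andP[kj kU].
apply: regular_div.
- by rewrite !addr0 subr_eq0; apply: contraNneq kj => E; apply/eqP/zI.
- apply: regularB; first exact: regular_const.
  by apply: regularM; apply: regular_shift.
- by apply: regularB; apply: regular_shift.
Qed.

(** A common shift keeps the nodes distinct and moves them off 0, 1 and -1. *)
Lemma schur_sums z U : {in U &, injective z} -> schur_sum1 z U /\ schur_sum2 z U.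
Proof.
move=> zI.
have zIt t : {in U &, injective (fun k => z k + t)} by move=> k l kU lU /addIr; apply: zI.
have z0 : (fun k => z k + 0) = z by apply: funext => k; rewrite addr0.
have G := generic_nodes z U.
split.
  apply/eqP; rewrite -subr_eq0 -z0; apply/eqP.
  apply: (@regular_eq0 _ (fun t => \sum_(j in U) schur_coef (fun k => z k + t) U j - (odd #|U|)%:R)).
    apply: regularB; last exact: regular_const.
    by apply: regular_sum => j jU; apply: regular_schur_coef.
  apply: generic_imp G => t /(schur_sums_generic (zIt t))[-> _].
  by rewrite subrr.
move=> y; apply/eqP; rewrite -subr_eq0 -z0; apply/eqP.
apply: (@regular_eq0 _ (fun t => \sum_(j in U) schur_coef (fun k => z k + t) U j *
   ((y - (z j + t)) * \prod_(k in U :\ j) (1 - (z k + t) * y)) -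
   (\prod_(k in U) (y - (z k + t)) - (~~ odd #|U|)%:R * \prod_(k in U) (1 - (z k + t) * y)))).
  have r1 k : regular (fun t => y - (z k + t)).
    by apply: regularB; [exact: regular_const | exact: regular_shift].
  have r2 k : regular (fun t => 1 - (z k + t) * y).
    apply: regularB; [exact: regular_const | apply: regularM; [exact: regular_shift | exact: regular_const]].
  apply: regularB.
    apply: regular_sum => j jU; apply: regularM; first exact: regular_schur_coef.
    by apply: regularM => //; apply: regular_prod.
  apply: regularB; first exact: regular_prod.
  by apply: regularM; [exact: regular_const | exact: regular_prod].
apply: generic_imp G => t /(schur_sums_generic (zIt t))[_ ->].
by rewrite subrr.
Qed.

(* The border point [o] plays the role of a variable equal to 1 with the
   value of [Sfun x 1] fixed to -1 even at [x = 1]. *)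
Definition bordered_S (o : I) z (a b : I) : F :=
  if a == o then (if b == o then 0 else 1) else
  if b == o then -1 else Sfun (z a) (z b).

Lemma bordered_SA o z a b : a != b -> bordered_S o z a b = - bordered_S o z b a.
Proof.
move=> ab; rewrite /bordered_S; case: (eqVneq a o) => ao; case: (eqVneq b o) => bo; rewrite ?oppr0 ?opprK //.
by rewrite /Sfun -[RHS]mulNr opprB [z b * _]mulrC.
Qed.

Lemma bordered_schur o z (T : {set I}) (a : I) : ~~ odd #|T| -> a \in T ->
  {in T :\ o &, injective z} ->
  (forall i j, i \in T :\ o -> j \in T :\ o -> i != j -> z i * z j != 1) ->
  \sum_(b in T :\ a) \prod_(k in T :\ a :\ b) (bordered_S o z a k * bordered_S o z b k)^-1 = 1.
Proof.
move=> oT aT zI z1.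
have oTa : odd #|T :\ a| by move: oT; rewrite (cardsD1 a) aT /= negbK.
have SV (i j : I) : (Sfun (z i) (z j))^-1 = (1 - z i * z j) / (z i - z j).
  by rewrite /Sfun invf_div.
have [ao|ao] := eqVneq a o.
  rewrite ao in aT oTa *; have [S1 _] := schur_sums zI; rewrite /schur_sum1 oTa in S1.
  rewrite -[RHS]S1; apply: eq_bigr => b; rewrite !inE => /andP[bo bT].
  apply: eq_bigr => k; rewrite !inE => /and3P[kb ko kT].
  by rewrite /bordered_S eqxx (negbTE ko) (negbTE bo) mul1r SV.
have zIa : {in T :\ a :\ o &, injective z}.
  by move=> i j; rewrite !inE => /and3P[io _ iT] /and3P[jo _ jT]; apply: zI; rewrite !inE ?io ?jo.
have [S1 S2] := schur_sums zIa.
set U := T :\ a :\ o in S1 S2 *.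
have zaU k : k \in U -> z a - z k != 0.
  rewrite !inE => /and3P[ko ka kT]; rewrite subr_eq0; apply: contraNneq ka => E.
  by apply/eqP/zI; rewrite ?inE ?ko ?kT ?ao ?aT.
have Pa : \prod_(k in U) (z a - z k) != 0 by apply/prodf_neq0 => k /zaU.
have main : \sum_(b in U) \prod_(k in U :\ b) (Sfun (z a) (z k) * Sfun (z b) (z k))^-1 =
    1 - (~~ odd #|U|)%:R * \prod_(k in U) (Sfun (z a) (z k))^-1.
  have -> : \prod_(k in U) (Sfun (z a) (z k))^-1 =
      (\prod_(k in U) (1 - z k * z a)) / \prod_(k in U) (z a - z k).
    by rewrite -prodf_div; apply: eq_bigr => k _; rewrite SV [z k * _]mulrC.
  apply: (mulIf Pa); rewrite mulrBl mul1r -mulrA divfK // -S2 big_distrl.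
  apply: eq_bigr => b bU /=; rewrite [\prod_(k in U) (z a - z k)](big_setD1 b bU) /= mulrCA.
  rewrite [RHS]mulrCA; congr (_ * _); rewrite /schur_coef -!big_split; apply: eq_bigr => k.
  rewrite !inE => /and4P[kb ko ka kT] /=.
  rewrite invfM !SV; have : z a - z k != 0 by apply: zaU; rewrite !inE ko ka.
  by move=> n; rewrite mulrAC divfK // mulrC [z k * z a]mulrC.
have [oT'|oT'] := boolP (o \in T); last first.
  have UE : U = T :\ a by apply/setP => k; rewrite !inE; case: eqP => // ->; rewrite (negbTE oT') andbF.
  rewrite -UE; rewrite UE oTa mul0r subr0 -UE in main; rewrite -[RHS]main.
  apply: eq_bigr => b; rewrite !inE => /and3P[bo _ _]; apply: eq_bigr => k.
  by rewrite !inE => /and4P[_ ko _ _]; rewrite /bordered_S (negbTE ao) (negbTE bo) (negbTE ko).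
have oTa' : o \in T :\ a by rewrite !inE oT' eq_sym ao.
have oU : ~~ odd #|U| by move: oTa; rewrite (cardsD1 o) oTa'.
rewrite (big_setD1 o oTa') /= -/U.
have -> : \prod_(k in U) (bordered_S o z a k * bordered_S o z o k)^-1 = \prod_(k in U) (Sfun (z a) (z k))^-1.
  apply: eq_bigr => k; rewrite !inE => /and3P[ko _ _].
  by rewrite /bordered_S (negbTE ao) (negbTE ko) eqxx mulr1.
have -> : \sum_(b in U) \prod_(k in T :\ a :\ b) (bordered_S o z a k * bordered_S o z b k)^-1 =
  \sum_(b in U) \prod_(k in U :\ b) (Sfun (z a) (z k) * Sfun (z b) (z k))^-1.
  apply: eq_bigr => b; rewrite !inE => /and3P[bo ba bT].
  have ob : o \in T :\ a :\ b by rewrite !inE oT' !(eq_sym o) bo ao.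
  rewrite (big_setD1 o ob) /= /bordered_S (negbTE ao) (negbTE bo) eqxx mulrNN mulr1 invr1 mul1r.
  have -> : T :\ a :\ b :\ o = U :\ b by apply/setP => k; rewrite !inE andbCA.
  apply: eq_bigr => k; rewrite !inE => /and4P[_ ko _ _]; by rewrite (negbTE ko).
by rewrite main oU mul1r addrC subrK.
Qed.

End SchurIdentity.

(** * The Pfaffians of Qe and Qo *)

Lemma setU1_ind (I : finType) (P : {set I} -> Prop) : P set0 ->
  (forall i (S : {set I}), i \notin S -> P S -> P (i |: S)) -> forall S, P S.
Proof.
move=> P0 PU S; have [n] := ubnP #|S|; elim: n S => // n IH S.
have [->//|[i iS]] := set_0Vmem S; rewrite (cardsD1 i) iS ltnS => Sn.
by rewrite -(setD1K iS); apply: PU; rewrite ?setD11 //; apply: IH.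
Qed.

Section PairProdImage.
Variable F : fieldType.

Lemma pairprodZ (I : finType) (S : {set I}) (r : F) (p : I -> I -> F) :
  pairprod S (fun i j => r * p i j) = r ^+ 'C(#|S|, 2) * pairprod S p.
Proof.
have H : pairprod S (fun=> fun=> r) = r ^+ 'C(#|S|, 2).
  elim/setU1_ind: S => [|i S iS IH]; first by rewrite pairprod0 cards0.
  by rewrite pairprodU1 // IH cardsU1 iS prodr_const -exprD add1n binS bin1 addnC.
rewrite -H /pairprod -big_split; apply: eq_bigr => i iS /=.
by rewrite -big_split.
Qed.

Lemma pairprod_imset (I J : finType) (f : I -> J) (S : {set I}) (p : J -> J -> F) :
  injective f -> (forall i j, p i j = p j i) ->
  pairprod (f @: S) p = pairprod S (fun i j => p (f i) (f j)).
Proof.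
move=> fI ps; elim/setU1_ind: S => [|i S iS IH]; first by rewrite imset0 !pairprod0.
rewrite imsetU1 pairprodU1 //; last first.
  by apply: contra iS => /imsetP[j jS /fI ->].
rewrite pairprodU1 //; first by rewrite IH big_imset //= => k l _ _; apply: fI.
Qed.

End PairProdImage.

Section OptionSets.
Variables (F : fieldType) (J : finType).
Implicit Types (S : {set J}) (f : {set option J} -> F).

Lemma None_notin_imset S : (None \in [set Some k | k in S]) = false.
Proof. by apply/imsetP => -[]. Qed.

Lemma Some_in_imset S j : (Some j \in [set Some k | k in S]) = (j \in S).
Proof. by apply: mem_imset => ? ? []. Qed.

Lemma card_Some S : #|[set Some k | k in S]| = #|S|.
Proof. by apply: card_imset => ? ? []. Qed.

Lemma imset_SomeK S : Some @^-1: [set Some k | k in S] = S.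
Proof. by apply/setP => j; rewrite inE Some_in_imset. Qed.

Lemma sum_sets_Some (P : pred nat) f :
  \sum_(S : {set option J} | (None \notin S) && P #|S|) f S =
  \sum_(S : {set J} | P #|S|) f [set Some k | k in S].
Proof.
rewrite (reindex_onto (fun S : {set J} => [set Some k | k in S]) (fun S : {set option J} => Some @^-1: S)) /=; last first.
  move=> S /andP[nS _]; apply/setP => -[j|]; first by rewrite Some_in_imset inE.
  by rewrite None_notin_imset (negbTE nS).
by apply: eq_bigl => S; rewrite None_notin_imset card_Some imset_SomeK eqxx andbT.
Qed.

Lemma sum_sets_None (P : pred nat) f :
  \sum_(S : {set option J} | (None \in S) && P #|S|) f S =
  \sum_(S : {set J} | P #|S|.+1) f (None |: [set Some k | k in S]).
Proof.
rewrite (reindex_onto (fun S : {set J} => None |: [set Some k | k in S]) (fun S : {set option J} => Some @^-1: S)) /=; last first.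
  move=> S /andP[nS _]; apply/setP => -[j|]; first by rewrite !inE Some_in_imset inE.
  by rewrite !inE nS.
apply: eq_bigl => S; rewrite setU11 cardsU1 None_notin_imset card_Some add1n /=.
rewrite (_ : _ @^-1: _ = S) ?eqxx ?andbT //.
by apply/setP => j; rewrite !inE Some_in_imset.
Qed.

End OptionSets.

(** * The two Pfaffians as even and odd parts of the subset sum *)

Section Assembly.
Variables (F : numClosedFieldType) (q qh a c u : F) (n : nat) (x : 'I_n -> F).
Hypotheses (qE : qh ^+ 2 = q) (q0 : q != 0) (a0 : a != 0) (c0 : c != 0).
Hypothesis xx : forall i j, i != j -> x i != x j.
Hypothesis x1 : forall i j, i != j -> x i * x j != 1.
Hypothesis qx : forall i j, i != j -> hfun a c (x i) != 0 -> hfun a c (x j) != 0 ->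
  q * x i * x j != 1.
Implicit Types (S : {set 'I_n}).

Let qh0 : qh != 0. Proof. by move: q0; rewrite -qE expf_eq0. Qed.

(** [None] is the border index. Paired before it with a variable it has weight 1, so it leaves the
    prefactor unchanged. *)
Let w (o p : option 'I_n) : F :=
  match o, p with
  | Some i, Some j => (1 - x i * x j) / (x i - x j)
  | Some _, None => 1
  | None, Some _ => -1
  | None, None => 0
  end.

Let node (r : F) (o : option 'I_n) : F := if o is Some i then r * x i else 0.

Let wA o p : o != p -> w o p = - w p o.
Proof.
case: o p => [i|] [j|] //= _; last by rewrite opprK.
by rewrite -[x i - x j]opprB invrN mulrN [x i * _]mulrC.
Qed.

Let sig r := bordered_S None (node r).

Let sig_eq r i j : sig r (Some i) (Some j) = Sfun (r * x i) (r * x j).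
Proof. by []. Qed.

Let sig0 r (lam : option 'I_n -> F) : r != 0 ->
  (forall i j, i != j -> lam (Some i) != 0 -> lam (Some j) != 0 -> (r * x i) * (r * x j) != 1) ->
  forall o p, o != p -> lam o != 0 -> lam p != 0 -> sig r o p != 0.
Proof.
move=> r0 H [i|] [j|] //= op lo lp; rewrite /sig /bordered_S /= ?oner_eq0 ?oppr_eq0 ?oner_eq0 //.
have ij : i != j by apply: contraNneq op => ->.
rewrite /Sfun mulf_neq0 ?invr_eq0 ?subr_eq0 ?(inj_eq (mulfI r0)) ?xx //.
by rewrite eq_sym H.
Qed.

(** [r = qh] and [r = 1] provide the two summands of [Qe] and of [Qo]. *)
Let schur r (lam : option 'I_n -> F) : r != 0 ->
  (forall i j, i != j -> lam (Some i) != 0 -> lam (Some j) != 0 -> (r * x i) * (r * x j) != 1) ->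
  normal_pfaffian w (fun o p => lam o * lam p * sig r o p)
    (fun T => (\prod_(o in T) lam o) * pairprod T (fun o p => sig r o p * w o p)).
Proof.
move=> r0 H; apply: (normal_pfaffian_schur wA).
- by move=> o p; apply: bordered_SA.
- exact: sig0.
move=> T o oT oin lT; apply: bordered_schur => //.
  move=> [i|] [j|]; rewrite !inE //= => _ _ /(mulfI r0) E.
  by congr Some; apply: contra_eq E; apply: xx.
move=> [i|] [j|]; rewrite !inE //= => iT jT ij; by apply: H; rewrite ?lT.
Qed.

(** The differences [x i - x j] cancel: [r = qh] leaves [qh] times the pair factor of the subset
    sum, and [r = 1] leaves 1 when [x i * x j != 1]. *)
Let sigw r i j : i != j -> sig r (Some i) (Some j) * w (Some i) (Some j) =
  r * ((1 - x i * x j) / (1 - r ^+ 2 * x i * x j)).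
Proof.
move=> ij; rewrite sig_eq /Sfun /w -mulrBr (_ : r * x i * (r * x j) = r ^+ 2 * x i * x j); last by ring.
have d : x i - x j != 0 by rewrite subr_eq0 xx.
move: (1 - r ^+ 2 * x i * x j)^-1 => e.
transitivity (r * ((1 - x i * x j) * e) * ((x i - x j) / (x i - x j))); first by ring.
by rewrite divff // mulr1.
Qed.

Let pair_sigw r S : pairprod [set Some k | k in S] (fun o p => sig r o p * w o p) =
  r ^+ 'C(#|S|, 2) * pairprod S (fun i j => (1 - x i * x j) / (1 - r ^+ 2 * x i * x j)).
Proof.
rewrite pairprod_imset; first last.
- by move=> o p; case: (eqVneq o p) => [->//|op]; rewrite [sig r p o]bordered_SA 1?eq_sym // [w p o]wA 1?eq_sym // mulrNN.
- by move=> ? ? [].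
rewrite -pairprodZ; apply: eq_bigr => i iS; apply: eq_bigr => j /andP[jS ij].
by apply: sigw; apply: contraTneq ij => ->; rewrite ltnn.
Qed.

Let pair_sigw1 S : pairprod [set Some k | k in S] (fun o p => sig 1 o p * w o p) = 1.
Proof.
rewrite pair_sigw expr1n mul1r /pairprod big1 // => i iS; rewrite big1 // => j /andP[jS ij].
rewrite expr1n mul1r divff // subr_eq0 eq_sym x1 //.
by apply: contraTneq ij => ->; rewrite ltnn.
Qed.

Let pair_pairf S : pairprod S (fun i j => (1 - x i * x j) / (1 - qh ^+ 2 * x i * x j)) =
  pairprod S (pairf q x).
Proof. by rewrite qE. Qed.

Let cross_pair S : ~~ odd (#|S| * #|~: S|) ->
  crossprod w [set Some k | k in S] [set Some k | k in ~: S] =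
  \prod_(i in S) \prod_(j in setT :\: S) crossf x i j.
Proof.
move=> ev; rewrite setTD.
rewrite /crossprod big_imset /=; last by move=> ? ? _ _ [].
transitivity (\prod_(i in S) \prod_(j in ~: S) (-1 * crossf x i j)).
  apply: eq_bigr => i _; rewrite big_imset /=; last by move=> ? ? _ _ [].
  by apply: eq_bigr => j _; rewrite /crossf mulN1r -[RHS]mulNr opprB.
under eq_bigr => i _ do rewrite big_split prodr_const /=.
by rewrite big_split prodr_const /= -exprM mulnC -signr_odd (negbTE ev) mul1r.
Qed.

(** The exponent count behind [q ^+ (r ^ 2)]: each of the ['C(2r, 2)] pairs contributes one [qh],
    and the factors [lam] supply [qh ^+ r] more. For [2r + 1] elements, [2r] additional pairs
    against [qh ^- r] leave the same power. *)
Let half_bin r : (r + 'C(r.*2, 2))%N = (2 * r ^ 2)%N.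
Proof.
elim: r => // r IH; rewrite doubleS !binS !bin1 bin0.
have -> : (r.+1 + ('C(r.*2, 2) + r.*2 + (r.*2 + 1)) = (r + 'C(r.*2, 2)) + (r.*2 * 2 + 2))%N by ring.
rewrite IH -mul2n; ring.
Qed.

Let qh_half r : qh ^+ 'C(r.*2, 2) * qh ^+ r = q ^+ (r ^ 2).
Proof. by rewrite -exprD addnC half_bin exprM qE. Qed.

Lemma Ze_pf_sum : ~~ odd n -> Ze_pf a c qh u (\row_i x i) =
  \sum_(S : {set 'I_n} | ~~ odd #|S|) gset q a c x setT S * zcore q a c u x setT S.
Proof.
(* A square root splits the coefficient of the second summand of [Qe] as [lam i * lam j]; over an
   even [S] only its square appears. *)
move=> oddn; pose kap := sqrtC (qh / (a * c)).
have kapE : kap ^+ 2 = qh / (a * c) by apply: sqrtCK.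
pose lam (o : option 'I_n) : F := if o is Some i then u * kap * x i * hfun a c (x i) else 0.
pose mu (o : option 'I_n) : F := if o is Some i then 1 else 0.
have NA : normal_pfaffian w _ _ := @schur qh lam qh0 _.
have NB : normal_pfaffian w _ _ := @schur 1 mu (oner_neq0 F) _.
have Some_inj : injective (@Some 'I_n) by move=> ? ? [].
have := normal_pfaffianE wA (normal_pfaffianD wA (NA _) (NB _)) oddn Some_inj.
have -> : \matrix_(i, j) (lam (Some i) * lam (Some j) * sig qh (Some i) (Some j) +
    mu (Some i) * mu (Some j) * sig 1 (Some i) (Some j)) =
    \matrix_(i < n, j < n) Qe a c qh u ((\row_k x k) 0 i) ((\row_k x k) 0 j).
  apply/matrixP => i j; rewrite !mxE !sig_eq !mul1r /lam /Qe addrC; congr (_ + _).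
  rewrite (_ : u ^+ 2 * qh / (a * c) = u ^+ 2 * kap ^+ 2); last by rewrite kapE mulrA.
  by ring.
have -> : upper_prod (fun i j => w (Some i) (Some j)) = prefactor (\row_i x i).
  by apply: eq_bigr => i _; apply: eq_bigr => j _; rewrite !mxE.
rewrite /Ze_pf => ->; first last.
- by move=> i j ij _ _; rewrite !mul1r x1.
- move=> i j ij li lj; have hn k : lam (Some k) != 0 -> hfun a c (x k) != 0.
    by rewrite /lam; apply: contraNneq => ->; rewrite mulr0.
  have -> : qh * x i * (qh * x j) = q * x i * x j by rewrite -qE; ring.
  by apply: qx => //; apply: hn.
rewrite /sum_pfaffian (eq_bigl (fun S : {set option 'I_n} => (None \notin S) && ~~ odd #|S|)); last first.
  move=> S; congr (_ && _); apply/idP/idP => [/subsetP H|H].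
    by apply/negP => /H; rewrite None_notin_imset.
  by apply/subsetP => -[j|]; [rewrite Some_in_imset | rewrite (negbTE H)].
rewrite (sum_sets_Some (fun k => ~~ odd k)); apply: eq_bigr => S oS.
have -> : [set Some k | k in [set: 'I_n]] :\: [set Some k | k in S] = [set Some k | k in ~: S].
  by apply/setP => -[j|]; rewrite !inE ?None_notin_imset ?andbF // !Some_in_imset !inE andbT.
rewrite cross_pair; last by rewrite oddM (negbTE oS).
rewrite pair_sigw pair_sigw1 pair_pairf.
rewrite [X in _ * (X * _) * _]big_imset /=; last by move=> ? ? _ _ [].
rewrite [X in _ * (X * 1)]big_imset /=; last by move=> ? ? _ _ [].
rewrite [X in _ * (X * 1)]big1 // !mulr1.
have -> : \prod_(i in S) (u * kap * x i * hfun a c (x i)) =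
    (u * kap) ^+ #|S| * (\prod_(i in S) x i) * \prod_(i in S) hfun a c (x i).
  by rewrite -prodr_const -!big_split.
rewrite /gset /zcore (negbTE oS) /gcoef.
have [r SE] : exists r, #|S| = r.*2.
  by exists #|S|./2; rewrite -[LHS]odd_double_half (negbTE oS).
have e2 (y : F) : y ^+ r.*2 = (y ^+ 2) ^+ r by rewrite -mul2n exprM.
rewrite !SE doubleK -qh_half !e2 sqrrN. rewrite [(u * kap) ^+ 2]exprMn kapE exprMn expr_div_n.
set C := \prod_(i in S) \prod_(j in _) _; set P := pairprod _ _.
set X := \prod_(i in S) x i; set H := \prod_(i in S) _.
by ring.
Qed.

Lemma Zo_pf_sum : odd n -> Zo_pf a c qh u (\row_i x i) =
  \sum_(S : {set 'I_n} | odd #|S|) gset q a c x setT S * zcore q a c u x setT S.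
Proof.
move=> oddn; pose kap := sqrtC (qh * a * c)^-1.
have kapE : kap ^+ 2 = (qh * a * c)^-1 by apply: sqrtCK.
have kap0 : kap != 0.
  have : kap ^+ 2 != 0 by rewrite kapE invr_eq0 !mulf_neq0.
  by rewrite expf_eq0.
(* The border value [kap^-1] cancels [kap], so the border entries become [u * h] up to sign. [mu]
   takes the factor [x i] of the first summand of [Qo] and vanishes at the border. *)
pose lam (o : option 'I_n) : F := if o is Some i then u * kap * hfun a c (x i) else kap^-1.
pose mu (o : option 'I_n) : F := if o is Some i then x i else 0.
have NA : normal_pfaffian w _ _ := @schur qh lam qh0 _.
have NB : normal_pfaffian w _ _ := @schur 1 mu (oner_neq0 F) _.
pose f (k : 'I_(n + 1)) : option 'I_n := if split k is inl i then Some i else None.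
have fl i : f (lshift 1 i) = Some i.
  by rewrite /f -[lshift 1 i]/(unsplit (inl i)) unsplitK.
have fr i : f (rshift n i) = None.
  by rewrite /f -[rshift n i]/(unsplit (inr i)) unsplitK.
have f_inj : injective f.
  move=> k l; case: (splitP k) => i ik; case: (splitP l) => j jl.
  - have -> : k = lshift 1 i by apply: val_inj.
    by have -> : l = lshift 1 j by [apply: val_inj]; rewrite !fl => -[->].
  - have -> : k = lshift 1 i by apply: val_inj.
    by have -> : l = rshift n j by [apply: val_inj]; rewrite fl fr.
  - have -> : k = rshift n i by apply: val_inj.
    by have -> : l = lshift 1 j by [apply: val_inj]; rewrite fl fr.
  - by move=> _; apply: val_inj; rewrite /= ik jl !ord1.
have oddn1 : ~~ odd (n + 1) by rewrite addn1 /= oddn.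
have := normal_pfaffianE wA (normal_pfaffianD wA (NA _) (NB _)) oddn1 f_inj.
have -> : \matrix_(i, j) (lam (f i) * lam (f j) * sig qh (f i) (f j) +
    mu (f i) * mu (f j) * sig 1 (f i) (f j)) =
   block_mx (\matrix_(i < n, j < n) Qo a c qh u ((\row_k x k) 0 i) ((\row_k x k) 0 j))
     (\col_(i < n) - (u * hfun a c ((\row_k x k) 0 i)))
     (\row_(j < n) (u * hfun a c ((\row_k x k) 0 j))) (0 : 'M_1).
  apply/matrixP => k l; rewrite [LHS]mxE; case: (splitP k) => i ik; case: (splitP l) => j jl.
  - have -> : k = lshift 1 i by apply: val_inj.
    have -> : l = lshift 1 j by apply: val_inj.
    rewrite block_mxEul !fl !mxE !sig_eq !mul1r /lam /mu /Qo addrC; congr (_ + _).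
    rewrite (_ : u ^+ 2 / (qh * a * c) = u ^+ 2 * kap ^+ 2); last by rewrite kapE.
    by ring.
  - have -> : k = lshift 1 i by apply: val_inj.
    have -> : l = rshift n j by apply: val_inj.
    rewrite block_mxEur fl fr !mxE /sig /bordered_S /= /lam /mu mulr0 mul0r addr0.
    by field.
  - have -> : k = rshift n i by apply: val_inj.
    have -> : l = lshift 1 j by apply: val_inj.
    rewrite block_mxEdl fl fr !mxE /sig /bordered_S /= /lam /mu !mul0r addr0.
    by field.
  - have -> : k = rshift n i by apply: val_inj.
    have -> : l = rshift n j by apply: val_inj.
    by rewrite block_mxEdr !fr !mxE /sig /bordered_S /= !mulr0 addr0.
have -> : upper_prod (fun i j => w (f i) (f j)) = prefactor (\row_i x i).
  rewrite /upper_prod big_split_ord /= [X in _ * X]big1 ?mulr1; last first.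
    move=> i _; rewrite big1 // => j; rewrite /= (ord1 i) addn0 => nj.
    by have := ltn_ord j; rewrite [X in (_ < X)%N]addn1 ltnS leqNgt nj.
  apply: eq_bigr => i _; rewrite big_mkcond big_split_ord /= [X in _ * X]big1 ?mulr1; last first.
    by move=> j _; rewrite fl fr /= if_same.
  by rewrite -big_mkcond; apply: eq_bigr => j _; rewrite !fl !mxE.
rewrite /Zo_pf => ->; first last.
- by move=> i j ij _ _; rewrite !mul1r x1.
- move=> i j ij li lj; have hn k : lam (Some k) != 0 -> hfun a c (x k) != 0.
    by rewrite /lam; apply: contraNneq => ->; rewrite mulr0.
  have -> : qh * x i * (qh * x j) = q * x i * x j by rewrite -qE; ring.
  by apply: qx => //; apply: hn.
have -> : f @: setT = setT.
  apply/setP => -[i|]; rewrite inE; apply/imsetP; last by exists (rshift n ord0).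
  by exists (lshift 1 i).
(* A set omitting the border leaves it to the complement, where [mu] gives 0. The remaining even
   sets are the border together with an odd set of variables. *)
rewrite /sum_pfaffian (bigID (fun S : {set option 'I_n} => None \in S)) /= [X in _ + X]big1 ?addr0; last first.
  move=> S /andP[_ nS]; rewrite [\prod_(o in setT :\: S) mu o](big_setD1 None) /=; last first.
    by rewrite !inE nS.
  by rewrite !mul0r mulr0.
rewrite (eq_bigl (fun S : {set option 'I_n} => (None \in S) && ~~ odd #|S|)); last first.
  by move=> S; rewrite subsetT andbC.
rewrite (sum_sets_None (fun k => ~~ odd k)) /=.
rewrite [LHS](eq_bigl (fun S : {set 'I_n} => odd #|S|)); last by move=> S; rewrite /= ?negbK.
apply: eq_bigr => S oS.
have oCS : ~~ odd #|~: S|.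
  have : odd n = odd #|S| (+) odd #|~: S| by rewrite -oddD cardsC card_ord.
  by rewrite oddn oS; case: odd.
have nS : None \notin [set Some k | k in S] by rewrite None_notin_imset.
have -> : [set: option 'I_n] :\: (None |: [set Some k | k in S]) = [set Some k | k in ~: S].
  by apply/setP => -[j|]; rewrite !inE ?None_notin_imset // !Some_in_imset !inE andbT.
rewrite [crossprod _ _ _]big_setU1 //= -/(crossprod _ _ _).
rewrite cross_pair; last by rewrite oddM (negbTE oCS) andbF.
rewrite [X in X * _ * _ * _]big_imset /=; last by move=> ? ? _ _ [].
rewrite prodr_const -signr_odd (negbTE oCS) expr0 mul1r.
rewrite pairprodU1 //; last first.
  by move=> o; case: (eqVneq o None) => [->//|op]; rewrite [sig qh o None]bordered_SA // [w o None]wA // mulrNN.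
rewrite pair_sigw pair_sigw1 pair_pairf.
rewrite [\prod_(k in [set Some _ | _ in S]) _]big_imset /=; last by move=> ? ? _ _ [].
rewrite [\prod_(i in None |: _) _]big_setU1 //= [\prod_(i in [set Some _ | _ in S]) _]big_imset /=; last by move=> ? ? _ _ [].
rewrite [\prod_(i in [set Some _ | _ in ~: S]) _]big_imset /=; last by move=> ? ? _ _ [].
(* The pairs formed with the border supply the sign of [(- u) ^+ #|S|] for odd [#|S|]. *)
have -> : \prod_(i in S) (sig qh None (Some i) * -1) = -1.
  rewrite (eq_bigr (fun=> -1)); first by rewrite prodr_const -signr_odd oS expr1.
  by move=> k _; rewrite /sig /bordered_S /= mul1r.
rewrite mulr1.
have -> : \prod_(i in S) (u * kap * hfun a c (x i)) =
    (u * kap) ^+ #|S| * \prod_(i in S) hfun a c (x i).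
  by rewrite -prodr_const -!big_split.
rewrite /gset /zcore oS /gcoef setTD.
have [r SE] : exists r, #|S| = r.*2.+1.
  by exists #|S|./2; rewrite -[LHS]odd_double_half oS.
have e2 (y : F) : y ^+ r.*2 = (y ^+ 2) ^+ r by rewrite -mul2n exprM.
have -> : #|S|./2 = r by rewrite SE /= uphalf_double.
rewrite !SE -qh_half binS bin1 exprD !exprS !e2 sqrrN [(u * kap) ^+ 2]exprMn kapE exprMn exprVn.
rewrite [(qh ^+ 2) ^+ r]exprAC expr2 -[qh * a * c]mulrA [(qh * _) ^+ r]exprMn.
have ac0 : (a * c) ^+ r != 0 by rewrite expf_neq0 ?mulf_neq0.
have qr0 : qh ^+ r != 0 by rewrite expf_neq0.
set C := \prod_(i in S) \prod_(j in _) _; set P := pairprod _ _.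
set X := \prod_(i in ~: S) x i; set H := \prod_(i in S) _.
move: ((a * c) ^+ r) ac0 (qh ^+ r) qr0 (qh ^+ 'C(_, _)) => A A0 Q Q0 B.
by field; rewrite A0 Q0 kap0.
Qed.

End Assembly.

(** * Parity components and the theorem *)

Section ZsumTransfer.
Variables (F : fieldType) (q a c u : F).

Lemma zsum_imset (I J : finType) (f : I -> J) (y : J -> F) (T : {set I}) : injective f ->
  zsum q a c u y (f @: T) = zsum q a c u (y \o f) T.
Proof.
move=> fI; rewrite /zsum.
rewrite (reindex_onto (fun S : {set I} => f @: S) (fun S : {set J} => f @^-1: S)) /=; last first.
  move=> S ST; apply/setP => j; apply/imsetP/idP => [ [ k ] | jS]; first by rewrite inE => ? ->.
  by have /imsetP[i _ jE] := subsetP ST j jS; exists i; rewrite ?inE -?jE.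
have fK (S : {set I}) : f @^-1: (f @: S) = S by apply/setP => i; rewrite inE mem_imset.
have fD (S : {set I}) : (f @: T) :\: (f @: S) = f @: (T :\: S).
  apply/setP => j; apply/idP/imsetP => [|[ i ]]; rewrite !inE.
    case/andP=> jS /imsetP[i iT jE]; exists i => //; rewrite inE iT andbT.
    by apply: contraNN jS => iS; rewrite jE imset_f.
  by move=> /andP[iS iT] ->; rewrite !mem_imset // iS iT.
have big (A : {set I}) (g : J -> F) : \prod_(j in f @: A) g j = \prod_(i in A) g (f i).
  by rewrite big_imset //= => ? ? _ _; apply: fI.
apply: eq_big => [S|S _].
  rewrite fK eqxx andbT; apply/idP/idP => [/subsetP H|]; last exact: imsetS.
  by apply/subsetP => i iS; rewrite -(mem_imset T _ fI) H // imset_f.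
rewrite /gset /zcore card_imset // fD pairprod_imset //; last by move=> i j; apply: pairfC.
rewrite !big; congr (_ * _ * (_ * _ * _ * _)); first by case: odd; rewrite big.
by apply: eq_bigr => i _; rewrite big.
Qed.

Lemma zcoreN (I : finType) (x : I -> F) (T S : {set I}) :
  zcore q a c (- u) x T S = (-1) ^+ #|S| * zcore q a c u x T S.
Proof. by rewrite /zcore -[- - u]mulN1r exprMn !mulrA. Qed.

(** Writing the parity components through the whole sum at [u] and [- u] lets the removal of a
    variable equal to 1, available for the whole sum, pass to each component. *)
Lemma zsum_even (I : finType) (x : I -> F) :
  2 * (\sum_(S : {set I} | ~~ odd #|S|) gset q a c x setT S * zcore q a c u x setT S) =
  zsum q a c u x setT + zsum q a c (- u) x setT.
Proof.
rewrite /zsum -big_split big_distrr big_mkcond [RHS]big_mkcond /=; apply: eq_bigr => S _.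
rewrite subsetT zcoreN -signr_odd; case: odd => /=; ring.
Qed.

Lemma zsum_odd (I : finType) (x : I -> F) :
  2 * (\sum_(S : {set I} | odd #|S|) gset q a c x setT S * zcore q a c u x setT S) =
  zsum q a c u x setT - zsum q a c (- u) x setT.
Proof.
rewrite /zsum -sumrB big_distrr big_mkcond [RHS]big_mkcond /=; apply: eq_bigr => S _.
rewrite subsetT zcoreN -signr_odd; case: odd => /=; ring.
Qed.

Lemma Zsum_zsum m (x : 'rV[F]_m) : Zsum q a c u x = zsum q a c u (fun i => x 0 i) setT.
Proof.
rewrite /Zsum /zsum; apply: eq_big => [S|S _]; first by rewrite subsetT.
rewrite /gset /zcore setTD !mulrA; congr (_ * _ * _ * _).
  by rewrite [RHS]mulrC /gcoef !mulrA.
by apply: eq_bigr => i _; apply: eq_bigl => j; rewrite !enum_rank_ord.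
Qed.

Lemma zsum_append1 m (x : 'rV[F]_m) : (forall i, x 0 i != 1) ->
  zsum q a c u (fun k => append1 x 0 k) setT = zsum q a c u (fun i => x 0 i) setT.
Proof.
move=> x1.
have -> : [set: 'I_(m + 1)] = rshift m ord0 |: [set lshift 1 i | i in setT].
  apply/setP => k; rewrite !inE; case: (split_ordP k) => i ->.
    by rewrite imset_f ?orbT.
  by rewrite (ord1 i) eqxx.
have xl i : append1 x 0 (lshift 1 i) = x 0 i by rewrite /append1 row_mxEl.
have xr : append1 x 0 (rshift m ord0) = 1 by rewrite /append1 row_mxEr mxE.
rewrite (@zsum_h0 _ _ _ _ _ _ _ _ _ 1) ?expr1n //.
- rewrite zsum_imset; last exact: lshift_inj.
  by congr zsum; apply: funext => i /=; rewrite xl.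
- by apply/imsetP => -[i _ /eqP]; rewrite eq_sym eq_lrshift.
- by move=> _ /imsetP[i _ ->]; rewrite xl.
Qed.

End ZsumTransfer.

Section ParityComponents.
Variables (F : numClosedFieldType) (q qh a c u : F) (m : nat) (x : 'rV[F]_m).
Hypotheses (qE : qh ^+ 2 = q) (q0 : q != 0) (a0 : a != 0) (c0 : c != 0).
Hypothesis xx : forall i j : 'I_m, i != j -> x 0 i != x 0 j.
Hypothesis qxx : forall i j : 'I_m, i != j -> q * x 0 i * x 0 j != 1.
Hypothesis x1 : forall i : 'I_m, x 0 i != 1.
Hypothesis xx1 : forall i j : 'I_m, i != j -> x 0 i * x 0 j != 1.

Let y (k : 'I_(m + 1)) := append1 x 0 k.

Let yl i : y (lshift 1 i) = x 0 i. Proof. by rewrite /y /append1 row_mxEl. Qed.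
Let yr i : y (rshift m i) = 1. Proof. by rewrite /y /append1 row_mxEr mxE. Qed.

Let h1 : hfun a c 1 = 0. Proof. by rewrite /hfun expr1n subrr mulr0 mul0r. Qed.

Let yy k l : k != l -> y k != y l.
Proof.
case: (split_ordP k) => i ->; case: (split_ordP l) => j ->; rewrite ?yl ?yr.
- by rewrite eq_lshift; apply: xx.
- by move=> _; apply: x1.
- by move=> _; rewrite eq_sym x1.
- by rewrite !ord1 eqxx.
Qed.

Let yy1 k l : k != l -> y k * y l != 1.
Proof.
case: (split_ordP k) => i ->; case: (split_ordP l) => j ->; rewrite ?yl ?yr ?mulr1 ?mul1r.
- by rewrite eq_lshift; apply: xx1.
- by move=> _; apply: x1.
- by move=> _; apply: x1.
- by rewrite !ord1 eqxx.
Qed.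

(** A pair formed with the appended 1 may hit the pole [q * x i = 1]; it is harmless because [h]
    vanishes at 1, and this is why the condition is restricted to nonzero values of [h]. *)
Let qyy k l : k != l -> hfun a c (y k) != 0 -> hfun a c (y l) != 0 -> q * y k * y l != 1.
Proof.
case: (split_ordP k) => i ->; case: (split_ordP l) => j ->; rewrite ?yl ?yr ?h1 ?eqxx //.
by rewrite eq_lshift => ij _ _; apply: qxx.
Qed.

Let yE : \row_k y k = append1 x. Proof. by apply/rowP => k; rewrite mxE. Qed.
Let xE : \row_i x 0 i = x. Proof. by apply/rowP => k; rewrite mxE. Qed.

Lemma Ze_zsum : 2 * Ze a c qh u x = Zsum q a c u x + Zsum q a c (- u) x.
Proof.
rewrite !Zsum_zsum /Ze; case: ifPn => om.
  rewrite -yE (Ze_pf_sum u qE) ?addn1 /= ?om // zsum_even.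
  by rewrite !zsum_append1.
rewrite -{1}xE (Ze_pf_sum u qE) // ?zsum_even // => i j ij _ _; exact: qxx.
Qed.

Lemma Zo_zsum : 2 * Zo a c qh u x = Zsum q a c u x - Zsum q a c (- u) x.
Proof.
rewrite !Zsum_zsum /Zo; case: ifPn => om.
  rewrite -{1}xE (Zo_pf_sum u qE) // ?zsum_odd // => i j ij _ _; exact: qxx.
rewrite -yE (Zo_pf_sum u qE) ?addn1 /= ?om // zsum_odd.
by rewrite !zsum_append1.
Qed.

End ParityComponents.

Theorem theorem4p14 (R : realType) (q qh a c : R[i]) (m : nat) (x : 'rV[R[i]]_m) :
  qh ^+ 2 = q ->
  (1 <= m)%N ->
  a != 0 -> c != 0 ->
  (forall i : 'I_m, x 0 i != a) ->
  (forall i : 'I_m, x 0 i != c) ->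
  (forall i j : 'I_m, i != j -> x 0 i != x 0 j) ->
  (forall i j : 'I_m, i != j -> q * x 0 i * x 0 j != 1) ->
  (q != 0 -> a != 1 -> c != 1 ->
   (forall i : 'I_m, x 0 i != 1) ->
   (forall i j : 'I_m, i != j -> x 0 i * x 0 j != 1) ->
   forall u : R[i], Ze a c qh u x + Zo a c qh u x = Zsum q a c u x)
  /\ partition_function q a c x = Zsum q a c 1 x.
Proof.
move=> qE _ a0 c0 xa xc xx qxx; split=> [q0 _ _ x1 xx1 u|].
  have n2 : (2 : R[i]) != 0 by rewrite (pnatr_eq0 _ 2).
  apply: (mulfI n2).
  rewrite mulrDr (@Ze_zsum _ q qh a c u m x qE) // (@Zo_zsum _ q qh a c u m x qE) //.
  by ring.
rewrite partition_function_zlat zlat_zsum ?enum_uniq //; last first.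
  by move=> i j ij; rewrite mulrA subr_eq0 eq_sym qxx.
by rewrite Zsum_zsum; congr zsum; apply/setP => i; rewrite !inE mem_enum.
Qed.
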